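(* Let $p>1$, $0<s<1$, let $\Omega\subset\mathbb{R}^n$ be a bounded open set, $K\Subset\Omega$, and $\delta>0$. Let $u\in C(\overline{\Omega_\delta})\cap V^{s,p}_0(\Omega|\mathbb{R}^n)$ satisfy $u>0$ in $\Omega$ and $$-2(\operatorname{diam}\Omega)^{-(n+ps)}\int_K u^{p-1}(y)\,dy\le(-\Delta_p)^su\le1\quad\text{in }\Omega$$ in the locally weak sense. Suppose that either (i) $u(x_0)\ge D$, or (ii) $\|u\|_{L^q(\Omega\setminus K)}\ge D$, where $x_0\in\Omega\setminus K$ is a fixed point and $D>0$, $1\le q<\infty$ are fixed constants. Then $$\sup_B u\le C\inf_B u$$ for every subset $B\Subset\Omega$, where $C$ is a positive constant which depends on $\Omega,\delta,K,n,s,p,D$, and $x_0$ or $q$.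
   Context: $K\Subset\Omega$ means $\overline K\subset\Omega$. $\Omega_\delta:=\{x\in\mathbb{R}^n:\operatorname{dist}(x,\overline\Omega)<\delta\}$; $C(\overline{\Omega_\delta})$ means that the restriction to the closure of $\Omega_\delta$ is continuous. $V^{s,p}(\Omega|\mathbb{R}^n)$ is the set of $u:\mathbb{R}^n\to\mathbb{R}$ with $u|_\Omega\in L^p(\Omega)$ and $\frac{u(x)-u(y)}{|x-y|^{n/p+s}}\in L^p(\Omega\times\mathbb{R}^n)$. $V^{s,p}_0(\Omega|\mathbb{R}^n)$ is the completion of $C_0^\infty(\Omega)$ in $V^{s,p}(\Omega|\mathbb{R}^n)$ with respect to $[u]_{V^{s,p}(\mathbb{R}^n)}=\big(\iint_{\mathbb{R}^n\times\mathbb{R}^n}\frac{|u(x)-u(y)|^p}{|x-y|^{n+ps}}dxdy\big)^{1/p}$. $L^{p-1}_{ps}(\mathbb{R}^n)$ is the set of measurable $u$ with $\int_{\mathbb{R}^n}\frac{|u(x)|^{p-1}}{1+|x|^{n+ps}}dx<\infty$; $V^{s,p}_{\mathrm{loc}}(\Omega|\mathbb{R}^n)$ is the set of $u:\mathbb{R}^n\to\mathbb{R}$ with $\int_{F}|u|^pdx+\int_{F\times\mathbb{R}^n}\frac{|u(x)-u(y)|^p}{|x-y|^{n+ps}}dxdy<\infty$ for every compact $F\subset\Omega$. For $f\in L^1_{\mathrm{loc}}(\Omega)$ and $u\in L^{p-1}_{ps}(\mathbb{R}^n)\cap V^{s,p}_{\mathrm{loc}}(\Omega|\mathbb{R}^n)$,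 $(-\Delta_p)^su\le f$ (resp. $\ge f$) in $\Omega$ in the locally weak sense means $$\iint_{\mathbb{R}^n\times\mathbb{R}^n}\frac{|u(x)-u(y)|^{p-2}(u(x)-u(y))(\phi(x)-\phi(y))}{|x-y|^{n+ps}}dxdy\le\int_\Omega f\phi\,dx\quad(\text{resp. }\ge)$$ for all non-negative $\phi\in C_0^\infty(\Omega)$.
   Formalization: The constant C is allowed to depend on B as well: a C independent of B is impossible since u vanishes at boundary points of Ω (e.g. the torsion function of a ball, p=2); K is also taken measurable so that the integrals make sense. *)

(* Defs.v *)
From HB Require Import structures.
From mathcomp Require Import all_boot all_order all_algebra.
From mathcomp Require Import all_classical all_reals all_analysis.
Import Order.TTheory GRing.Theory Num.Theory.
Import numFieldNormedType.Exports.

Set Implicit Arguments.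
Unset Strict Implicit.
Unset Printing Implicit Defensive.

Local Open Scope classical_set_scope.
Local Open Scope ring_scope.

(* R^n with the sigma-algebra generated by the coordinate maps, i.e. the
   product (= Borel) sigma-algebra. *)
Definition borelRn (R : realType) (n : nat) := 'rV[R]_n.

Definition borelRn_display : measure_display.
Proof. exact. Qed.

Section borelRn.
Context {R : realType} {n : nat}.

Definition coordRn : 'I_n -> borelRn R n -> measurableTypeR R := fun i x => x ord0 i.

Let borelRn_set0 : g_sigma_preimage coordRn set0.
Proof. exact: sigma_algebra0. Qed.

Let borelRn_setC A : g_sigma_preimage coordRn A -> g_sigma_preimage coordRn (~` A).
Proof. exact: sigma_algebraC. Qed.

Let borelRn_bigcup (F : _^nat) : (forall i, g_sigma_preimage coordRn (F i)) ->
  g_sigma_preimage coordRn (\bigcup_i (F i)).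
Proof. exact: sigma_algebra_bigcup. Qed.

HB.instance Definition _ := Pointed.copy (borelRn R n) 'rV[R]_n.
HB.instance Definition _ := @isMeasurable.Build borelRn_display
  (borelRn R n) (g_sigma_preimage coordRn)
  borelRn_set0 borelRn_setC borelRn_bigcup.

Lemma measurable_coordRn i : measurable_fun [set: borelRn R n] (coordRn i).
Proof.
move=> _ Y mY; rewrite setTI; apply: sub_sigma_algebra => /=.
rewrite -bigcup_seq/=; exists i => /=; first by rewrite mem_index_enum.
by exists Y => //; rewrite setTI.
Qed.

Lemma measurable_to_borelRn d (T : measurableType d) (f : T -> borelRn R n) :
  (forall i, measurable_fun [set: T] (coordRn i \o f)) ->
  measurable_fun [set: T] f.
Proof.
move=> mf _ A mA; rewrite setTI.
suff H : g_sigma_preimage coordRn `<=` [set A | d.-measurable (f @^-1` A)].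
  exact: H.
apply: smallest_sub.
  split => /=.
  - by rewrite preimage_set0.
  - move=> B mB; rewrite setTD preimage_setC; exact: measurableC.
  - by move=> F mF; rewrite preimage_bigcup; exact: bigcup_measurable.
rewrite -bigcup_seq => B [i _ /= [C mC <-]].
by rewrite !setTI -[_ @^-1` _]setTI -comp_preimage; exact: mf.
Qed.

End borelRn.

Definition consRn (R : realType) (n : nat) (z : measurableTypeR R * borelRn R n) :
    borelRn R n.+1 :=
  \row_i (if unlift ord0 i is Some j then z.2 ord0 j else z.1).

Lemma measurable_consRn (R : realType) (n : nat) :
  measurable_fun [set: measurableTypeR R * borelRn R n] (@consRn R n).
Proof.
apply: measurable_to_borelRn => i.
case: (unliftP ord0 i) => [j ->|->].
  rewrite (_ : _ \o _ = coordRn j \o snd).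
    by apply: measurableT_comp; [exact: measurable_coordRn|
                                 exact: measurable_snd].
  by apply/funext => z /=; rewrite /coordRn /consRn mxE liftK.
rewrite (_ : _ \o _ = fst); first exact: measurable_fst.
by apply/funext => z /=; rewrite /coordRn /consRn mxE unlift_none.
Qed.

(* n-fold product of the one-dimensional Lebesgue measure, transported from
   R * R^n to R^(n+1). *)
Fixpoint borel_lebesgueRn (R : realType) (n : nat) :
    set (borelRn R n) -> \bar R :=
  match n with
  | 0 => @dirac _ (borelRn R 0) (0 : 'rV[R]_0) R
  | m.+1 => pushforward (lebesgue_measure \x @borel_lebesgueRn R m)%E
              (@consRn R m)
  end.

Section consRn_measure.
Context {R : realType} {n : nat}.
Variable mu : {sigma_finite_measure set (borelRn R n) -> \bar R}.
Local Open Scope ereal_scope.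

Let leb : {sigma_finite_measure set (measurableTypeR R) -> \bar R} :=
  @lebesgue_measure R.
Let prd : {measure set (measurableTypeR R * borelRn R n)%type -> \bar R} :=
  leb \x mu.

Let prd_sigma_finite : sigma_finite setT prd.
Proof.
have /sigma_finiteP[F [TF ndF Foo]] := sigma_finiteT leb.
have /sigma_finiteP[G [TG ndG Goo]] := sigma_finiteT mu.
exists (fun k => F k `*` G k).
  rewrite -setXTT TF TG predeqE => -[x y]; split.
    move=> [/= [k _ Fkx] [l _ Gly]]; exists (maxn k l) => //; split.
    - by move: x Fkx; exact/subsetPset/ndF/leq_maxl.
    - by move: y Gly; exact/subsetPset/ndG/leq_maxr.
  by move=> [k _ []/= ? ?]; split; exists k.
move=> k; have [? ?] := Foo k; have [? ?] := Goo k.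
split; first exact: measurableX.
by rewrite /prd/= product_measure1E// lte_mul_pinfty// ge0_fin_numE.
Qed.

Definition consRn_measure := pushforward prd (@consRn R n).

Let mcons (A : set (borelRn R n.+1)) :
  measurable A -> measurable (@consRn R n @^-1` A).
Proof. by move=> mA; rewrite -[_ @^-1` _]setTI; exact: measurable_consRn. Qed.

Let consRn_measure0 : consRn_measure set0 = 0.
Proof. by rewrite /consRn_measure /pushforward preimage_set0 measure0. Qed.

Let consRn_measure_ge0 A : 0 <= consRn_measure A.
Proof. exact: (measure_ge0 prd). Qed.

Let consRn_measure_sigma_additive : semi_sigma_additive consRn_measure.
Proof.
move=> F mF tF mUF; rewrite /consRn_measure /pushforward preimage_bigcup.
apply: measure_semi_sigma_additive.
- by move=> k; exact: mcons.
- apply/trivIsetP => /= i j _ _ ij; rewrite -preimage_setI.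
  by move/trivIsetP : tF => /(_ _ _ _ _ ij) ->//; rewrite preimage_set0.
- by rewrite -preimage_bigcup; exact: mcons.
Qed.

HB.instance Definition _ := isMeasure.Build _ _ _ consRn_measure
  consRn_measure0 consRn_measure_ge0 consRn_measure_sigma_additive.

Let consRn_measure_sigma_finite : sigma_finite setT consRn_measure.
Proof.
pose g (x : borelRn R n.+1) : (measurableTypeR R * borelRn R n)%type :=
  (x ord0 ord0, \row_j x ord0 (lift ord0 j)).
have Kg : cancel (@consRn R n) g.
  move=> [a y]; rewrite /g mxE unlift_none; congr pair.
  by apply/rowP => j; rewrite !mxE liftK.
have mg : measurable_fun setT g.
  apply: measurable_fun_pair; first exact: (@measurable_coordRn R n.+1 ord0).
  apply: measurable_to_borelRn => j.
  rewrite (_ : _ \o _ = coordRn (lift ord0 j)); first exact: measurable_coordRn.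
  by apply/funext => x; rewrite /= /coordRn mxE.
have [F FT Foo]  := prd_sigma_finite.
exists (fun k => g @^-1` F k); first by rewrite -preimage_bigcup -FT.
move=> k; have [mF Fk] := Foo k; split.
  by rewrite -[_ @^-1` _]setTI; exact: mg.
rewrite /consRn_measure /pushforward -comp_preimage (_ : g \o _ = id)//.
by apply/funext => z; exact: Kg.
Qed.

HB.instance Definition _ := Measure_isSigmaFinite.Build _ _ _ consRn_measure
  consRn_measure_sigma_finite.

End consRn_measure.

Section borel_lebesgueRn.
Context {R : realType}.
Local Open Scope ereal_scope.

Lemma borel_lebesgueRn_sigma_finite_measure n :
  exists mu : {sigma_finite_measure set (borelRn R n) -> \bar R},
    mu = @borel_lebesgueRn R n :> (set _ -> \bar R).
Proof.
elim: n => [|n [mu muE]].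
  by exists (@dirac _ (borelRn R 0) (0%R : 'rV[R]_0) R).
by exists (consRn_measure mu); rewrite /= /consRn_measure/= muE.
Qed.

Context {n : nat}.

Let borel_lebesgueRn0 : @borel_lebesgueRn R n set0 = 0.
Proof.
by have [mu <-] := borel_lebesgueRn_sigma_finite_measure n; exact: measure0.
Qed.

Let borel_lebesgueRn_ge0 A : 0 <= @borel_lebesgueRn R n A.
Proof.
by have [mu <-] := borel_lebesgueRn_sigma_finite_measure n; exact: measure_ge0.
Qed.

Let borel_lebesgueRn_sigma_additive : semi_sigma_additive (@borel_lebesgueRn R n).
Proof.
have [mu <-] := borel_lebesgueRn_sigma_finite_measure n.
exact: measure_semi_sigma_additive.
Qed.

HB.instance Definition _ := isMeasure.Build _ _ _ (@borel_lebesgueRn R n)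
  borel_lebesgueRn0 borel_lebesgueRn_ge0 borel_lebesgueRn_sigma_additive.

Let borel_lebesgueRn_sigma_finite : sigma_finite setT (@borel_lebesgueRn R n).
Proof.
have [mu <-] := borel_lebesgueRn_sigma_finite_measure n.
exact: sigma_finiteT.
Qed.

HB.instance Definition _ := Measure_isSigmaFinite.Build _ _ _
  (@borel_lebesgueRn R n) borel_lebesgueRn_sigma_finite.

End borel_lebesgueRn.

(* R^n with the sigma-algebra of Lebesgue-measurable sets, and the (complete)
   Lebesgue measure on it. *)
Definition Rn (R : realType) (n : nat) :=
  caratheodory_type (mu_ext (@borel_lebesgueRn R n)).

HB.instance Definition _ (R : realType) (n : nat) :=
  Measurable.copy (Rn R n)
    (caratheodory_type (mu_ext (@borel_lebesgueRn R n))).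

Definition lebesgueRn {R : realType} {n : nat} : set (Rn R n) -> \bar R :=
  @completed_measure_extension _ (borelRn R n) R (@borel_lebesgueRn R n).

HB.instance Definition _ (R : realType) (n : nat) :=
  Measure.on (@lebesgueRn R n).

Lemma lebesgueRn_sigma_finite (R : realType) (n : nat) :
  sigma_finite setT (@lebesgueRn R n).
Proof. exact/completed_measure_extension_sigma_finite/sigma_finiteT. Qed.

HB.instance Definition _ (R : realType) (n : nat) :=
  Measure_isSigmaFinite.Build _ _ _ (@lebesgueRn R n)
    (@lebesgueRn_sigma_finite R n).

Section euclidean.
Context {R : realType} {n : nat}.
Implicit Types (x y : 'rV[R]_n) (A : set 'rV[R]_n).

(* The library norm of 'rV[R]_n is the sup norm: it induces the same topology
   and bounded sets, but distances have to be Euclidean. *)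
Definition enorm x : R := Num.sqrt (\sum_(i < n) x ord0 i ^+ 2).

Definition diam A : R := sup [set enorm (z.1 - z.2) | z in A `*` A].

Definition edist x A : \bar R := ereal_inf [set (enorm (x - y))%:E | y in A].

Definition neighborhood A (delta : R) : set 'rV[R]_n :=
  [set x | (edist x (closure A) < delta%:E)%E].

Definition compactly_contained (K A : set 'rV[R]_n) : Prop := closure K `<=` A.

End euclidean.

Section test_functions.
Context {R : realType} {n : nat}.

Definition partial (i : 'I_n) (f : 'rV[R]_n -> R) : 'rV[R]_n -> R :=
  fun x => 'D_(delta_mx ord0 i) f x.

Definition smooth (f : 'rV[R]_n -> R) : Prop :=
  forall l : seq 'I_n, let g := foldr partial f l in
    continuous g /\ forall i x, derivable g x (delta_mx ord0 i).

Definition test_function (Omega : set 'rV[R]_n) (phi : 'rV[R]_n -> R) : Prop :=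
  let supp := closure [set x | phi x != 0] in
  [/\ smooth phi, compact supp & supp `<=` Omega].

End test_functions.

Section Lp.
Context d (T : measurableType d) (R : realType).
Variable mu : {measure set T -> \bar R}.
Local Open Scope ereal_scope.

Definition LpNorm (D : set T) (p : R) (f : T -> R) : \bar R :=
  'N[mu]_p%:E[EFin \o (f \_ D)%R].

Definition in_Lp (D : set T) (p : R) (f : T -> R) : Prop :=
  measurable_fun D f /\ LpNorm D p f < +oo.

End Lp.

Section fractional.
Context {R : realType} {n : nat}.
Implicit Types (Omega F : set 'rV[R]_n) (u f phi : 'rV[R]_n -> R) (s p : R).

Let mu : {measure set (Rn R n) -> \bar R} := @lebesgueRn R n.
Let mu2 : {measure set (Rn R n * Rn R n)%type -> \bar R} :=
  (@lebesgueRn R n \x @lebesgueRn R n)%E.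

(* |u(x) - u(y)|^p / |x - y|^(n + ps); division by zero yields 0 on the
   diagonal, which is a null set. *)
Definition gagliardo_density s p u (z : Rn R n * Rn R n) : R :=
  `|u z.1 - u z.2| `^ p / enorm (z.1 - z.2 : 'rV[R]_n) `^ (n%:R + p * s).

Definition gagliardo_seminorm s p u : \bar R :=
  ((\int[mu2]_z (gagliardo_density s p u z)%:E) `^ p^-1)%E.

Definition in_V s p Omega u : Prop :=
  in_Lp mu Omega p u /\
  in_Lp mu2 (Omega `*` setT) p (fun z : Rn R n * Rn R n =>
    (u z.1 - u z.2) / enorm (z.1 - z.2 : 'rV[R]_n) `^ (n%:R / p + s)).

(* The limit of an approximating sequence is taken in V^{s,p}(Omega|R^n), which
   embeds in L^p(Omega): convergence in the seminorm alone would determine u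
   only up to an additive constant. For bounded Omega the L^p(Omega)
   convergence of seminorm-Cauchy sequences of test functions is automatic, by
   the fractional Poincare inequality. *)
Definition in_V0 s p Omega u : Prop :=
  in_V s p Omega u /\
  exists phi : nat -> 'rV[R]_n -> R,
    [/\ forall k, test_function Omega (phi k),
        gagliardo_seminorm s p (fun x => u x - phi k x) @[k --> \oo] --> 0%E &
        LpNorm mu Omega p (fun x : Rn R n => u x - phi k x) @[k --> \oo]
          --> 0%E].

Definition in_tail_space s p u : Prop :=
  measurable_fun [set: Rn R n] (u : Rn R n -> R) /\
  (\int[mu]_x (`|u x| `^ (p - 1) / (1 + enorm x `^ (n%:R + p * s)))%:E
     < +oo)%E.

Definition in_V_loc s p Omega u : Prop :=
  measurable_fun [set: Rn R n] (u : Rn R n -> R) /\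
  forall F, compact F -> F `<=` Omega ->
    (\int[mu]_(x in F) (`|u x| `^ p)%:E +
     \int[mu2]_(z in F `*` setT) (gagliardo_density s p u z)%:E < +oo)%E.

Definition in_L1_loc Omega f : Prop :=
  forall F, compact F -> F `<=` Omega -> mu.-integrable F (EFin \o f).

Definition weak_form s p u phi : \bar R :=
  (\int[mu2]_z (`|u z.1 - u z.2| `^ (p - 2) * (u z.1 - u z.2) *
      (phi z.1 - phi z.2) /
    enorm (z.1 - z.2 : 'rV[R]_n) `^ (n%:R + p * s))%:E)%E.

Definition fracplap_le s p Omega u f : Prop :=
  [/\ in_L1_loc Omega f, in_tail_space s p u, in_V_loc s p Omega u &
      forall phi, test_function Omega phi -> (forall x, 0 <= phi x) ->
        (weak_form s p u phi <= \int[mu]_(x in Omega) (f x * phi x)%:E)%E].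

Definition fracplap_ge s p Omega u f : Prop :=
  [/\ in_L1_loc Omega f, in_tail_space s p u, in_V_loc s p Omega u &
      forall phi, test_function Omega phi -> (forall x, 0 <= phi x) ->
        (\int[mu]_(x in Omega) (f x * phi x)%:E <= weak_form s p u phi)%E].

End fractional.

(* Main.v *)
Require Import Defs.
From HB Require Import structures.
From mathcomp Require Import all_boot all_order all_algebra.
From mathcomp Require Import all_classical all_reals all_analysis.
From mathcomp Require Import measurable_realfun ring lra.
Import Order.TTheory GRing.Theory Num.Theory.
Import numFieldNormedType.Exports.
Set Implicit Arguments.
Unset Strict Implicit.
Unset Printing Implicit Defensive.
Local Open Scope classical_set_scope.
Local Open Scope ring_scope.

(* All estimates come from testing the equation with truncations of [u] against
   barriers; an energy bound for the truncations feeds De Giorgi's iteration.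

   Upper bound: [u] vanishes outside [Omega], so on [{u > M}] the nonlocal
   interaction with a cube away from [Omega] exceeds the right-hand side 1 when
   [M] is large, and [(u - M)^+] must vanish. With this bound, either assumption
   (i) (by De Giorgi's iteration) or (ii) (by Chebyshev's inequality) provides
   [t, m > 0], independent of [u], such that [|{u > t}| >= m].

   Lower bound at [x1]: compare [u] with the small concave paraboloid
   [2e (1 - |x - x1|^2 / r^2)]. Where [u] lies below it, the nonlocal operator
   gains [2 |x - y|^-(n+ps) u(y)^(p-1)] from every [y], and since [x] stays away
   from the complement of [Omega], [|x - y| <= (1 + tau)^-1 diam Omega]. The gain
   thus exceeds the allowed [2 (diam Omega)^-(n+ps) \int_K u^(p-1)] by a fixed
   multiple of [t^(p-1) m]. This makes the set where the paraboloid exceeds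
   [u + e / 2] of measure [O(e^(p-1))], and De Giorgi's iteration then gives
   [u x1 >= e] once [e] is small. *)

(** The equation may be tested only with smooth functions supported in [Omega], and membership in V0
    supplies nothing but an approximating sequence [phi_j]. A truncation (u - w)^+ is therefore
    reached as the limit of [soft j (phi_j - w)], with [soft j] a smooth, nondecreasing, 1-Lipschitz
    substitute for the positive part. This is admissible when {w <= 0} is a compact subset of
    [Omega], which dictates the barriers: constants for [u], paraboloids for [- u]. A subsequence
    with summable errors provides the dominating function.

    The factor 2 in front of the gain is the double counting of pairs in the double integral, and it
    matches the 2 of the allowed right-hand side exactly; the whole margin is the surplus factor (1
    + tau)^(n+ps). Far pairs carry this margin, near pairs carry the energy that De Giorgi's
    iteration needs, and there the paraboloid costs only a multiple of e^p.

    The smallness threshold of the iteration does not depend on the height of the truncation. A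
    measure of order e^(p-1) with p > 1 thus falls below it for small [e]. *)

(** * Elementary inequalities for real powers *)

Section inequalities.
Context {R : realType}.
Implicit Types (a b c p : R).

(** The nonlinearity of the p-Laplacian. The factor [a] makes it 0 at 0 for every [p], also for p <
    2. *)
Definition pJ p a : R := `|a| `^ (p - 2) * a.

Lemma powR0_pos p : 0 < p -> (0 : R) `^ p = 0.
Proof. by move=> p0; rewrite powR0// gt_eqF. Qed.

Lemma normr_pJ p a : 1 < p -> `|pJ p a| = `|a| `^ (p - 1).
Proof.
move=> p1; rewrite normrM ger0_norm ?powR_ge0//.
have [->|a0] := eqVneq a 0; first by rewrite normr0 mulr0 powR0_pos// subr_gt0.
rewrite -{2}[`|a|]powRr1// -powRD ?normr_eq0 ?a0 ?implybT//.
by congr (_ `^ _); ring.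
Qed.

Lemma pJ_ge0E p a : 1 < p -> 0 <= a -> pJ p a = a `^ (p - 1).
Proof.
by move=> p1 a0; rewrite -[in RHS](ger0_norm a0) -normr_pJ// ger0_norm// mulr_ge0// powR_ge0.
Qed.

Lemma pJN p a : pJ p (- a) = - pJ p a.
Proof. by rewrite /pJ normrN mulrN. Qed.

Lemma pJM p a : 1 < p -> pJ p a * a = `|a| `^ p.
Proof.
move=> p1; rewrite /pJ; have [->|a0] := eqVneq a 0.
  by rewrite mulr0 normr0 powR0_pos// (lt_trans ltr01).
rewrite -mulrA -expr2 -real_normK ?num_real// -powR_mulrn// -powRD ?normr_eq0 ?a0 ?implybT//.
by congr (_ `^ _); ring.
Qed.

Lemma powR_le p a b : 0 <= p -> 0 <= a -> a <= b -> a `^ p <= b `^ p.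
Proof.
by move=> p0 a0 ab; rewrite ge0_ler_powR// nnegrE// (le_trans a0).
Qed.

Lemma powRBM p a : 1 < p -> 0 <= a -> a `^ (p - 1) * a = a `^ p.
Proof. by move=> p1 a0; rewrite -pJ_ge0E// pJM// ger0_norm. Qed.

(** The larger of [a] and [b] alone dominates the product; sharp Young constants would gain
    nothing. *)
Lemma young_powR p a b : 1 < p -> 0 <= a -> 0 <= b ->
  a `^ (p - 1) * b <= a `^ p + b `^ p.
Proof.
move=> p1 a0 b0; have p10 : 0 <= p - 1 by lra.
have [ab|ba] := leP a b.
  rewrite (@le_trans _ _ (b `^ p))// ?lerDr ?powR_ge0// -(powRBM p1 b0).
  by rewrite ler_wpM2r// powR_le.
rewrite (@le_trans _ _ (a `^ p))// ?lerDl ?powR_ge0// -(powRBM p1 a0).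
by rewrite ler_wpM2l ?powR_ge0// ltW.
Qed.

Lemma powRD3_le p a b c : 0 <= p -> 0 <= a -> 0 <= b -> 0 <= c ->
  (a + b + c) `^ p <= 3 `^ p * (a `^ p + b `^ p + c `^ p).
Proof.
move=> p0 a0 b0 c0.
pose m := Num.max a (Num.max b c).
have m0 : 0 <= m by rewrite le_max a0.
have [am bm cm] : [/\ a <= m, b <= m & c <= m].
  by rewrite /m !le_max !lexx !orbT.
apply: (@le_trans _ _ ((3 * m) `^ p)).
  by apply: powR_le => //; [rewrite !addr_ge0|lra].
rewrite powRM// ler_wpM2l ?powR_ge0//.
have pa := powR_ge0 a p; have pb := powR_ge0 b p; have pc := powR_ge0 c p.
have [->|->|->] : [\/ m = a, m = b | m = c]; try lra.
  by rewrite /m; case: (leP b c) => _; case: leP => _; constructor.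
Qed.

Lemma measurable_pJ p : measurable_fun setT (pJ p).
Proof.
apply: measurable_funM => //.
by apply: (measurableT_comp (measurable_powR _)); exact: normr_measurable.
Qed.

Lemma le1Dpowr p a : 1 <= p -> 0 <= a -> a <= 1 + a `^ p.
Proof.
move=> p1 a0; have [a1|a1] := leP a 1; first by rewrite (le_trans a1)// lerDl powR_ge0.
rewrite (@le_trans _ _ (a `^ p)) ?lerDr//.
rewrite -{1}[a]powRr1//; exact: (ler_powR (ltW a1)).
Qed.

Lemma powRV (x al : R) : 0 <= x -> x^-1 `^ al = (x `^ al)^-1.
Proof.
by move=> x0; rewrite -powR_inv1// -powRrM mulrC powRrM powR_inv1// powR_ge0.
Qed.

Lemma powR_expr (x al : R) j : 0 <= x -> (x ^+ j) `^ al = (x `^ al) ^+ j.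
Proof.
move=> x0; elim: j => [|j IH]; first by rewrite !expr0 powR1.
by rewrite !exprS powRM ?exprn_ge0// IH.
Qed.

Lemma powR2_gt1 (al : R) : 0 < al -> 1 < (2 : R) `^ al.
Proof.
move=> al0; rewrite -[X in X < _](congr1 (@^~ al) (@powR1 R)).
by rewrite gt0_ltr_powR ?nnegrE// ltr1n.
Qed.

End inequalities.

(** * Smooth approximation of the positive part *)

Section flat.
Context {R : realType}.
Implicit Types (P : {poly R}) (t : R).

(** The functions P(1/t) exp(-1/t), extended by 0. Indexing by polynomials closes the family under
    differentiation: with z = 1/t the derivative is z^2 (P - P')(z) exp(-z), whence [dflat]. *)
Definition flat P t : R := if 0 < t then P.[t^-1] * expR (- t^-1) else 0.

Definition dflat P : {poly R} := 'X^2 * (P - P^`()).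

Lemma horner_le_pow P z : 1 <= z ->
  `|P.[z]| <= (\sum_(i < size P) `|P`_i|) * z ^+ size P.
Proof.
move=> z1; rewrite horner_coef (le_trans (ler_norm_sum _ _ _))// mulr_suml.
apply: ler_sum => i _; rewrite normrM ler_wpM2l// normrX ger0_norm ?(le_trans ler01)//.
by rewrite ler_weXn2l// ltnW.
Qed.

Lemma expRN_le_pow (z : R) (m : nat) : 0 < z -> expR (- z) <= m.+1`!%:R / z ^+ m.+1.
Proof.
move=> z0; rewrite expRN -[leRHS]invrK lef_pV2 ?posrE ?expR_gt0//; last first.
  by rewrite invr_gt0 divr_gt0// ?exprn_gt0// ltr0n fact_gt0.
rewrite invf_div; apply: le_trans (expR_ge1Dxn m (ltW z0)).
by rewrite lerDr.
Qed.

(** The exponential beats the power z^(size P + 2), two more than the polynomial requires. These two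
    orders make the difference quotient at 0 vanish. *)
Lemma flat_bound P : exists2 C, 0 <= C & forall t, t <= 1 -> `|flat P t| <= C * t ^+ 2.
Proof.
pose S := \sum_(i < size P) `|P`_i|.
have S0 : 0 <= S by exact: sumr_ge0.
exists (S * (size P).+2`!%:R); first by rewrite mulr_ge0// ler0n.
move=> t t1; rewrite /flat; case: ifPn => [t0|_]; last first.
  rewrite normr0; apply: mulr_ge0; last exact: sqr_ge0.
  by apply: mulr_ge0; rewrite ?ler0n.
have z1 : 1 <= t^-1 by rewrite invf_ge1.
have z0 : 0 < t^-1 by rewrite invr_gt0.
rewrite normrM [X in _ * X]ger0_norm ?expR_ge0//.
apply: (le_trans (ler_pM (normr_ge0 _) (expR_ge0 _) (horner_le_pow P z1)
  (expRN_le_pow (size P).+1 z0))).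
rewrite -/S -!mulrA ler_wpM2l// mulrCA ler_wpM2l ?ler0n//.
have -> : t^-1 ^+ (size P).+2 = t^-1 ^+ size P * t^-1 ^+ 2 by rewrite -exprD addn2.
by rewrite invfM mulrA mulfV ?expf_neq0 ?gt_eqF// mul1r -exprVn invrK.
Qed.

Lemma flat_le0 P t : t <= 0 -> flat P t = 0.
Proof. by move=> t0; rewrite /flat ltNge t0. Qed.

Global Instance is_derive_flat P t : is_derive t 1 (flat P) (flat (dflat P) t).
Proof.
have [t0|t0|->] := ltgtP t 0.
- rewrite (flat_le0 _ (ltW t0)).
  apply: (@near_eq_is_derive _ _ _ (cst 0)).
  near=> x; rewrite flat_le0//; apply/ltW; near: x.
  exact: lt_nbhsl.
- rewrite /flat t0.
  apply: (@near_eq_is_derive R R R (fun x => P.[x^-1] * expR (- x^-1))).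
    by near=> x; rewrite ifT//; near: x; exact: lt_nbhsr.
  have tn : t != 0 by rewrite gt_eqF.
  have dV : is_derive t 1 (fun x : R => x^-1) (- t ^- 2).
    apply: is_derive_eq; first exact: (@is_deriveV R id t 1 1 tn (is_derive_id _ _)).
    by rewrite /= -[(- _) *: _]/(_ * _) mulr1.
  have dP : is_derive (t^-1) 1 (horner P) (P^`()).[t^-1].
    rewrite derivE derive1E; apply: derivableP; exact: derivable_horner.
  have d1 := @is_derive1_comp R _ _ t _ _ dP dV.
  have d2 := @is_derive1_comp R expR (fun x => - x^-1) t _ _ (is_derive_expR _)
     (is_deriveN dV).
  have := @is_deriveM _ _ _ _ t 1 _ _ d1 d2.
  move=> h; apply: (is_derive_eq h).
  rewrite /dflat !hornerE /=.
  rewrite -![_ *: _]/(_ * _) /=.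
  by rewrite exprVn; ring.
(* At the gluing point the difference quotient is at most C |h| by [flat_bound]. *)
- rewrite flat_le0//.
  suff h : (fun h => h^-1 *: ((flat P \o shift 0) (h *: 1) - flat P 0)) @ 0^' --> (0 : R).
    apply: DeriveDef; last by apply/cvg_lim.
    by apply/cvg_ex; exists 0.
  have [C C0 CP] := flat_bound P.
  apply/cvgr0Pnorm_le => e e0; near=> h.
  rewrite /= addr0 [_%:A]mulr1 (flat_le0 _ (lexx 0)) subr0.
  rewrite -[_ *: _]/(_ * _) normrM normfV.
  have hn0 : h != 0 by near: h; exact: nbhs_dnbhs_neq.
  rewrite ler_pdivrMl ?normr_gt0//.
  have h1 : `|h| <= 1 by near: h; apply: dnbhs0_le.
  apply: (le_trans (CP _ _)); first by rewrite (le_trans (ler_norm _)).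
  rewrite -real_normK ?num_real// expr2 mulrCA ler_wpM2l//.
  have hC : `|h| <= e / (C + 1) by near: h; apply: dnbhs0_le; rewrite divr_gt0// ltr_wpDl.
  rewrite (le_trans (ler_wpM2l C0 hC))// mulrCA ler_piMr ?(ltW e0)//.
  by rewrite ler_pdivrMr ?ltr_wpDl// mul1r lerDl.
Unshelve. all: by end_near.
Qed.

(* [soft m t -> max t 0] as [m -> oo], while [0 <= soft' <= 1]. *)
Definition soft (m : nat) t : R := t * flat 1 (m.+1%:R * t).

Lemma soft_le0 m t : t <= 0 -> soft m t = 0.
Proof. by move=> t0; rewrite /soft flat_le0 ?mulr0// mulr_ge0_le0. Qed.

Lemma soft_ge0 m t : 0 <= soft m t.
Proof.
have [t0|t0] := leP t 0; first by rewrite soft_le0.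
rewrite /soft /flat; case: ifPn => _; last by rewrite mulr0.
by rewrite hornerC mul1r mulr_ge0 ?expR_ge0// ltW.
Qed.

Lemma soft_le m t : soft m t <= Num.max t 0.
Proof.
have [t0|t0] := leP t 0; first by rewrite soft_le0.
rewrite /soft /flat mulr_gt0// hornerC mul1r ler_piMr ?ltW//.
by rewrite -expR0 ltr_expR oppr_lt0 invr_gt0 mulr_gt0.
Qed.

Lemma soft_cvg (t : R) : Num.max t 0 - soft m t @[m --> \oo] --> 0.
Proof.
have [t0|t0] := leP t 0.
  by under eq_cvg do rewrite soft_le0// subrr; exact: cvg_cst.
have -> : (fun m => t - soft m t) =
    (fun m => t - t * expR (- (m.+1%:R^-1 * t^-1))).
  apply/funext => m; rewrite /soft /flat ifT; last by rewrite mulr_gt0.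
  by rewrite hornerC mul1r invfM.
have -> : 0 = t - t * expR (- (0 * t^-1)) by rewrite mul0r oppr0 expR0 mulr1 subrr.
apply: cvgB; first exact: cvg_cst.
apply: cvgM; first exact: cvg_cst.
apply: continuous_cvg; first exact: continuous_expR.
apply: cvgN; apply: cvgM; last exact: cvg_cst.
exact: cvg_harmonic.
Qed.

(** For t > 0 the derivative is (1 + z) exp(-z) with z = 1/((m+1) t). It lies in [0, 1] because 1 +
    z <= exp z, uniformly in [m]. *)
Lemma soft_incr m (a b : R) : a <= b -> 0 <= soft m b - soft m a <= b - a.
Proof.
move=> ab.
have [b0|b0] := leP b 0.
  by rewrite !soft_le0 ?(le_trans ab)// subr0 lexx/= subr_ge0.
have [a0|a0] := leP a 0.
  rewrite (soft_le0 _ a0) subr0 soft_ge0/= (le_trans (soft_le _ _))//.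
  rewrite (max_l (ltW b0)); lra.
pose M : R := m.+1%:R.
have M0 : 0 < M by rewrite /M ltr0n.
pose f (t : R) := t * flat 1 (M * t).
pose df (t : R) := flat 1 (M * t) + t * (M * flat (dflat 1) (M * t)).
have fE : soft m = f by [].
have d (t : R) : is_derive t 1 f (df t).
  have d1 := @is_derive1_comp R (flat 1) ( *%R M) t _ _ (is_derive_flat _ _)
    (@is_deriveZ _ _ _ id M t 1 1 (is_derive_id _ _)).
  have := @is_deriveM _ _ id _ t 1 _ _ (is_derive_id _ _) d1.
  move=> h; apply: (is_derive_eq h).
  by rewrite -![_ *: _]/(_ * _) /df /=; ring.
have dle (t : R) : 0 < t -> 0 <= df t <= 1.
  move=> t0; rewrite /df /flat mulr_gt0//.
  rewrite /dflat derivC subr0 mulr1 hornerXn hornerC mul1r.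
  set z := (M * t)^-1.
  have z0 : 0 < z by rewrite invr_gt0 mulr_gt0.
  have -> : expR (- z) + t * (M * (z ^+ 2 * expR (- z))) = (1 + z) * expR (- z).
    have : M * t * z = 1 by rewrite mulfV// gt_eqF// mulr_gt0.
    move=> Mtz; transitivity ((1 + (M * t * z) * z) * expR (- z)); first by ring.
    by rewrite Mtz mul1r.
  rewrite mulr_ge0 ?expR_ge0 ?addr_ge0 ?(ltW z0)//=.
  by rewrite expRN ler_pdivrMr ?expR_gt0// mul1r expR_ge1Dx.
have [->|ne] := eqVneq a b; first by rewrite !subrr lexx.
have altb : a < b by rewrite lt_neqAle ne.
have [|c /andP[ac cb] ->] := @MVT R f df _ _ altb (fun x _ => d x).
  apply: derivable_within_continuous => x _.
  by have [] := d x.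
have c0 : 0 < c by rewrite (lt_trans a0)//; move: ac; rewrite bnd_simp.
have /andP[d0 d1] := dle _ c0.
by rewrite mulr_ge0 ?subr_ge0//= ler_piMl ?subr_ge0.
Qed.

End flat.

(** * Smooth functions on R^n and smooth truncations *)

Section smooth_algebra.
Context {R : realType} {n : nat}.
Implicit Types (f g h : 'rV[R]_n -> R).

(** A directional derivative only sees the restriction to a line; this imports the one-dimensional
    chain rule. *)
Lemma is_derive_line f x (v : 'rV[R]_n) df :
  is_derive x v f df <-> is_derive (0 : R) 1 (fun t : R => f (t *: v + x)) df.
Proof.
have E : (fun h : R => h^-1 *: ((f \o shift x) (h *: v) - f x)) =
    (fun h : R => h^-1 *: (((fun t : R => f (t *: v + x)) \o shift 0) (h *: 1)
       - f (0 *: v + x))).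
  by apply/funext => t /=; rewrite addr0 scale0r add0r [_%:A]mulr1.
by split => -[]; rewrite /derivable /derive ?E => d e; apply: DeriveDef;
  rewrite /derivable /derive ?E.
Qed.

Lemma is_derive_comp f (F : R -> R) x (v : 'rV[R]_n) a b :
  is_derive x v f a -> is_derive (f x) 1 F b ->
  is_derive x v (F \o f) (b * a).
Proof.
move=> /is_derive_line df dF; apply/is_derive_line.
apply: (@is_derive1_comp R F (fun t => f (t *: v + x)) 0 b a) => //.
by rewrite scale0r add0r.
Qed.

Lemma smooth_continuous f : smooth f -> continuous f.
Proof. by move=> /(_ [::])[]. Qed.

Lemma smooth_derivable f : smooth f ->
  forall i x, derivable f x (delta_mx ord0 i).
Proof. by move=> /(_ [::])[]. Qed.

Lemma smooth_partial f i : smooth f -> smooth (partial i f).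
Proof. by move=> sf l; have := sf (rcons l i); rewrite foldr_rcons. Qed.

(** Coinduction: a class of continuous functions with partial derivatives that is stable under these
    derivatives consists of smooth functions. *)
Lemma smooth_coind (P : ('rV[R]_n -> R) -> Prop) :
  (forall f, P f -> [/\ continuous f,
     forall i x, derivable f x (delta_mx ord0 i) &
     forall i, P (partial i f)]) ->
  forall f, P f -> smooth f.
Proof.
move=> Pc f Pf l.
suff /Pc[] : P (foldr partial f l) by [].
by elim: l => //= i l /Pc[].
Qed.

(** A class made for [smooth_coind]. The derivative of [flat P \o f] is a product of
    [flat (dflat P) \o f] and a smooth function, so the class is visibly stable and no chain rule of
    higher order is required. *)
Inductive smooth_alg : ('rV[R]_n -> R) -> Prop :=
| smooth_alg_base f : smooth f -> smooth_alg f
| smooth_alg_flat (P : {poly R}) f : smooth f -> smooth_alg (flat P \o f)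
| smooth_alg_add f g : smooth_alg f -> smooth_alg g ->
    smooth_alg (fun x => f x + g x)
| smooth_alg_mul f g : smooth_alg f -> smooth_alg g ->
    smooth_alg (fun x => f x * g x).

Lemma continuous_flat (P : {poly R}) : continuous (flat P).
Proof.
move=> t; apply: differentiable_continuous; apply/derivable1_diffP.
by have [] := is_derive_flat P t.
Qed.

Lemma smooth_algP f : smooth_alg f -> smooth f.
Proof.
apply: smooth_coind => {}f; elim => {f} [f sf|P f sf|f g _ [cf df af] _ [cg dg ag]
  |f g sf [cf df af] sg [cg dg ag]].
- split; [exact: smooth_continuous|exact: smooth_derivable|] => i.
  exact/smooth_alg_base/smooth_partial.
- have d i x : is_derive x (delta_mx ord0 i) (flat P \o f)
      (flat (dflat P) (f x) * partial i f x).
    apply: (@is_derive_comp f (flat P) x _ (partial i f x) (flat (dflat P) (f x))).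
    exact/derivableP/smooth_derivable.
  split.
  + by move=> x; apply: continuous_comp; [exact: smooth_continuous|exact: continuous_flat].
  + by move=> i x; have [] := d i x.
  + move=> i; rewrite (_ : partial _ _ =
      (fun x => (flat (dflat P) \o f) x * partial i f x)).
      apply: smooth_alg_mul; first exact: smooth_alg_flat.
      exact/smooth_alg_base/smooth_partial.
    by apply/funext => x; have [] := d i x.
- split.
  + by move=> x; exact: (cvgD (cf x) (cg x)).
  + by move=> i x; apply: derivableD.
  + move=> i; rewrite (_ : partial _ _ = (fun x => partial i f x + partial i g x)).
      exact: smooth_alg_add.
    by apply/funext => x; rewrite /partial -deriveD.
- split.
  + by move=> x; exact: (cvgM (cf x) (cg x)).
  + by move=> i x; apply: derivableM.
  + move=> i; rewrite (_ : partial _ _ =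
      (fun x => f x * partial i g x + g x * partial i f x)).
      by apply: smooth_alg_add; apply: smooth_alg_mul.
    by apply/funext => x; rewrite /partial deriveM.
Qed.

Lemma smooth_cst (c : R) : smooth (fun _ : 'rV[R]_n => c).
Proof.
apply: (@smooth_coind (fun f => exists c, f = fun=> c)); last by exists c.
move=> _ [d ->]; split.
- exact: cst_continuous.
- by move=> i x; exact: derivable_cst.
- by move=> i; exists 0; apply/funext => x; rewrite /partial derive_cst.
Qed.

Lemma smooth_coord (j : 'I_n) : smooth (fun x : 'rV[R]_n => x ord0 j).
Proof.
have d i (x : 'rV[R]_n) : is_derive x (delta_mx ord0 i)
    (fun x : 'rV[R]_n => x ord0 j) ((delta_mx ord0 i : 'rV[R]_n) ord0 j).
  apply/is_derive_line.
  rewrite (_ : (fun t : R => _) =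
    (fun t => ((delta_mx ord0 i : 'rV[R]_n) ord0 j) *: t + x ord0 j)); last first.
    by apply/funext => t; rewrite !mxE -[_ *: _]/(_ * _) mulrC.
  set b := (delta_mx _ _) _ _.
  have := @is_deriveD R R R _ _ (0 : R) 1 _ _
    (@is_deriveZ R R R id b 0 1 1 (is_derive_id _ _)) (is_derive_cst (x ord0 j) _ _).
  by move/is_derive_eq; apply; rewrite addr0 [_%:A]mulr1.
apply: (@smooth_coind (fun f => f = (fun x => x ord0 j) \/ exists c, f = fun=> c));
  last by left.
move=> f [->|[c ->]]; split.
- exact: coord_continuous.
- by move=> i x; have [] := d i x.
- move=> i; right; exists ((delta_mx ord0 i : 'rV[R]_n) ord0 j).
  by apply/funext => x; have [] := d i x.
- exact: cst_continuous.
- by move=> i x; exact: derivable_cst.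
- by move=> i; right; exists 0; apply/funext => x; rewrite /partial derive_cst.
Qed.

Lemma smoothD f g : smooth f -> smooth g -> smooth (fun x => f x + g x).
Proof.
by move=> sf sg; apply/smooth_algP/smooth_alg_add; exact: smooth_alg_base.
Qed.

Lemma smoothM f g : smooth f -> smooth g -> smooth (fun x => f x * g x).
Proof.
by move=> sf sg; apply/smooth_algP/smooth_alg_mul; exact: smooth_alg_base.
Qed.

Lemma smooth_soft m f : smooth f -> smooth (fun x => soft m (f x)).
Proof.
move=> sf; apply/smooth_algP; apply: smooth_alg_mul; first exact: smooth_alg_base.
apply: (@smooth_alg_flat 1 (fun x => m.+1%:R * f x)).
exact: (smoothM (smooth_cst _) sf).
Qed.

(** With l = 0 this is a constant, so one family of barriers serves both bounds. *)
Definition paraboloid (c l : R) (a x : 'rV[R]_n) : R := c + l * enorm (x - a) ^+ 2.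

Lemma enorm_sqr (x : 'rV[R]_n) : enorm x ^+ 2 = \sum_(i < n) x ord0 i ^+ 2.
Proof. by rewrite sqr_sqrtr// sumr_ge0// => i _; rewrite sqr_ge0. Qed.

Lemma smooth_sum (I : Type) (r : seq I) (F : I -> 'rV[R]_n -> R) :
  (forall i, smooth (F i)) -> smooth (fun x => \sum_(i <- r) F i x).
Proof.
move=> sF; elim: r => [|i r IH].
  by rewrite (_ : (fun x => _) = fun=> 0);
    [exact: smooth_cst|apply/funext => x; rewrite big_nil].
rewrite (_ : (fun x => _) = fun x => F i x + \sum_(j <- r) F j x).
  exact: smoothD.
by apply/funext => x; rewrite big_cons.
Qed.

Lemma smooth_paraboloid c l a : smooth (paraboloid c l a).
Proof.
apply: smoothD; first exact: smooth_cst.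
apply: smoothM; first exact: smooth_cst.
rewrite (_ : (fun x => _) =
  fun x : 'rV[R]_n => \sum_(i < n) (x ord0 i + - a ord0 i) * (x ord0 i + - a ord0 i)).
  apply: smooth_sum => i; apply: smoothM; apply: smoothD;
    by [exact: smooth_coord|exact: smooth_cst].
by apply/funext => x; rewrite enorm_sqr; apply: eq_bigr => i _; rewrite !mxE expr2.
Qed.

(* The set where the test function is nonzero lies in [supp psi `|` {w <= 0}]. *)
Lemma test_function_soft (Omega : set 'rV[R]_n) (psi w : 'rV[R]_n -> R) m :
  test_function Omega psi -> smooth w ->
  compact [set x | w x <= 0] -> [set x | w x <= 0] `<=` Omega ->
  test_function Omega (fun x => soft m (psi x - w x)).
Proof.
move=> [spsi cpsi psiO] sw cw wO.
have sub : closure [set x | soft m (psi x - w x) != 0] `<=`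
    closure [set x | psi x != 0] `|` [set x | w x <= 0].
  have cl : closed (closure [set x | psi x != 0] `|` [set x | w x <= 0]).
    apply: closedU; first exact: closed_closure.
    by apply: compact_closed => //; exact: norm_hausdorff.
  rewrite [X in _ `<=` X]((closure_id _).1 cl).
  apply: closure_subset => x /=.
  have [w0|w0] := leP (w x) 0; first by right.
  move=> sx; left; apply: subset_closure => /=.
  apply: contraNneq sx => ->; rewrite soft_le0// sub0r oppr_le0; exact: ltW.
split.
- apply: smooth_soft; apply: (smoothD spsi).
  rewrite (_ : (fun x => _) = fun x => -1 * w x).
    exact: (smoothM (smooth_cst _) sw).
  by apply/funext => x; rewrite mulN1r.
- apply: (subclosed_compact _ _ sub); first exact: closed_closure.
  exact: compactU.
- by move=> x /sub [/psiO|/wO].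
Qed.

Lemma test_functionN (Omega : set 'rV[R]_n) psi :
  test_function Omega psi -> test_function Omega (fun x => - psi x).
Proof.
move=> [spsi cpsi psiO].
have E : [set x | - psi x != 0] = [set x | psi x != 0].
  by apply/seteqP; split => x /=; rewrite oppr_eq0.
split; [|by rewrite E|by rewrite E].
rewrite (_ : (fun x => _) = fun x => -1 * psi x).
  exact: (smoothM (smooth_cst _) spsi).
by apply/funext => x; rewrite mulN1r.
Qed.

End smooth_algebra.

(** * Lebesgue measure, Euclidean norm and fractional kernels *)

Section lebesgueRn_facts.
Context {R : realType}.
Implicit Types (n : nat) (r : R).

Lemma measurable_borel_Rn n (A : set (borelRn R n)) :
  measurable A -> measurable (A : set (Rn R n)).
Proof. exact: caratheodory_measurable_mu_ext. Qed.

Lemma lebesgueRn_borel n (A : set (borelRn R n)) : measurable A ->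
  @lebesgueRn R n A = @borel_lebesgueRn R n A.
Proof. by move=> mA; exact: (measurable_mu_extE (@borel_lebesgueRn R n)). Qed.

Lemma measurable_coord n (i : 'I_n) :
  measurable_fun [set: Rn R n] (fun x : Rn R n => (x : 'rV[R]_n) ord0 i).
Proof.
move=> _ A mA; rewrite setTI; apply: measurable_borel_Rn.
by rewrite -[_ @^-1` _]setTI; exact: (@measurable_coordRn R n i).
Qed.

(** The balls of the sup norm. Their volume is explicit by induction on the dimension, so they
    replace Euclidean balls throughout. *)
Definition cube n (x : 'rV[R]_n) r : set 'rV[R]_n :=
  [set y | forall i, `|x ord0 i - y ord0 i| < r].

Lemma cube_itv n (x : 'rV[R]_n) r : cube x r =
  \bigcap_(i in [set: 'I_n]) ((@coordRn R n i) @^-1` `]x ord0 i - r, x ord0 i + r[).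
Proof.
apply/seteqP; split => y /= h i.
  by move=> _; rewrite /= in_itv/= /coordRn; move: (h i); rewrite ltr_distlC => /andP[-> ->].
by have := h i I; rewrite /= in_itv/= /coordRn ltr_distlC.
Qed.

Lemma measurable_cube_borel n (x : 'rV[R]_n) r : measurable (cube x r : set (borelRn R n)).
Proof.
rewrite cube_itv; apply: fin_bigcap_measurable => // i _.
by rewrite -[_ @^-1` _]setTI; apply: measurable_coordRn.
Qed.

Lemma measurable_cube n (x : 'rV[R]_n) r : measurable (cube x r : set (Rn R n)).
Proof. exact: measurable_borel_Rn (measurable_cube_borel x r). Qed.

Lemma borel_lebesgueRn_cube n (x : 'rV[R]_n) r : 0 < r ->
  @borel_lebesgueRn R n (cube x r) = ((2 * r) ^+ n)%:E.
Proof.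
move=> r0; elim: n x => [|n IH] x.
  by rewrite /= diracE mem_set ?expr0//= => -[].
rewrite [LHS]/= /pushforward.
have -> : @consRn R n @^-1` cube x r =
    `]x ord0 ord0 - r, x ord0 ord0 + r[ `*` cube (\row_j x ord0 (lift ord0 j)) r.
  apply/seteqP; split => -[a y] /=.
    move=> h; split.
      have := h ord0; rewrite /consRn !mxE unlift_none in_itv/= ltr_distlC.
      by move=> /andP[-> ->].
    by move=> i; have := h (lift ord0 i); rewrite /consRn !mxE liftK.
  rewrite in_itv/= => -[ha h] i; rewrite /consRn mxE.
  case: unliftP => [j ->|->]; first by have := h j; rewrite mxE.
  by rewrite ltr_distlC.
rewrite product_measure1E//; last exact: measurable_cube_borel.
rewrite [X in (_ * X)%E]IH [X in (X * _)%E]lebesgue_measure_itv/= lte_fin ifT; last lra.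
by rewrite -EFinB -EFinM exprS; congr (_ * _)%:E; ring.
Qed.

Lemma lebesgueRn_cube n (x : 'rV[R]_n) r : 0 < r ->
  @lebesgueRn R n (cube x r) = ((2 * r) ^+ n)%:E.
Proof.
by move=> r0; rewrite lebesgueRn_borel ?borel_lebesgueRn_cube//; exact: measurable_cube_borel.
Qed.

Lemma cube_ball n (x : 'rV[R]_n) r : 0 < r -> ball x r = cube x r.
Proof.
move=> r0; apply/seteqP; split => y.
  by case=> _ h i; exact: h.
by move=> h; split => // i j; rewrite (ord1 i); exact: h.
Qed.

(** The sigma-algebra is generated by coordinates, so an open set is exhausted by the countably many
    rational cubes that it contains. *)
Lemma open_measurable_Rn n (A : set 'rV[R]_n) : open A -> measurable (A : set (Rn R n)).
Proof.
move=> oA.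
pose Q (c : 'rV[rat]_n * rat) : set 'rV[R]_n := cube (map_mx (@ratr R) c.1) (ratr c.2).
have -> : A = \bigcup_c [set y | Q c `<=` A /\ Q c y].
  apply/seteqP; split => [x Ax|x [c _ [h]]]; last exact: h.
  have [e e0 eA] : exists2 e : R, 0 < e & cube x e `<=` A.
    have /nbhs_ballP[e e0 eA] := open_nbhs_nbhs (conj oA Ax : open_nbhs x A).
    by exists e => //; rewrite -cube_ball.
  (* A cube of radius q < e/2 whose rational centre is within [q] of [x] stays in [cube x e]. *)
  have [q /andP[q0 qe]] : exists q : rat, 0 < (ratr q : R) < e / 2.
    have [q] := @rat_in_itvoo R 0 (e / 2) (divr_gt0 e0 (ltr0Sn _ _)).
    by rewrite in_itv/=; exists q.
  have /choice[c cP] : forall i : 'I_n, exists c : rat, `|x ord0 i - ratr c| < ratr q.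
    move=> i; have [c] := @rat_in_itvoo R (x ord0 i - ratr q) (x ord0 i + ratr q) ltac:(lra).
    by rewrite in_itv/= => h; exists c; rewrite ltr_distlC.
  exists (\row_i c i, q) => //=; split.
    move=> y; rewrite /Q/= => h; apply: eA => i.
    have := h i; have := cP i; rewrite !mxE => h1 h2.
    rewrite (le_lt_trans (ler_distD (ratr (c i)) _ _))//; lra.
  by move=> i; rewrite !mxE distrC.
apply: countable_bigcupT_measurable; first exact: countableP.
move=> c; have [h|h] := pselect (Q c `<=` A).
  rewrite (_ : [set y | _] = Q c); first exact: measurable_cube.
  by apply/seteqP; split => y //= [].
rewrite (_ : [set y | _] = set0); first exact: measurable0.
by apply/seteqP; split => y //= [].
Qed.

Lemma continuous_measurable_Rn n (f : 'rV[R]_n -> R) : continuous f ->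
  measurable_fun [set: Rn R n] (f : Rn R n -> R).
Proof.
move=> cf; apply: (measurability (@RGenOInfty.G R)).
  exact: RGenOInfty.measurableE.
move=> _ [_ [a ->] <-]; rewrite setTI.
apply: (@open_measurable_Rn n (f @^-1` `]a, +oo[)).
by apply: open_comp => // x _; exact: cf.
Qed.

Lemma open_gt0_Rn n (A : set 'rV[R]_n) x : open A -> A x ->
  (0 < @lebesgueRn R n (A : set (Rn R n)))%E.
Proof.
move=> oA Ax; have /nbhs_ballP[e e0 eA] := open_nbhs_nbhs (conj oA Ax : open_nbhs x A).
rewrite (cube_ball _ e0) in eA.
apply: (@lt_le_trans _ _ (@lebesgueRn R n (cube x e))).
  by rewrite lebesgueRn_cube// lte_fin exprn_gt0// mulr_gt0.
apply: le_measure => //; rewrite inE; [exact: measurable_cube|exact: open_measurable_Rn].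
Qed.

Lemma enorm_ge0 n (x : 'rV[R]_n) : 0 <= enorm x.
Proof. exact: sqrtr_ge0. Qed.

Lemma enorm_coord n (x : 'rV[R]_n) i : `|x ord0 i| <= enorm x.
Proof.
rewrite -sqrtr_sqr ler_sqrt; last by rewrite sumr_ge0// => j _; rewrite sqr_ge0.
by rewrite (bigD1 i)//= lerDl sumr_ge0// => j _; rewrite sqr_ge0.
Qed.

Lemma enorm_le n (x : 'rV[R]_n) r : 0 <= r -> (forall i, `|x ord0 i| <= r) ->
  enorm x <= n%:R * r.
Proof.
move=> r0 h; rewrite -[leRHS]ger0_norm ?mulr_ge0// -sqrtr_sqr ler_sqrt ?sqr_ge0//.
rewrite (le_trans (ler_sum _ (G := fun=> r ^+ 2) _))//.
  by move=> i _; rewrite -real_normK ?num_real// lerXn2r ?nnegrE.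
rewrite sumr_const card_ord -[leLHS]mulr_natl exprMn ler_wpM2r ?sqr_ge0//.
by rewrite -natrX ler_nat; case: n {x h} => // n; rewrite expnS leq_pmulr// expn_gt0.
Qed.

Lemma enormN n (x : 'rV[R]_n) : enorm (- x) = enorm x.
Proof. by congr Num.sqrt; apply: eq_bigr => i _; rewrite mxE sqrrN. Qed.

Lemma enormB n (x y : 'rV[R]_n) : enorm (x - y) = enorm (y - x).
Proof. by rewrite -enormN opprB. Qed.

Lemma enorm0 n : enorm (0 : 'rV[R]_n) = 0.
Proof. by rewrite /enorm big1 ?sqrtr0// => i _; rewrite mxE expr0n. Qed.

Lemma enorm_gt0 n (x : 'rV[R]_n) : x != 0 -> 0 < enorm x.
Proof.
move=> x0; rewrite lt_neqAle enorm_ge0 andbT eq_sym.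
apply: contraNneq x0 => e0; apply/eqP/rowP => i; rewrite mxE.
by apply/eqP; rewrite -normr_le0 -e0 enorm_coord.
Qed.

Lemma enormZ n (c : R) (x : 'rV[R]_n) : enorm (c *: x) = `|c| * enorm x.
Proof.
rewrite /enorm -sqrtr_sqr -sqrtrM ?sqr_ge0// mulr_sumr.
by congr Num.sqrt; apply: eq_bigr => i _; rewrite mxE exprMn.
Qed.

Lemma measurable_enorm d (T : measurableType d) n (f g : T -> Rn R n) :
  measurable_fun setT f -> measurable_fun setT g ->
  measurable_fun setT (fun z => enorm (f z - g z : 'rV[R]_n)).
Proof.
move=> mf mg.
rewrite (_ : (fun z => _) =
  (fun z => (\sum_(i < n) (((f z : 'rV[R]_n) ord0 i - (g z : 'rV[R]_n) ord0 i) ^+ 2))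
     `^ 2^-1)).
  apply: (measurableT_comp (measurable_powR _)).
  apply: measurable_sum => i; apply: measurable_funX; apply: measurable_funB.
    exact: (measurableT_comp (measurable_coord i) mf).
  exact: (measurableT_comp (measurable_coord i) mg).
apply/funext => z; rewrite powR12_sqrt; last by rewrite sumr_ge0// => i _; rewrite sqr_ge0.
by congr Num.sqrt; apply: eq_bigr => i _; rewrite !mxE.
Qed.

End lebesgueRn_facts.

Section series_bound.
Context {R : realType}.

Lemma geometric_nneseries (a z : R) : 0 <= a -> 0 <= z < 1 ->
  (\sum_(0 <= j <oo) (a * z ^+ j)%:E = (a / (1 - z))%:E)%E.
Proof.
move=> a0 /andP[z0 z1].
have h : series (geometric a z) x @[x --> \oo] --> a / (1 - z).
  by apply: cvg_geometric_series; rewrite ger0_norm.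
apply/cvg_lim => //.
rewrite (_ : (fun k : nat => _) = EFin \o series (geometric a z)); last first.
  by apply/funext => k /=; rewrite sumEFin.
by apply: cvg_EFin => //; exact: nearW.
Qed.

(** [F] is below the sum of the step functions c_j 1_(C_j), whose integrals form a geometric series.
    Meant for dyadic shells around a point. *)
Lemma integral_le_geometric d (T : measurableType d) (mu : {measure set T -> \bar R})
    (F : T -> R) (C : nat -> set T) (c m : nat -> R) (A z : R) :
  measurable_fun setT F -> (forall y, 0 <= F y) -> (forall j, measurable (C j)) ->
  (forall j, mu (C j) = (m j)%:E) -> (forall j, 0 <= c j) ->
  0 <= z < 1 -> (forall j, c j * m j = A * z ^+ j) ->
  (forall y, F y != 0 -> exists2 j, C j y & F y <= c j) ->
  (\int[mu]_y (F y)%:E <= (A / (1 - z))%:E)%E.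
Proof.
move=> mF F0 mC muC c0 z01 cA Fc.
have m0 j : 0 <= m j by rewrite -lee_fin -muC.
have A0 : 0 <= A.
  by have := cA 0; rewrite expr0 mulr1 => <-; rewrite mulr_ge0.
pose G j (y : T) : \bar R := (c j * \1_(C j) y)%:E.
have mG j : measurable_fun setT (G j).
  by apply/measurable_EFinP; apply: measurable_funM => //; exact: measurable_indic.
have G0 j y : (0 <= G j y)%E by rewrite lee_fin mulr_ge0.
apply: (@le_trans _ _ (\int[mu]_y (\sum_(0 <= j <oo) G j y))%E).
  apply: ge0_le_integral => //.
  - by move=> y _; rewrite lee_fin.
  - exact/measurable_EFinP.
  - exact: ge0_emeasurable_sum.
  - move=> y _; have [->|Fy] := eqVneq (F y) 0; first exact: nneseries_ge0.
    have [j xy Fj] := Fc y Fy.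
    apply: (@le_trans _ _ (G j y)).
      by rewrite lee_fin indicE mem_set ?mulr1.
    by rewrite (@nneseriesD1 _ _ j)// leeDl// nneseries_ge0.
rewrite integral_nneseries//.
rewrite -geometric_nneseries//; apply: lee_nneseries => [j _|j _].
  by move=> _; exact: integral_ge0.
rewrite /G; under eq_integral do rewrite EFinM.
have -> : (\int[mu]_x ((c j)%:E * (\1_(C j) x)%:E) =
    (c j)%:E * \int[mu]_x (\1_(C j) x)%:E)%E.
  apply: ge0_integralZl => //; first exact/measurable_EFinP/measurable_indic.
  by rewrite lee_fin.
by rewrite integral_indic// setIT [X in (_ * X)%E]muC -EFinM cA.
Qed.

End series_bound.

(** * Near and far parts of the fractional kernel *)

Section kernels.
Context {R : realType} {n : nat}.
Variables (p s : R).
Hypotheses (p1 : 1 < p) (s0 : 0 < s) (s1 : s < 1).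
Implicit Types (x y : 'rV[R]_n) (r : R).
Local Notation mu := (@lebesgueRn R n).
Local Notation sg := (n%:R + p * s).

Lemma sg_gt0 : 0 < sg.
Proof. by rewrite ltr_wpDl// mulr_gt0// (lt_trans ltr01). Qed.

Definition ker x y : R := (enorm (x - y) `^ sg)^-1.

(** The weight |x - y|^p is the contribution of the increment of a Lipschitz function; it makes the
    kernel integrable at the diagonal. *)
Definition ker_near r x y : R :=
  if enorm (x - y) < r then enorm (x - y) `^ p * ker x y else 0.

Definition ker_far r x y : R := if r <= enorm (x - y) then ker x y else 0.

Lemma ker_ge0 x y : 0 <= ker x y.
Proof. by rewrite invr_ge0 powR_ge0. Qed.

Lemma kerC x y : ker x y = ker y x.
Proof. by rewrite /ker enormB. Qed.

Lemma ker_diag x : ker x x = 0.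
Proof. by rewrite /ker subrr enorm0 powR0 ?invr0// gt_eqF// sg_gt0. Qed.

Lemma ker_nearC r x y : ker_near r x y = ker_near r y x.
Proof. by rewrite /ker_near kerC enormB. Qed.

Lemma ker_farC r x y : ker_far r x y = ker_far r y x.
Proof. by rewrite /ker_far kerC enormB. Qed.

Lemma ker_near_ge0 r x y : 0 <= ker_near r x y.
Proof. by rewrite /ker_near; case: ifP => // _; rewrite mulr_ge0 ?ker_ge0 ?powR_ge0. Qed.

Lemma ker_far_ge0 r x y : 0 <= ker_far r x y.
Proof. by rewrite /ker_far; case: ifP => // _; rewrite ker_ge0. Qed.

Lemma measurable_ker d (T : measurableType d) (f g : T -> Rn R n) :
  measurable_fun setT f -> measurable_fun setT g ->
  measurable_fun setT (fun z => ker (f z) (g z)).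
Proof.
move=> mf mg; rewrite (_ : (fun z => _) =
  (fun z => (enorm (f z - g z : 'rV[R]_n) `^ sg) `^ (-1))).
  apply: (measurableT_comp (measurable_powR _)).
  apply: (measurableT_comp (measurable_powR _)); exact: measurable_enorm.
by apply/funext => z; rewrite powR_inv1 ?powR_ge0.
Qed.

Lemma measurable_ker_near r d (T : measurableType d) (f g : T -> Rn R n) :
  measurable_fun setT f -> measurable_fun setT g ->
  measurable_fun setT (fun z => ker_near r (f z) (g z)).
Proof.
move=> mf mg; apply: measurable_fun_ifT => //.
  by apply: measurable_fun_ltr => //; exact: measurable_enorm.
apply: measurable_funM; last exact: measurable_ker.
by apply: (measurableT_comp (measurable_powR _)); exact: measurable_enorm.
Qed.

Lemma measurable_ker_far r d (T : measurableType d) (f g : T -> Rn R n) :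
  measurable_fun setT f -> measurable_fun setT g ->
  measurable_fun setT (fun z => ker_far r (f z) (g z)).
Proof.
move=> mf mg; apply: measurable_fun_ifT => //; last exact: measurable_ker.
by apply: measurable_fun_ler => //; exact: measurable_enorm.
Qed.

Lemma cube_enorm x y (r : R) : enorm (x - y) < r -> cube x r y.
Proof.
by move=> xy i; rewrite (le_lt_trans _ xy)//; have := enorm_coord (x - y) i; rewrite !mxE.
Qed.

Lemma enorm_cube x y (r : R) : 0 < r -> cube x r y -> enorm (x - y) <= n%:R * r.
Proof.
move=> r0 h; apply: enorm_le; first exact: ltW.
by move=> i; rewrite !mxE ltW.
Qed.

Lemma ker_ge x y (r : R) : x != y -> enorm (x - y) <= r -> (r `^ sg)^-1 <= ker x y.
Proof.
move=> xy xyr; have e0 : 0 < enorm (x - y) by rewrite enorm_gt0// subr_eq0.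
rewrite lef_pV2 ?posrE ?powR_gt0//; last exact: lt_le_trans xyr.
by rewrite ge0_ler_powR ?nnegrE ?enorm_ge0 ?(ltW sg_gt0)// (le_trans _ xyr)// enorm_ge0.
Qed.

Lemma ker_le x y (r : R) : 0 < r -> r <= enorm (x - y) -> ker x y <= (r `^ sg)^-1.
Proof.
move=> r0 xyr; rewrite lef_pV2 ?posrE ?powR_gt0//; last exact: lt_le_trans xyr.
by rewrite ge0_ler_powR ?nnegrE ?enorm_ge0 ?(ltW sg_gt0)// ltW.
Qed.

Lemma pow_unbounded (c : R) : exists j, c < 2 ^+ j.
Proof.
have [m cm] : exists m, c < m%:R.
  exists (Num.truncn c).+1; have [c0|c0] := leP 0 c; first exact: truncnS_gt.
  by rewrite (lt_trans c0)// ltr0n.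
exists m; rewrite (lt_trans cm)// -natrX ltr_nat; exact: ltn_expl.
Qed.

Lemma dyadic_near (r e : R) : 0 < e < r -> exists j : nat,
  r / 2 ^+ j.+1 <= e < 2 * (r / 2 ^+ j.+1).
Proof.
move=> /andP[e0 er].
have ex : exists j : nat, r / 2 ^+ j <= e.
  have [j hj] := pow_unbounded (r / e); exists j.
  rewrite ler_pdivrMr ?exprn_gt0//; move: hj; rewrite ltr_pdivrMr// => /ltW.
  by rewrite mulrC.
case: (ex_minnP ex) => -[|j] hj jmin.
  by move: hj; rewrite expr0 divr1 leNgt er.
exists j; rewrite hj/= ltNge; apply/negP => h.
have h' : r / 2 ^+ j <= e.
  by rewrite (le_trans _ h)// exprS invfM mulrCA [2 * (_ * _)]mulrA mulfV ?mul1r.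
by have := jmin j h'; rewrite ltnn.
Qed.

Lemma dyadic_far (r e : R) : 0 < r <= e -> exists j : nat,
  r * 2 ^+ j <= e < 2 * (r * 2 ^+ j).
Proof.
move=> /andP[r0 re].
have ex : exists j : nat, e < r * 2 ^+ j.
  have [j hj] := pow_unbounded (e / r); exists j.
  by move: hj; rewrite ltr_pdivrMr// mulrC.
case: (ex_minnP ex) => -[|j] hj jmin.
  by move: hj; rewrite expr0 mulr1 ltNge re.
exists j; rewrite mulrCA -exprS hj andbT leNgt; apply/negP => h.
by have := jmin j h; rewrite ltnn.
Qed.

(** On the shell a_j <= |x - y| < 2 a_j with a_j = r / 2^(j+1), the kernel is at most (2 a_j)^p
    a_j^-(n+ps) and the enclosing cube has volume (4 a_j)^n. The product is a multiple of
    a_j^(p(1-s)), which is summable because s < 1. *)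
Lemma integral_ker_near r : 0 < r -> exists2 S : R, 0 <= S &
  forall x, (\int[mu]_y (ker_near r x y)%:E <= S%:E)%E.
Proof.
move=> r0.
pose al := p * (1 - s).
have al0 : 0 < al by rewrite mulr_gt0 ?subr_gt0// (lt_trans ltr01).
pose a j : R := r / 2 ^+ j.+1.
have a0 j : 0 < a j by rewrite divr_gt0// exprn_gt0.
pose A : R := 2 `^ p * 4 ^+ n * (r / 2) `^ al.
pose z : R := (2 `^ al)^-1.
have z01 : 0 <= z < 1.
  rewrite invr_ge0 powR_ge0/= invf_lt1 ?powR_gt0//.
  exact: powR2_gt1.
exists (A / (1 - z)).
  case/andP : z01 => z0 z1.
  by rewrite divr_ge0 ?subr_ge0 ?(ltW z1)// !mulr_ge0 ?powR_ge0 ?exprn_ge0.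
move=> x.
apply: (@integral_le_geometric _ _ _ mu (ker_near r x) (fun j => cube x (2 * a j))
  (fun j => (2 * a j) `^ p * (a j `^ sg)^-1) (fun j => (2 * (2 * a j)) ^+ n) A z).
- exact: measurable_ker_near.
- exact: ker_near_ge0.
- by move=> j; exact: measurable_cube.
- by move=> j; apply: lebesgueRn_cube; rewrite mulr_gt0.
- by move=> j; rewrite mulr_ge0 ?invr_ge0 ?powR_ge0.
- exact: z01.
- move=> j; rewrite powRM ?(ltW (a0 j))// powRD ?(gt_eqF (a0 j)) ?implybT//.
  rewrite (_ : 2 * (2 * a j) = 4 * a j); last by ring.
  rewrite exprMn powR_mulrn ?(ltW (a0 j))//.
  have -> : a j `^ p = a j `^ al * a j `^ (p * s).
    by rewrite -powRD ?(gt_eqF (a0 j)) ?implybT//; congr (_ `^ _); rewrite /al; ring.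
  have -> : a j `^ al = (r / 2) `^ al * z ^+ j.
    rewrite /a exprS invfM mulrA powRM ?divr_ge0 ?invr_ge0 ?exprn_ge0 ?(ltW r0)//.
    by congr (_ * _); rewrite /z powRV ?exprn_ge0// powR_expr// exprVn.
  rewrite /A; field.
  by rewrite !gt_eqF ?powR_gt0 ?exprn_gt0.
- move=> y; rewrite /ker_near; case: ifP => [xyr|]; last by rewrite eqxx.
  have [->|xy] := eqVneq x y; first by rewrite ker_diag mulr0 eqxx.
  have e0 : 0 < enorm (x - y) by rewrite enorm_gt0// subr_eq0.
  have [j /andP[h1 h2]] := @dyadic_near r (enorm (x - y)) ltac:(by rewrite e0 xyr).
  move=> _; exists j; first exact: cube_enorm.
  apply: ler_pM; rewrite ?powR_ge0 ?ker_ge0//.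
    have p0 : 0 <= p by rewrite (le_trans ler01)// ltW.
    apply: (ge0_ler_powR p0) (ltW h2); rewrite nnegrE ?enorm_ge0//.
    exact: mulr_ge0 (ltW (a0 j)).
  exact: ker_le.
Qed.

(** The same computation on growing shells a_j = r 2^j gives multiples of a_j^(-ps), summable
    because s > 0. *)
Lemma integral_ker_far r : 0 < r -> exists2 S : R, 0 <= S &
  forall x, (\int[mu]_y (ker_far r x y)%:E <= S%:E)%E.
Proof.
move=> r0.
pose al := p * s.
have al0 : 0 < al by rewrite mulr_gt0// (lt_trans ltr01).
pose a j : R := r * 2 ^+ j.
have a0 j : 0 < a j by rewrite mulr_gt0// exprn_gt0.
pose A : R := 4 ^+ n * (r `^ al)^-1.
pose z : R := (2 `^ al)^-1.
have z01 : 0 <= z < 1.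
  rewrite invr_ge0 powR_ge0/= invf_lt1 ?powR_gt0//.
  exact: powR2_gt1.
exists (A / (1 - z)).
  case/andP : z01 => z0 z1.
  by rewrite divr_ge0 ?subr_ge0 ?(ltW z1)// !mulr_ge0 ?invr_ge0 ?powR_ge0 ?exprn_ge0.
move=> x.
apply: (@integral_le_geometric _ _ _ mu (ker_far r x) (fun j => cube x (2 * a j))
  (fun j => (a j `^ sg)^-1) (fun j => (2 * (2 * a j)) ^+ n) A z).
- exact: measurable_ker_far.
- exact: ker_far_ge0.
- by move=> j; exact: measurable_cube.
- by move=> j; apply: lebesgueRn_cube; rewrite mulr_gt0.
- by move=> j; rewrite invr_ge0 powR_ge0.
- exact: z01.
- move=> j; rewrite powRD ?(gt_eqF (a0 j)) ?implybT//.
  rewrite (_ : 2 * (2 * a j) = 4 * a j); last by ring.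
  rewrite exprMn powR_mulrn ?(ltW (a0 j))//.
  have -> : a j `^ (p * s) = r `^ al * z ^- j.
    rewrite /a powRM ?exprn_ge0 ?(ltW r0)//.
    by congr (_ * _); rewrite /z -exprVn invrK powR_expr.
  rewrite /A; field.
  by rewrite !gt_eqF ?powR_gt0 ?exprn_gt0// invr_gt0 powR_gt0.
- move=> y; rewrite /ker_far; case: ifP => [xyr|]; last by rewrite eqxx.
  have [j /andP[h1 h2]] := @dyadic_far r (enorm (x - y)) ltac:(by rewrite r0 xyr).
  move=> _; exists j; first exact: cube_enorm.
  exact: ker_le.
Qed.

End kernels.

(** * Truncations as admissible test functions *)

Section ae_tools.
Context d (T : measurableType d) {R : realType}.
Variable mu : {sigma_finite_measure set T -> \bar R}.

Lemma ae_fst (P : T -> Prop) : (\forall x \ae mu, P x) ->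
  \forall z \ae (mu \x mu)%E, P z.1.
Proof.
move=> [A [mA A0 PA]]; exists (A `*` setT); split.
- exact: measurableX.
- by rewrite product_measure1E// [X in (X * _)%E]A0 mul0e.
- by move=> z /= Pz; split => //; exact: PA.
Qed.

Lemma ae_snd (P : T -> Prop) : (\forall x \ae mu, P x) ->
  \forall z \ae (mu \x mu)%E, P z.2.
Proof.
move=> [A [mA A0 PA]]; exists (setT `*` A); split.
- exact: measurableX.
- by rewrite product_measure1E// [X in (_ * X)%E]A0 mule0.
- by move=> z /= Pz; split => //; exact: PA.
Qed.

Lemma integral_swap (f : T * T -> \bar R) : measurable_fun setT f ->
  (forall z, 0 <= f z)%E ->
  (\int[mu \x mu]_z f z = \int[mu \x mu]_z f (z.2, z.1))%E.
Proof.
move=> mf f0; rewrite fubini_tonelli1// fubini_tonelli2//.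
by apply: (measurableT_comp mf); exact: measurable_swap.
Qed.

End ae_tools.

Lemma integrable_cst_fin d (T : measurableType d) (R : realType)
    (mu : {measure set T -> \bar R}) (D : set T) (c : R) :
  measurable D -> (mu D < +oo)%E -> mu.-integrable D (cst c%:E).
Proof.
move=> mD fD; apply/integrableP; split; first exact: measurable_cst.
by rewrite /= integral_cst// lte_mul_pinfty.
Qed.

Lemma ge0_integrable d (T : measurableType d) (R : realType)
    (mu : {measure set T -> \bar R}) (D : set T) (f : T -> R) :
  measurable D -> measurable_fun D (EFin \o f) -> (forall x, 0 <= f x) ->
  (\int[mu]_(x in D) (f x)%:E < +oo)%E -> mu.-integrable D (EFin \o f).
Proof.
move=> mD mf f0 fi; apply/integrableP; split => //.
rewrite (_ : (\int[mu]_(x in D) _)%E = (\int[mu]_(x in D) (f x)%:E)%E)//.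
by apply: eq_integral => x _; rewrite gee0_abs// lee_fin.
Qed.

Lemma integral_scaled_indic d (T : measurableType d) (R : realType)
    (mu : {measure set T -> \bar R}) (B : set T) (c : R) :
  measurable B -> 0 <= c -> (\int[mu]_x (c * \1_B x)%:E = c%:E * mu B)%E.
Proof.
move=> mB c0; under eq_integral do rewrite EFinM.
rewrite (@ge0_integralZl _ _ _ mu setT measurableT (fun x => (\1_B x)%:E))//.
- by rewrite integral_indic// setIT.
- exact/measurable_EFinP/measurable_indic.
Qed.

Section summable.
Context d (T : measurableType d) {R : realType}.
Variable mu : {measure set T -> \bar R}.
Variables (D : set T) (F : nat -> T -> R).
Hypotheses (mD : measurable D) (mF : forall j, measurable_fun D (F j))
  (F0 : forall j x, 0 <= F j x)
  (sF : (\sum_(0 <= j <oo) \int[mu]_(x in D) (F j x)%:E < +oo)%E).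

(** The sum is one integrable function above every single term. It serves as the dominating function
    for a sequence that is only known to converge in mean. *)
Lemma summable_integrable :
  mu.-integrable D (fun x => \sum_(0 <= j <oo) (F j x)%:E)%E.
Proof.
have H0 x : (0 <= \sum_(0 <= j <oo) (F j x)%:E)%E.
  by apply: nneseries_ge0 => j _ _; rewrite lee_fin.
apply/integrableP; split.
  apply: ge0_emeasurable_sum => [j x _ _|j _]; first by rewrite lee_fin.
  exact/measurable_EFinP.
under eq_integral do rewrite gee0_abs//.
rewrite integral_nneseries//; last by move=> j x _; rewrite lee_fin.
by move=> j; exact/measurable_EFinP.
Qed.

Lemma summable_ae_cvg : \forall x \ae mu, D x -> F ^~ x @ \oo --> 0.
Proof.
have := integrable_ae mD summable_integrable.
apply: filterS => x h Dx; have := h Dx => fx.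
have [H HE] : exists H, (\sum_(0 <= j <oo) (F j x)%:E)%E = H%:E.
  by exists (fine (\sum_(0 <= j <oo) (F j x)%:E)%E); rewrite fineK.
apply: cvg_series_cvg_0.
apply: nondecreasing_is_cvgn.
  by apply/nondecreasing_seqP => m; rewrite seriesSr/= lerDl.
exists H => _ [m _ <-]; rewrite -lee_fin -HE /series/= -sumEFin.
by apply: nneseries_lim_ge => j _ _; rewrite lee_fin.
Qed.

Lemma term_le_summable j x : ((F j x)%:E <= \sum_(0 <= i <oo) (F i x)%:E)%E.
Proof.
rewrite (@nneseriesD1 _ _ j)//; last by move=> i _; rewrite lee_fin.
by rewrite leeDl// nneseries_ge0// => i _ _; rewrite lee_fin.
Qed.

End summable.

(** * Passage to the limit in the weak formulation *)

Section limit_test.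
Context d (T : measurableType d) {R : realType}.
Variable mu : {sigma_finite_measure set T -> \bar R}.
Local Notation mu2 := (mu \x mu)%E.
(** [q] majorizes the increments of the barrier [w], and q^p k is integrable. A paraboloid grows too
    fast for this at infinity. But the test functions vanish outside [Om], so for y outside [Om] it
    suffices that [q] bounds |w x|; this is the second alternative in [wq]. *)
Variables (p : R) (Om : set T) (k q : T * T -> R) (g w : T -> R)
  (psi : nat -> T -> R) (Lam Mw : R).
Hypotheses (p1 : 1 < p) (mOm : measurable Om) (fOm : (mu Om < +oo)%E)
  (mk : measurable_fun setT k) (k0 : forall z, 0 <= k z)
  (mq : measurable_fun setT q) (q0 : forall z, 0 <= q z)
  (qC : forall x y, q (x, y) = q (y, x))
  (mg : measurable_fun setT g) (mw : measurable_fun setT w)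
  (mpsi : forall j, measurable_fun setT (psi j))
  (gOm : forall x, ~ Om x -> g x = 0)
  (psiOm : forall j x, ~ Om x -> psi j x = 0)
  (wOm : forall x, ~ Om x -> 0 <= w x)
  (wMw : forall x, Om x -> `|w x| <= Mw)
  (wq : forall x y, Om x ->
    `|w x - w y| <= q (x, y) \/ ~ Om y /\ `|w x| <= q (x, y)).
Let gd (z : T * T) := g z.1 - g z.2.
Let pd j (z : T * T) := psi j z.1 - psi j z.2.
Hypotheses
  (fg : (\int[mu2]_z (`|gd z| `^ p * k z)%:E < +oo)%E)
  (fg1 : (\int[mu]_(x in Om) (`|g x| `^ p)%:E < +oo)%E)
  (fq : (\int[mu2]_z (q z `^ p * k z)%:E < +oo)%E)
  (sE : (\sum_(0 <= j <oo) \int[mu2]_z (`|gd z - pd j z| `^ p * k z)%:E < +oo)%E)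
  (sL : (\sum_(0 <= j <oo) \int[mu]_(x in Om) (`|g x - psi j x| `^ p)%:E < +oo)%E).
Let Phi j x := soft j (psi j x - w x).
Let v x := Num.max (g x - w x) 0.
Let W (f : T -> R) (z : T * T) := pJ p (gd z) * (f z.1 - f z.2) * k z.
Hypothesis weak : forall j,
  (\int[mu2]_z (W (Phi j) z)%:E <= \int[mu]_(x in Om) (Lam * Phi j x)%:E)%E.

Let softL j (a b : R) : `|soft j a - soft j b| <= `|a - b|.
Proof.
have [ab|ba] := leP a b.
  by have /andP[? ?] := soft_incr j ab; rewrite distrC ger0_norm// [leRHS]distrC ger0_norm// subr_ge0.
have /andP[? ?] := soft_incr j (ltW ba).
by rewrite ger0_norm// ger0_norm// subr_ge0 ltW.
Qed.

Let PhiOm j x : ~ Om x -> Phi j x = 0.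
Proof. by move=> xOm; rewrite /Phi psiOm// soft_le0// sub0r oppr_le0 wOm. Qed.

Let Phi_le j x : `|Phi j x| <= `|psi j x| + `|w x|.
Proof.
rewrite /Phi -[X in `|X|]subr0 -(soft_le0 j (lexx 0)) (le_trans (softL _ _ _))//.
by rewrite subr0 ler_normB.
Qed.

Let Phi_diff1 j x y : Om x -> `|Phi j x - Phi j y| <= q (x, y) + `|psi j x - psi j y|.
Proof.
move=> xOm; have [h|[yOm h]] := wq y xOm.
  rewrite (le_trans (softL _ _ _))//.
  rewrite (_ : psi j x - w x - (psi j y - w y) = (w y - w x) + (psi j x - psi j y)); last by ring.
  by rewrite (le_trans (ler_normD _ _))// lerD2r distrC.
by rewrite (PhiOm _ yOm) (psiOm _ yOm) !subr0 (le_trans (Phi_le _ _))// addrC lerD2r.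
Qed.

Let Phi_diff j (z : T * T) : `|Phi j z.1 - Phi j z.2| <= q z + `|pd j z|.
Proof.
case: z => x y; rewrite /pd/=.
have [xOm|xOm] := pselect (Om x); first exact: Phi_diff1.
have [yOm|yOm] := pselect (Om y).
  by rewrite distrC [`|psi j x - _|]distrC qC; exact: Phi_diff1.
by rewrite !PhiOm// subrr normr0 addr_ge0.
Qed.

Let mPhi j : measurable_fun setT (Phi j).
Proof.
apply: (@measurableT_comp _ _ _ _ _ _ (soft j)).
  apply: measurable_funM => //.
  apply: (@measurableT_comp _ _ _ _ _ _ (flat 1)) => //.
  by apply: continuous_measurable_fun; exact: continuous_flat.
exact: measurable_funB.
Qed.

Let mv : measurable_fun setT v.
Proof. by apply: measurable_maxr => //; exact: measurable_funB. Qed.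

Let mdiff (f : T -> R) : measurable_fun setT f ->
  measurable_fun setT (fun z : T * T => f z.1 - f z.2).
Proof.
move=> mf; apply: measurable_funB.
  exact: (measurableT_comp mf measurable_fst).
exact: (measurableT_comp mf measurable_snd).
Qed.

Let mW f : measurable_fun setT f -> measurable_fun setT (W f).
Proof.
move=> mf; apply: measurable_funM => //; apply: measurable_funM; last exact: mdiff.
by apply: (measurableT_comp (@measurable_pJ _ p)); exact: mdiff.
Qed.

Let mpow (f : T * T -> R) : measurable_fun setT f ->
  measurable_fun setT (fun z => `|f z| `^ p * k z).
Proof.
move=> mf; apply: measurable_funM => //.
apply: (measurableT_comp (measurable_powR _)).
exact: (measurableT_comp (@normr_measurable R setT)).
Qed.

Let psi_cvg : \forall x \ae mu, psi ^~ x @ \oo --> g x.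
Proof.
have := @summable_ae_cvg _ T R mu Om (fun j x => `|g x - psi j x| `^ p) mOm _ _ sL.
have h1 : forall j, measurable_fun Om (fun x => `|g x - psi j x| `^ p).
  move=> j; apply: measurable_funTS.
  apply: (measurableT_comp (measurable_powR _)).
  apply: (measurableT_comp (@normr_measurable R setT)).
  exact: measurable_funB.
move=> /(_ h1 (fun _ _ => powR_ge0 _ _)); apply: filterS => x h.
have [xOm|xOm] := pselect (Om x); last first.
  rewrite gOm//; rewrite (_ : (fun j => _) = cst 0); first exact: cvg_cst.
  by apply/funext => j; rewrite psiOm.
have {}h := h xOm.
suff : (fun j => g x - psi j x) @ \oo --> 0.
  move=> h'; rewrite (_ : (fun j => _) = fun j => g x - (g x - psi j x)); last first.
    by apply/funext => j; ring.
  rewrite -[X in _ --> X](subr0 (g x)); apply: cvgB => //; exact: cvg_cst.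
apply/cvgr0Pnorm_lt => e e0.
have ep0 : 0 < e `^ p by rewrite powR_gt0.
move/cvgr0Pnorm_lt : h => /(_ _ ep0); apply: filterS => j.
rewrite ger0_norm ?powR_ge0// => hj; rewrite ltNge; apply/negP => eh.
move: hj; rewrite ltNge => /negP; apply.
by apply: powR_le => //; [rewrite ltW// (lt_trans ltr01)|exact: ltW].
Qed.

Let Phi_cvg x : psi ^~ x @ \oo --> g x -> Phi ^~ x @ \oo --> v x.
Proof.
move=> h.
pose t := g x - w x; pose t_ j := psi j x - w x.
have ht : t_ j - t @[j --> \oo] --> 0.
  rewrite -(subrr t); apply: cvgB; last exact: cvg_cst.
  by apply: cvgB => //; exact: cvg_cst.
suff : v x - Phi j x @[j --> \oo] --> 0.
  move=> h'; rewrite (_ : (fun j => _) = fun j => v x - (v x - Phi j x)); last first.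
    by apply/funext => j; ring.
  rewrite -[X in _ --> X](subr0 (v x)); apply: cvgB => //; exact: cvg_cst.
(* The index of [soft] and its argument move together; the uniform Lipschitz bound decouples the two
   limits. *)
rewrite (_ : (fun j => _) =
    fun j => (v x - soft j t) + (soft j t - soft j (t_ j))); last first.
  by apply/funext => j; rewrite /Phi /t_; ring.
rewrite -[X in _ --> X](addr0 0); apply: cvgD; first exact: soft_cvg.
apply/cvgr0Pnorm_lt => e e0; move/cvgr0Pnorm_lt : ht => /(_ _ e0).
by apply: filterS => j; apply: le_lt_trans; rewrite distrC softL// distrC.
Qed.

Let H z := (\sum_(0 <= j <oo) (`|gd z - pd j z| `^ p * k z)%:E)%E.

Let p0 : 0 <= p. Proof. by rewrite (le_trans ler01)// ltW. Qed.

(** Young's inequality separates the increments of [g] from those of [Phi j]. The latter are at most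
    q + |gd| + |gd - pd j|, and the only term depending on [j] is absorbed in the sum [H] of all
    errors. *)
Let Wdom j z : (`|(W (Phi j) z)%:E| <=
  ((1 + 3 `^ p) * (`|gd z| `^ p * k z) + 3 `^ p * (q z `^ p * k z))%:E +
  (3 `^ p)%:E * H z)%E.
Proof.
have c0 : 0 <= (3 : R) `^ p by exact: powR_ge0.
apply: (@le_trans _ _ (((1 + 3 `^ p) * (`|gd z| `^ p * k z) + 3 `^ p * (q z `^ p * k z))%:E +
   (3 `^ p)%:E * (`|gd z - pd j z| `^ p * k z)%:E)%E); last first.
  rewrite leeD2l// lee_wpmul2l ?lee_fin//.
  apply: (@term_le_summable _ _ _ (fun j z => `|gd z - pd j z| `^ p * k z)).
  by move=> i y; rewrite mulr_ge0// powR_ge0.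
rewrite -EFinM -EFinD lee_fin.
rewrite /W normrM normrM (ger0_norm (k0 z)) normr_pJ//.
rewrite [leRHS](_ : _ = (`|gd z| `^ p + 3 `^ p * (q z `^ p + `|gd z| `^ p +
   `|gd z - pd j z| `^ p)) * k z); last by ring.
rewrite ler_wpM2r//.
apply: le_trans (ler_wpM2l (powR_ge0 _ _) (Phi_diff j z)) _.
apply: le_trans (young_powR p1 (normr_ge0 _) (addr_ge0 (q0 z) (normr_ge0 _))) _.
rewrite lerD2l; apply: le_trans (powRD3_le p0 (q0 z) (normr_ge0 (gd z)) (normr_ge0 _)).
apply: powR_le => //; first by rewrite addr_ge0.
rewrite -addrA lerD2l; rewrite -[X in `|X| <= _](subrK (gd z)) addrC.
by rewrite (le_trans (ler_normD _ _))// lerD2r distrC.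
Qed.

Let idom : mu2.-integrable setT (fun z =>
  ((1 + 3 `^ p) * (`|gd z| `^ p * k z) + 3 `^ p * (q z `^ p * k z))%:E +
  (3 `^ p)%:E * H z)%E.
Proof.
have i1 : mu2.-integrable setT (fun z => (`|gd z| `^ p * k z)%:E).
  apply: ge0_integrable.
  - exact: measurableT.
  - by apply/measurable_EFinP; exact: mpow (mdiff mg).
  - by move=> z; rewrite mulr_ge0// powR_ge0.
  - exact: fg.
have i2 : mu2.-integrable setT (fun z => (q z `^ p * k z)%:E).
  apply: ge0_integrable.
  - exact: measurableT.
  - apply/measurable_EFinP; apply: measurable_funM => //.
    exact: (measurableT_comp (measurable_powR _)).
  - by move=> z; rewrite mulr_ge0// powR_ge0.
  - exact: fq.
have i3 : mu2.-integrable setT H.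
  apply: summable_integrable => //.
    by move=> j; apply: mpow; apply: measurable_funB; apply: mdiff.
  by move=> j z; rewrite mulr_ge0// powR_ge0.
apply: integrableD => //; last exact: integrableZl.
under eq_fun do rewrite EFinD !EFinM.
by apply: integrableD => //; rewrite ?[X in _.-integrable _ X](_ : _ = fun z => _)//;
  exact: integrableZl.
Qed.

Lemma limit_test_cvg : mu2.-integrable setT (EFin \o W v) /\
  (\int[mu2]_z (W (Phi j) z)%:E @[j --> \oo] --> \int[mu2]_z (W v z)%:E)%E.
Proof.
have [||||h _ h'] := @dominated_convergence _ _ _ mu2 setT measurableT
   (fun j z => (W (Phi j) z)%:E) (fun z => (W v z)%:E) _ _ _ _ idom.
- by move=> j; apply/measurable_EFinP; exact: mW (mPhi j).
- by apply/measurable_EFinP; exact: mW mv.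
- have h1 := ae_fst psi_cvg; have h2 := ae_snd psi_cvg.
  apply: filterS2 h1 h2 => z c1 c2 _.
  apply: cvg_EFin; first exact: nearW.
  apply: cvgM; last exact: cvg_cst.
  apply: cvgM; first exact: cvg_cst.
  by apply: cvgB; exact: Phi_cvg.
- by apply: aeW => z j _; exact: Wdom.
by split.
Qed.

Lemma limit_test_rhs : mu.-integrable Om (fun x => (Lam * v x)%:E) /\
  (\int[mu]_(x in Om) (Lam * Phi j x)%:E @[j --> \oo] -->
   \int[mu]_(x in Om) (Lam * v x)%:E)%E.
Proof.
pose HL x := (\sum_(0 <= j <oo) (`|g x - psi j x| `^ p)%:E)%E.
(* [Mw] bounds the barrier; the 2 comes from using a <= 1 + a^p for |g| and for |g - psi j|.
   Constants are integrable since [Om] has finite measure. *)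
pose dom x := (`|Lam|%:E * ((Mw + 2)%:E + (`|g x| `^ p)%:E + HL x))%E.
have mgp (f : T -> R) : measurable_fun setT f ->
    measurable_fun Om (fun x => `|f x| `^ p).
  move=> mf; apply: measurable_funTS; apply: (measurableT_comp (measurable_powR _)).
  exact: (measurableT_comp (@normr_measurable R setT)).
have idomL : mu.-integrable Om dom.
  apply: integrableZl => //; apply: integrableD => //.
    apply: integrableD => //; first exact: integrable_cst_fin.
    by apply: ge0_integrable => //; exact/measurable_EFinP/mgp.
  apply: summable_integrable => //.
  by move=> j; apply: mgp; exact: measurable_funB.
have [||||h _ h'] := @dominated_convergence _ _ _ mu Om mOm
   (fun j x => (Lam * Phi j x)%:E) (fun x => (Lam * v x)%:E) dom _ _ _ idomL.
- by move=> j; apply/measurable_EFinP; apply: measurable_funTS; exact: measurable_funM.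
- by apply/measurable_EFinP; apply: measurable_funTS; exact: measurable_funM.
- apply: filterS psi_cvg => x c1 _.
  apply: cvg_EFin; first exact: nearW.
  by apply: cvgM; [exact: cvg_cst|exact: Phi_cvg].
- apply: aeW => x j xOm.
  rewrite /dom abse_EFin normrM EFinM lee_wpmul2l ?lee_fin//.
  apply: (@le_trans _ _ ((Mw + 2)%:E + (`|g x| `^ p)%:E + (`|g x - psi j x| `^ p)%:E)%E).
    rewrite -!EFinD lee_fin (le_trans (Phi_le _ _))//.
    have h1 := wMw xOm.
    have h2 := le1Dpowr (ltW p1) (normr_ge0 (g x)).
    have h3 := le1Dpowr (ltW p1) (normr_ge0 (g x - psi j x)).
    have h4 : `|psi j x| <= `|g x| + `|g x - psi j x|.
      rewrite -{1}[psi j x](subrK (g x)) addrC (le_trans (ler_normD _ _))//.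
      by rewrite lerD2l distrC.
    lra.
  rewrite leeD2l//; apply: (@term_le_summable _ _ _ (fun j x => `|g x - psi j x| `^ p)).
  by move=> i y; exact: powR_ge0.
by split.
Qed.

Lemma limit_test_le :
  (\int[mu2]_z (W v z)%:E <= \int[mu]_(x in Om) (Lam * v x)%:E)%E.
Proof.
have [_ h1] := limit_test_cvg; have [_ h2] := limit_test_rhs.
by apply: (lee_cvg_to h1 h2); exact: nearW.
Qed.

End limit_test.

(** * De Giorgi iteration *)

Section de_giorgi.
Context d (T : measurableType d) {R : realType}.
Variable mu : {sigma_finite_measure set T -> \bar R}.
Variables (n : nat) (p s c rmax : R) (K : T * T -> R) (C : T -> R -> set T).
Local Notation sg := (n%:R + p * s).
Hypotheses (n0 : (0 < n)%N) (p1 : 1 < p) (s0 : 0 < s) (c0 : 0 < c)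
  (rmax0 : 0 < rmax) (mK : measurable_fun setT K) (K0 : forall z, 0 <= K z)
  (mC : forall x r, measurable (C x r))
  (muC : forall x r, 0 < r -> mu (C x r) = ((2 * r) ^+ n)%:E)
  (KC : forall x y r, 0 < r <= rmax -> C x r y -> x <> y ->
    ((c * r) `^ sg)^-1 <= K (x, y)).

Definition trunc_energy (f : T -> R) (t : R) : \bar R :=
  (\int[mu \x mu]_z (`|Num.max (f z.1 - t) 0 - Num.max (f z.2 - t) 0| `^ p * K z)%:E)%E.

Definition above (f : T -> R) (t : R) : set T := [set x | t < f x].

Lemma measurable_above (f : T -> R) (t : R) : measurable_fun setT f ->
  measurable (above f t).
Proof.
move=> mf; rewrite /above (_ : [set x | _] = f @^-1` `]t, +oo[).
  by rewrite -[X in measurable X]setTI; exact: mf.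
by apply/seteqP; split => x /=; rewrite in_itv/= andbT.
Qed.

Lemma measurable_trunc (f : T -> R) (t : R) : measurable_fun setT f ->
  measurable_fun setT
    (fun z : T * T => `|Num.max (f z.1 - t) 0 - Num.max (f z.2 - t) 0| `^ p * K z).
Proof.
move=> mf; apply: measurable_funM => //.
apply: (measurableT_comp (measurable_powR _)).
apply: (measurableT_comp (@normr_measurable R setT)).
apply: measurable_funB.
  apply: (@measurableT_comp _ _ _ _ _ _ (fun x => Num.max (f x - t) 0) _ fst) => //.
  by apply: measurable_maxr => //; exact: measurable_funB.
apply: (@measurableT_comp _ _ _ _ _ _ (fun x => Num.max (f x - t) 0) _ snd) => //.
by apply: measurable_maxr => //; exact: measurable_funB.
Qed.

(* Points of [{f > t + e}] see a share of [{f <= t}] in every cube whose volume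
   is twice that of [{f > t}]; this replaces the Sobolev inequality. *)
Lemma trunc_energy_ge (f : T -> R) (t e r Y : R) : measurable_fun setT f ->
  0 < e -> 0 < r <= rmax -> Y + Y = (2 * r) ^+ n ->
  (mu (above f t) <= Y%:E)%E ->
  ((e `^ p * ((c * r) `^ sg)^-1 * Y)%:E * mu (above f (t + e))
    <= trunc_energy f t)%E.
Proof.
move=> mf e0 r0 YY muA.
have r00 : 0 < r by case/andP : r0.
have Y0 : 0 <= Y.
  have : 0 <= (2 * r) ^+ n by rewrite exprn_ge0// mulr_ge0// ltW.
  lra.
pose A := above f t; have mA : measurable A by exact: measurable_above.
pose B := above f (t + e); have mB : measurable B by exact: measurable_above.
(* The cube has measure 2Y and {f > t} at most Y, so at least half of the cube remains. *)
have muCA x : (Y%:E <= mu (C x r `\` A))%E.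
  have : (Y%:E + Y%:E <= mu (C x r `\` A) + Y%:E)%E.
    rewrite -EFinD YY -(muC x r00) (measureDI mu (mC x r) mA) leeD2l//.
    by rewrite (le_trans _ muA)// le_measure// inE//; exact: measurableI.
  by rewrite leeD2rE.
pose k := e `^ p * ((c * r) `^ sg)^-1.
have k0 : 0 <= k by rewrite mulr_ge0 ?invr_ge0 ?powR_ge0.
have F0 z : (0 <= (`|Num.max (f z.1 - t) 0 - Num.max (f z.2 - t) 0| `^ p * K z)%:E :> \bar R)%E.
  by rewrite lee_fin mulr_ge0// powR_ge0.
have mF := measurable_trunc t mf.
rewrite /trunc_energy fubini_tonelli1//; last exact/measurable_EFinP.
rewrite -/k -(integral_scaled_indic mu mB (mulr_ge0 k0 Y0)).
apply: ge0_le_integral => //.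
- by move=> x _; rewrite lee_fin mulr_ge0// mulr_ge0.
- by apply/measurable_EFinP; apply: measurable_funM => //; exact: measurable_indic.
- by apply: measurable_fun_fubini_tonelli_F => //; exact/measurable_EFinP.
move=> x _; rewrite indicE; have [xB|xB] := boolP (x \in B); last first.
  by rewrite mulr0; apply: integral_ge0 => y _; exact: F0.
rewrite mulr1 EFinM; apply: (@le_trans _ _ (k%:E * mu (C x r `\` A))%E).
  by rewrite lee_wpmul2l// lee_fin.
have mCA : measurable (C x r `\` A) by exact: measurableD.
rewrite -(integral_scaled_indic mu mCA k0).
apply: ge0_le_integral => //.
- by move=> y _; rewrite lee_fin mulr_ge0.
- by apply/measurable_EFinP; apply: measurable_funM => //; exact: measurable_indic.
- apply/measurable_EFinP.
  by apply: (measurableT_comp mF); exact: pair1_measurable.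
move=> y _; rewrite indicE; have [yC|yC] := boolP (y \in C x r `\` A); last first.
  by rewrite mulr0; exact: (F0 (x, y)).
rewrite mulr1 lee_fin; move: xB yC; rewrite !inE /B /A /above /= => xB [yC /negP].
rewrite -leNgt => fy.
(* The truncation vanishes at [y] and is at least [e] at [x]. *)
rewrite (max_r (_ : f y - t <= 0)) ?subr_le0// subr0.
have fx : e <= f x - t by lra.
rewrite max_l ?(le_trans (ltW e0))// ger0_norm ?(le_trans (ltW e0))//.
apply: ler_pM; rewrite ?powR_ge0 ?invr_ge0 ?powR_ge0//.
  by apply: powR_le => //; rewrite ltW// ?(lt_trans ltr01).
apply: KC => // xy; move: xB; rewrite xy ltNge => /negP; apply.
by rewrite (le_trans fy)// lerDl ltW.
Qed.

(** In place of a nonlinear recursion, the decay is prescribed: radii r_j = r0 tau^j, levels t_j = h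
    (1 - 2^-j), and |{f > t_j}| <= Y_j = (2 r_j)^n / 2 by induction. The two energy bounds yield |{f
    > t_(j+1)}| <= E 2^(p(j+1)) c^sg r_j^(n+ps), where [h] has cancelled; hence [nu] = Y_0 is
    independent of [h]. *)
Lemma de_giorgi (E : R) : 0 <= E -> exists2 nu : R, 0 < nu &
  forall (f : T -> R) (h : R), measurable_fun setT f -> 0 < h ->
  (forall t, 0 <= t < h ->
    (trunc_energy f t <= (E * h `^ p)%:E * mu (above f t))%E) ->
  (mu (above f 0) <= nu%:E)%E -> mu [set x | (h <= f x)%R] = 0%E.
Proof.
move=> E0.
have p0 : 0 < p by rewrite (lt_trans ltr01).
have ps0 : 0 < p * s by exact: mulr_gt0.
(* Chosen so that tau^(ps) = 2^-p offsets the growth 2^(pj) caused by the shrinking level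
   differences. *)
pose tau : R := (2 `^ s^-1)^-1.
have tau0 : 0 < tau by rewrite invr_gt0 powR_gt0.
have tau1 : tau < 1 by rewrite invf_lt1 ?powR_gt0// powR2_gt1// invr_gt0.
have tauP j : (tau ^+ j) `^ (p * s) = (2 `^ p) ^- j.
  rewrite powR_expr ?(ltW tau0)// powRV ?powR_ge0// -powRrM.
  by rewrite (_ : s^-1 * (p * s) = p) ?exprVn//; field; rewrite gt_eqF.
(* [E + 1] keeps [M] positive when E = 0. *)
pose M : R := (E + 1) * 2 `^ p * c `^ sg.
have M0 : 0 < M by rewrite !mulr_gt0 ?powR_gt0// ltr_wpDl.
pose b : R := (2 * tau) ^+ n / 2.
have b0 : 0 < b by rewrite divr_gt0// exprn_gt0// mulr_gt0.
(* Makes M r0^(ps) <= b, where b r_j^n = Y_(j+1): exactly what the induction step asks for. *)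
pose r0 := Num.min rmax ((b / M) `^ (p * s)^-1).
have r00 : 0 < r0 by rewrite lt_min rmax0 powR_gt0// divr_gt0.
have r0M : M * r0 `^ (p * s) <= b.
  rewrite mulrC -ler_pdivlMr// (@le_trans _ _ (((b / M) `^ (p * s)^-1) `^ (p * s)))//.
    apply: powR_le; [exact: ltW|exact: ltW|].
    by rewrite /r0 ge_min lexx orbT.
  by rewrite -powRrM mulVf ?gt_eqF// powRr1// divr_ge0// ltW.
pose r j := r0 * tau ^+ j; have rj0 j : 0 < r j by rewrite mulr_gt0// exprn_gt0.
have rmaxj j : 0 < r j <= rmax.
  rewrite rj0/= (@le_trans _ _ r0)//; last by rewrite /r0 ge_min lexx.
  by rewrite ler_piMr ?(ltW r00)// exprn_ile1// ltW.
pose Y j := (2 * r j) ^+ n / 2.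
have Y0 j : 0 < Y j by rewrite divr_gt0// exprn_gt0// mulr_gt0.
exists (Y 0%N) => // f h mf h0 Hf f0.
pose t j : R := h * (1 - 2 ^- j).
pose e j : R := h * 2 ^- j.+1.
have e0 j : 0 < e j by rewrite mulr_gt0// invr_gt0 exprn_gt0.
have tS j : t j.+1 = t j + e j.
  rewrite /t /e exprS invfM -!mulrDr; congr (_ * _); field.
  by rewrite expf_neq0.
have tj0 j : 0 <= t j < h.
  have h1 : (2 : R) ^- j <= 1 by rewrite invf_le1 ?exprn_gt0// exprn_ege1// ler1n.
  have h2 : 0 < (2 : R) ^- j by rewrite invr_gt0 exprn_gt0.
  by rewrite mulr_ge0 ?subr_ge0 ?(ltW h0)//= -[ltRHS]mulr1 ltr_pM2l// ltrBlDr ltrDl.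
have claim j : (mu (above f (t j)) <= (Y j)%:E)%E.
  elim: j => [|j IH]; first by rewrite /t expr0 invr1 subrr mulr0.
  have := trunc_energy_ge mf (e0 j) (rmaxj j) _ IH.
  rewrite -tS => /(_ _)/le_trans H.
  have {H}/H : Y j + Y j = (2 * r j) ^+ n by rewrite /Y -splitr.
  move=> /(_ _ (Hf _ (tj0 j)))/le_trans H.
  have Eh0 : 0 <= E * h `^ p by rewrite mulr_ge0// powR_ge0.
  have /H {H} : ((E * h `^ p)%:E * mu (above f (t j)) <= (E * h `^ p)%:E * (Y j)%:E)%E.
    by rewrite lee_wpmul2l// lee_fin.
  have cr0 : 0 < c * r j by exact: mulr_gt0.
  have pe0 : 0 < e j `^ p / (c * r j) `^ sg * Y j.
    by apply: mulr_gt0 => //; rewrite divr_gt0// powR_gt0.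
  rewrite -EFinM muleC -lee_pdivlMr// -EFinM => /le_trans; apply.
  rewrite lee_fin.
  have -> : E * h `^ p * Y j / (e j `^ p / (c * r j) `^ sg * Y j) =
      E * (h `^ p / e j `^ p) * (c * r j) `^ sg.
    by field; rewrite !gt_eqF ?powR_gt0// mulr_gt0.
  have -> : h `^ p / e j `^ p = 2 `^ p * (2 `^ p) ^+ j.
    rewrite /e powRM ?invr_ge0 ?exprn_ge0 ?(ltW h0)// powRV ?exprn_ge0// powR_expr//.
    by rewrite exprS; field; rewrite !gt_eqF ?exprn_gt0 ?powR_gt0.
  have -> : (c * r j) `^ sg = c `^ sg * (r j ^+ n * (r0 `^ (p * s) * (2 `^ p) ^- j)).
    rewrite powRM ?(ltW c0) ?(ltW (rj0 j))//; congr (_ * _).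
    rewrite powRD ?(gt_eqF (rj0 j)) ?implybT// powR_mulrn ?(ltW (rj0 j))//; congr (_ * _).
    by rewrite /r powRM ?exprn_ge0 ?(ltW r00) ?(ltW tau0)// tauP.
  rewrite (_ : _ * _ = (E * 2 `^ p * c `^ sg) * r0 `^ (p * s) * r j ^+ n); last first.
    by field; rewrite gt_eqF// exprn_gt0// powR_gt0.
  rewrite (_ : Y j.+1 = b * r j ^+ n); last first.
    by rewrite /Y /b /r exprS [tau * _]mulrC !mulrA !exprMn; ring.
  rewrite ler_wpM2r ?exprn_ge0 ?(ltW (rj0 j))// (le_trans _ r0M)//.
  rewrite ler_wpM2r ?powR_ge0// /M -!mulrA ler_wpM2r ?mulr_ge0 ?powR_ge0//.
  by rewrite lerDl.
apply/eqP; rewrite -measure_le0.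
have Ycvg : Y j @[j --> \oo] --> 0.
  rewrite (_ : Y = fun j => ((2 * r0) ^+ n / 2) * (tau ^+ n) ^+ j); last first.
    by apply/funext => j; rewrite /Y /r !exprMn -!exprM mulnC; ring.
  apply: cvg_geometric; rewrite ger0_norm ?exprn_ge0 ?(ltW tau0)//.
  by rewrite exprn_ilt1 ?(ltW tau0)// -lt0n.
apply/lee_addgt0Pr => eps eps0; rewrite add0e.
have /cvgr0Pnorm_lt/(_ _ eps0)[N _ /(_ N (leqnn N)) YN] := Ycvg.
apply: (@le_trans _ _ (Y N)%:E).
  rewrite (le_trans _ (claim N))// le_measure ?inE//.
  - rewrite (_ : [set x | _] = f @^-1` `[h, +oo[).
      by rewrite -[X in measurable X]setTI; exact: mf.
    by apply/seteqP; split => x /=; rewrite in_itv/= andbT.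
  - exact: measurable_above.
  - by move=> x /=; apply: lt_le_trans; case/andP : (tj0 N).
by rewrite lee_fin (le_trans (ler_norm _))// ltW.
Qed.

End de_giorgi.

(** * Energy estimates *)

Section pointwise_estimates.
Context {R : realType}.
Variable p : R.
Hypothesis p1 : 1 < p.
Let p0 : 0 < p. Proof. exact: lt_trans p1. Qed.

(** The positive part is nondecreasing and 1-Lipschitz; an explicit chord slope replaces a case
    distinction on the signs later on. *)
Lemma max0_diff (X Y : R) : exists2 th, 0 <= th <= 1 &
  Num.max X 0 - Num.max Y 0 = th * (X - Y).
Proof.
wlog XY : X Y / Y < X.
  move=> H; have [XY|XY|->] := ltgtP X Y; last by exists 0; rewrite ?lexx ?ler01// !subrr mulr0.
    have [th th01 E] := H _ _ XY; exists th => //.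
    by rewrite -opprB E -mulrN opprB.
  exact: H.
have [Y0|] := boolP (0 <= Y).
  exists 1; first by rewrite ler01 lexx.
  by rewrite !max_l ?mul1r// (le_trans Y0)// ltW.
rewrite -ltNge => Y0; have [X0|] := boolP (X <= 0).
  by exists 0; rewrite ?lexx ?ler01// mul0r (max_r X0) (max_r (ltW Y0)) subrr.
rewrite -ltNge => X0; exists (X / (X - Y)).
  rewrite divr_ge0 ?subr_ge0 ?(ltW X0) ?(ltW XY)//= ler_pdivrMr ?subr_gt0//; lra.
by rewrite (max_l (ltW X0)) (max_r (ltW Y0)) subr0 divfK// gt_eqF// subr_gt0.
Qed.

(** The constants of [caccioppoli_pointwise]. [cac_c] comes from |a - b| <= 2|a| and the loss of one
    half when |a| dominates; [cac_C] collects both sides of the inequality when |b| dominates, with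
    |a - b| <= 3|b|. *)
Definition cac_c : R := (2 * 2 `^ p)^-1.
Definition cac_C : R := 3 * 2 `^ p + 3 `^ p.

Lemma cac_c_gt0 : 0 < cac_c.
Proof. by rewrite invr_gt0 mulr_gt0// powR_gt0. Qed.

Lemma cac_C_gt0 : 0 < cac_C.
Proof. by rewrite addr_gt0 ?mulr_gt0 ?powR_gt0. Qed.

(* [th] is the slope of [max(., 0)] given by [max0_diff]. *)
Lemma caccioppoli_pointwise (a b th : R) : 0 <= th <= 1 ->
  cac_c * `|th * (a - b)| `^ p <=
  pJ p a * (th * (a - b)) + cac_C * `|b| `^ p.
Proof.
move=> /andP[th0 th1].
(* If |a| >= 2|b|, the mixed term |a|^(p-1) |b| is at most half of |a|^p. Otherwise every term is a
   multiple of |b|^p. *)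
have [ab|ab] := leP (2 * `|b|) `|a|.
  have h1 : `|a - b| <= 2 * `|a| by rewrite (le_trans (ler_normB _ _))//; have := normr_ge0 a; have := normr_ge0 b; lra.
  have h2 : `|a| `^ p / 2 <= pJ p a * (a - b).
    have : `|pJ p a * b| <= `|a| `^ p / 2.
      rewrite normrM normr_pJ// -(powRBM p1 (normr_ge0 a)) -mulrA ler_wpM2l ?powR_ge0//; lra.
    by rewrite mulrBr pJM// ler_norml => /andP[]; lra.
  rewrite (@le_trans _ _ (pJ p a * (th * (a - b))))//; last first.
    by rewrite lerDl mulr_ge0 ?powR_ge0// ltW// cac_C_gt0.
  rewrite mulrCA (@le_trans _ _ (th * (`|a| `^ p / 2)))//; last by rewrite ler_wpM2l.
  rewrite /cac_c normrM (ger0_norm th0) powRM//.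
  have h3 : th `^ p <= th.
    rewrite -powRBM// ler_piMl//.
    by have := @powR_le R (p - 1) th 1 _ th0 th1; rewrite powR1; apply; rewrite subr_ge0 ltW.
  have a2 : 0 < 2 * (2 : R) `^ p by rewrite mulr_gt0// powR_gt0.
  rewrite ler_pdivrMl//.
  rewrite (_ : 2 * _ * _ = th * (2 `^ p * `|a| `^ p)); last by field.
  apply: ler_pM; rewrite ?powR_ge0//.
  rewrite -powRM//; apply: powR_le => //; exact: ltW.
have b0 : 0 <= `|b| by [].
have h1 : `|a - b| <= 3 * `|b| by rewrite (le_trans (ler_normB _ _))//; lra.
have h1' : `|th * (a - b)| <= 3 * `|b|.
  by rewrite normrM (ger0_norm th0) (le_trans _ h1)// ler_piMl.
have h2 : `|pJ p a * (th * (a - b))| <= 3 * 2 `^ p * `|b| `^ p.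
  rewrite normrM normr_pJ//.
  apply: (@le_trans _ _ ((2 * `|b|) `^ (p - 1) * (3 * `|b|))).
    apply: ler_pM; rewrite ?powR_ge0//; apply: powR_le => //; last exact: ltW.
    by rewrite subr_ge0 ltW.
  rewrite powRM// -mulrA [_ * (3 * _)]mulrCA powRBM// mulrCA mulrA.
  rewrite ler_wpM2r ?powR_ge0// ler_wpM2l//.
  by apply: ler_powR; [rewrite ler1n|rewrite gerBl].
have h3 : cac_c * `|th * (a - b)| `^ p <= 3 `^ p * `|b| `^ p.
  rewrite (@le_trans _ _ (`|th * (a - b)| `^ p))//.
    rewrite ler_piMl ?powR_ge0// /cac_c invf_le1 ?mulr_gt0 ?powR_gt0//.
    by have := ltW (powR2_gt1 p0); lra.
  by rewrite -powRM//; apply: powR_le => //; exact: ltW.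
rewrite /cac_C mulrDl; move: h2; rewrite ler_norml => /andP[]; lra.
Qed.

(** If b <= th a, subtracting [b] costs at most the factor 1 - th. Otherwise a < e / th, and both
    a^(p-1) and the possibly negative right-hand side are controlled by (e / th)^(p-1). Used with a
    = u y and a small b = u x. *)
Lemma pJ_sub_ge (a b e th : R) : 0 <= a -> 0 <= b <= e -> 0 < th < 1 ->
  (1 - th) `^ (p - 1) * a `^ (p - 1) - 2 * (e / th) `^ (p - 1) <= pJ p (a - b).
Proof.
move=> a0 /andP[b0 be] /andP[th0 th1].
have p10 : 0 <= p - 1 by rewrite subr_ge0 ltW.
have pe : 0 <= (e / th) `^ (p - 1) by exact: powR_ge0.
have th1' : 0 <= 1 - th by rewrite subr_ge0 ltW.
have [bth|bth] := leP b (th * a).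
  have ab : (1 - th) * a <= a - b by lra.
  have h0 : 0 <= (1 - th) * a by rewrite mulr_ge0.
  rewrite pJ_ge0E//; last exact: le_trans ab.
  rewrite -powRM// (@le_trans _ _ (((1 - th) * a) `^ (p - 1)))//; last exact: powR_le.
  by rewrite gerBl mulr_ge0.
have h1 : a `^ (p - 1) <= (e / th) `^ (p - 1).
  apply: powR_le => //; rewrite ler_pdivlMr// mulrC; lra.
have h2 : (1 - th) `^ (p - 1) <= 1.
  have := @powR_le R (p - 1) (1 - th) 1 p10 th1'; rewrite powR1; apply; lra.
have h3 : (1 - th) `^ (p - 1) * a `^ (p - 1) <= (e / th) `^ (p - 1).
  by rewrite -[leRHS]mul1r; apply: ler_pM; rewrite ?powR_ge0.
have h4 : - (e / th) `^ (p - 1) <= pJ p (a - b).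
  have [ab|ab] := leP b a; first by rewrite (@le_trans _ _ 0)// ?oppr_le0// mulr_ge0 ?powR_ge0 ?subr_ge0.
  rewrite -(opprB b a) pJN lerN2 pJ_ge0E ?subr_ge0// ?(ltW ab)//.
  apply: powR_le => //; first by rewrite subr_ge0 ltW.
  rewrite (@le_trans _ _ e)//; first lra.
  by rewrite ler_pdivlMr// ler_piMr ?(ltW th1)// (le_trans b0).
lra.
Qed.

End pointwise_estimates.

(** No integrability of [P] or [Q] is assumed: an infinite integral of [Q] makes the right-hand side
    infinite because that of [W] is finite. *)
Lemma ge0_le_integral_sum d (T : measurableType d) (R : realType)
    (mu : {measure set T -> \bar R}) (P Q W : T -> R) :
  measurable_fun setT P -> measurable_fun setT Q ->
  (forall x, 0 <= P x) -> (forall x, 0 <= Q x) ->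
  mu.-integrable setT (EFin \o W) -> (forall x, P x <= W x + Q x) ->
  (\int[mu]_x (P x)%:E <= \int[mu]_x (W x)%:E + \int[mu]_x (Q x)%:E)%E.
Proof.
move=> mP mQ P0 Q0 iW PWQ.
have [Qoo|Qoo] := ltP (\int[mu]_x (Q x)%:E)%E +oo%E; last first.
  move: Qoo; rewrite leye_eq => /eqP ->; rewrite addey ?leey//.
  by have := integrable_fin_num measurableT iW; rewrite fin_numE => /andP[].
have iQ : mu.-integrable setT (EFin \o Q).
  by apply: ge0_integrable => //; exact/measurable_EFinP.
rewrite -(integralD measurableT iW iQ).
apply: ge0_le_integral => //.
- by move=> x _; rewrite lee_fin.
- exact/measurable_EFinP.
- by apply: emeasurable_funD; [exact: measurable_int iW|exact: measurable_int iQ].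
- by move=> x _; rewrite /= -EFinD lee_fin.
Qed.

(** * Energy of truncations of sub- and supersolutions *)

Section energy_estimates.
Context d (T : measurableType d) {R : realType}.
Variable mu : {sigma_finite_measure set T -> \bar R}.
Local Notation mu2 := (mu \x mu)%E.
Variables (p : R) (k : T * T -> R) (N : T * T -> bool).
Hypotheses (p1 : 1 < p) (mk : measurable_fun setT k) (k0 : forall z, 0 <= k z)
  (kC : forall x y, k (x, y) = k (y, x))
  (mN : measurable_fun setT N) (NC : forall x y, N (x, y) = N (y, x)).

(** The symmetric relation [N] separates the pairs that carry the energy from those that carry the
    nonlocal gain. *)
Definition kern_near (z : T * T) : R := if N z then k z else 0.
Definition kern_far (z : T * T) : R := if N z then 0 else k z.

Definition weak_integrand (u phi : T -> R) (z : T * T) : R :=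
  pJ p (u z.1 - u z.2) * (phi z.1 - phi z.2) * k z.

Lemma kern_near_ge0 z : 0 <= kern_near z.
Proof. by rewrite /kern_near; case: ifP. Qed.

Lemma kern_far_ge0 z : 0 <= kern_far z.
Proof. by rewrite /kern_far; case: ifP. Qed.

Lemma measurable_kern_near : measurable_fun setT kern_near.
Proof. by apply: measurable_fun_ifT. Qed.

Lemma measurable_kern_far : measurable_fun setT kern_far.
Proof. by apply: measurable_fun_ifT. Qed.

Lemma kern_farC x y : kern_far (x, y) = kern_far (y, x).
Proof. by rewrite /kern_far kC NC. Qed.

Lemma kern_split z : k z = kern_near z + kern_far z.
Proof. by rewrite /kern_near /kern_far; case: ifP; rewrite ?addr0 ?add0r. Qed.

Let mfst (f : T -> R) : measurable_fun setT f ->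
  measurable_fun setT (fun z : T * T => f z.1).
Proof. by move=> mf; exact: (measurableT_comp mf measurable_fst). Qed.

Let msnd (f : T -> R) : measurable_fun setT f ->
  measurable_fun setT (fun z : T * T => f z.2).
Proof. by move=> mf; exact: (measurableT_comp mf measurable_snd). Qed.

Lemma integral_product_le (f : T -> R) (h : T * T -> R) (S : R) :
  measurable_fun setT f -> measurable_fun setT h ->
  (forall x, 0 <= f x) -> (forall z, 0 <= h z) -> 0 <= S ->
  (forall x, \int[mu]_y (h (x, y))%:E <= S%:E)%E ->
  (\int[mu2]_z (f z.1 * h z)%:E <= S%:E * \int[mu]_x (f x)%:E)%E.
Proof.
move=> mf mh f0 h0 S0 hS.
rewrite fubini_tonelli1; last 2 first.
- by apply/measurable_EFinP; apply: measurable_funM => //; exact: mfst.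
- by move=> z; rewrite lee_fin mulr_ge0.
rewrite -ge0_integralZl//; last 2 first.
- exact/measurable_EFinP.
- by move=> x _; rewrite lee_fin.
apply: ge0_le_integral => //.
- by move=> x _; apply: integral_ge0 => y _; rewrite lee_fin mulr_ge0.
- apply: measurable_fun_fubini_tonelli_F.
    by apply/measurable_EFinP; apply: measurable_funM => //; exact: mfst.
  by move=> z; rewrite lee_fin mulr_ge0.
- by apply/measurable_EFinP; exact: measurable_funM.
move=> x _; rewrite /fubini_F /=; under eq_integral do rewrite EFinM.
rewrite ge0_integralZl//; last 3 first.
- apply/measurable_EFinP; exact: (measurableT_comp mh (@pair1_measurable _ _ _ _ x)).
- by move=> y _; rewrite lee_fin.
- by rewrite lee_fin.
by rewrite muleC lee_wpmul2r// lee_fin.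
Qed.

Lemma integral_product_ge (f : T -> R) (h : T * T -> R) (S : R) :
  measurable_fun setT f -> measurable_fun setT h ->
  (forall x, 0 <= f x) -> (forall z, 0 <= h z) -> 0 <= S ->
  (forall x, 0 < f x -> (S%:E <= \int[mu]_y (h (x, y))%:E)%E) ->
  (S%:E * \int[mu]_x (f x)%:E <= \int[mu2]_z (f z.1 * h z)%:E)%E.
Proof.
move=> mf mh f0 h0 S0 hS.
rewrite fubini_tonelli1; last 2 first.
- by apply/measurable_EFinP; apply: measurable_funM => //; exact: mfst.
- by move=> z; rewrite lee_fin mulr_ge0.
rewrite -ge0_integralZl//; last 2 first.
- exact/measurable_EFinP.
- by move=> x _; rewrite lee_fin.
apply: ge0_le_integral => //.
- by move=> x _; rewrite -EFinM lee_fin mulr_ge0.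
- by apply/measurable_EFinP; exact: measurable_funM.
- apply: measurable_fun_fubini_tonelli_F.
    by apply/measurable_EFinP; apply: measurable_funM => //; exact: mfst.
  by move=> z; rewrite lee_fin mulr_ge0.
move=> x _; rewrite /fubini_F /=; under eq_integral do rewrite EFinM.
rewrite ge0_integralZl//; last 3 first.
- apply/measurable_EFinP; exact: (measurableT_comp mh (@pair1_measurable _ _ _ _ x)).
- by move=> y _; rewrite lee_fin.
- by rewrite lee_fin.
have [->|fx] := eqVneq (f x) 0; first by rewrite mule0 mul0e.
have fx0 : 0 < f x by rewrite lt_neqAle eq_sym fx f0.
by rewrite [leLHS]muleC; apply: lee_wpmul2l; [rewrite lee_fin|exact: hS].
Qed.

(** A constant barrier has no increments, so [caccioppoli_pointwise] applies with b = 0 and leaves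
    no error. The far part of the integrand is nonnegative and is dropped. *)
Lemma sub_energy (u : T -> R) (t Lam M : R) :
  measurable_fun setT u -> (forall x, u x <= M) -> 0 <= t -> 0 <= Lam -> 0 <= M ->
  let v x := Num.max (u x - t) 0 in
  mu2.-integrable setT (EFin \o weak_integrand u v) ->
  (\int[mu2]_z (weak_integrand u v z)%:E <= \int[mu]_x (Lam * v x)%:E)%E ->
  ((cac_c p)%:E * trunc_energy mu p kern_near u t <= (Lam * M)%:E * mu (above u t))%E.
Proof.
move=> mu_ uM t0 Lam0 M0 v iW WLam.
have mv : measurable_fun setT v by apply: measurable_maxr => //; exact: measurable_funB.
have mA := measurable_above t mu_.
have mE := measurable_trunc p measurable_kern_near t mu_.
have c0 := cac_c_gt0 p.
apply: (@le_trans _ _ (\int[mu2]_z (weak_integrand u v z)%:E)%E).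
  rewrite /trunc_energy -ge0_integralZl//; last 3 first.
  - exact/measurable_EFinP.
  - by move=> z _; rewrite lee_fin mulr_ge0 ?powR_ge0 ?kern_near_ge0.
  - by rewrite lee_fin ltW.
  rewrite -[leRHS]adde0 -(integral0 mu2 setT).
  apply: (@ge0_le_integral_sum _ _ _ _ _ (fun=> 0)) => //.
  - exact: measurable_funM.
  - by move=> z; rewrite mulr_ge0 ?(ltW c0)// mulr_ge0 ?powR_ge0 ?kern_near_ge0.
  - move=> z; rewrite addr0 /weak_integrand.
    have [th th01 E] := max0_diff (u z.1 - t) (u z.2 - t).
    have := @caccioppoli_pointwise _ _ p1 (u z.1 - u z.2) 0 th th01.
    rewrite normr0 powR0_pos ?(lt_trans ltr01)// mulr0 addr0 subr0.
    have {}E : v z.1 - v z.2 = th * (u z.1 - u z.2) by rewrite /v E; congr (_ * _); ring.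
    rewrite -E => h; rewrite mulrA.
    apply: (le_trans (ler_wpM2r (kern_near_ge0 z) h)); rewrite ler_wpM2l//.
      by rewrite (le_trans _ h)// mulr_ge0 ?powR_ge0// ltW.
    by rewrite (kern_split z) lerDl kern_far_ge0.
apply: (le_trans WLam); rewrite -(integral_scaled_indic mu mA (mulr_ge0 Lam0 M0)).
apply: ge0_le_integral => //.
- by move=> x _; rewrite lee_fin mulr_ge0// le_max lexx orbT.
- by apply/measurable_EFinP; exact: measurable_funM.
- by apply/measurable_EFinP; apply: measurable_funM => //; exact: measurable_indic.
move=> x _; rewrite lee_fin -mulrA ler_wpM2l// indicE.
have [xA|xA] := boolP (x \in above u t).
  by rewrite mulr1 /v ge_max M0 andbT (le_trans _ (uM x))// gerBl.
move: xA; rewrite notin_setE /above/= => /negP; rewrite -leNgt => ut.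
by rewrite mulr0 /v max_r// subr_le0.
Qed.

(** On near pairs the only error is the increment of [w], controlled by [h]. On far pairs [u x <= e]
    on [A] lets [pJ_sub_ge] produce the gain [a y - b]. Gain and errors occur once for [x] and once
    for [y], hence the factors 2. *)
Lemma super_energy (u w : T -> R) (h : T * T -> R) (Lam L S e th T0 Gam : R) :
  measurable_fun setT u -> measurable_fun setT w -> (forall x, 0 <= u x) ->
  let f x := - u x - w x in
  let v x := Num.max (f x) 0 in
  let A := above f 0 in
  let a x := (1 - th) `^ (p - 1) * u x `^ (p - 1) in
  let b := 2 * (e / th) `^ (p - 1) in
  mu2.-integrable setT (EFin \o weak_integrand (fun x => - u x) v) ->
  (\int[mu2]_z (weak_integrand (fun x => - u x) v z)%:E <= \int[mu]_x (Lam * v x)%:E)%E ->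
  measurable_fun setT h -> (forall z, 0 <= h z) -> (forall x y, h (x, y) = h (y, x)) ->
  0 <= L -> 0 <= S -> 0 <= T0 -> 0 <= Gam -> 0 < th < 1 ->
  (forall x, \int[mu]_y (h (x, y))%:E <= S%:E)%E ->
  (forall x y, N (x, y) -> A x -> `|w x - w y| `^ p * k (x, y) <= L * h (x, y)) ->
  (forall x, A x -> u x <= e) ->
  (forall x, \int[mu]_y (kern_far (x, y))%:E <= T0%:E)%E ->
  (forall x, A x -> (Gam%:E <= \int[mu]_y (a y * kern_far (x, y))%:E)%E) ->
  ((cac_c p)%:E * trunc_energy mu p kern_near f 0
     + (2 * Gam)%:E * \int[mu]_x (v x)%:E <=
   \int[mu]_x (Lam * v x)%:E + ((2 * (cac_C p * L * S))%:E * mu A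
     + (2 * (b * T0))%:E * \int[mu]_x (v x)%:E))%E.
Proof.
move=> mu_ mw u0 f v A a b iW WLam mh h0 hC L0 S0 T00 G0 th01 hS wL ue kfT kfG.
have mf : measurable_fun setT f.
  by apply: measurable_funB => //; exact: measurable_funN.
have mv : measurable_fun setT v by exact: measurable_maxr.
have v0 x : 0 <= v x by rewrite le_max lexx orbT.
have mA : measurable A := measurable_above 0 mf.
have vA x : 0 < v x -> A x by rewrite /v lt_max ltxx orbF.
have vNA x : ~ A x -> v x = 0.
  by move=> xA; apply/eqP; rewrite eq_le v0 andbT leNgt; apply/negP => /vA.
have c0 := cac_c_gt0 p; have C0 := cac_C_gt0 p.
have ma : measurable_fun setT a.
  by apply: measurable_funM => //; exact: (measurableT_comp (measurable_powR _)).
have a0 x : 0 <= a x by rewrite mulr_ge0 ?powR_ge0.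
have b0 : 0 <= b by rewrite mulr_ge0 ?powR_ge0.
have mK := measurable_kern_near; have mKf := measurable_kern_far.
have Kf0 := kern_far_ge0.
have mE := measurable_trunc p mK 0 mf.
pose E z := `|Num.max (- u z.1 - w z.1 - 0) 0 - Num.max (- u z.2 - w z.2 - 0) 0| `^ p * kern_near z.
have E0 z : 0 <= E z by rewrite mulr_ge0 ?powR_ge0 ?kern_near_ge0.
pose P1 (z : T * T) := v z.1 * (a z.2 * kern_far z).
pose Q1 (z : T * T) := \1_A z.1 * h z.
pose Q2 (z : T * T) := v z.1 * kern_far z.
pose sw (f : T * T -> R) z := f (z.2, z.1).
have msw F : measurable_fun setT F -> measurable_fun setT (sw F).
  by move=> mf'; apply: (measurableT_comp mf'); exact: measurable_swap.
have mP1 : measurable_fun setT P1.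
  apply: measurable_funM; first exact: mfst.
  by apply: measurable_funM => //; exact: msnd.
have mQ1 : measurable_fun setT Q1.
  by apply: measurable_funM => //; apply: mfst; exact: measurable_indic.
have mQ2 : measurable_fun setT Q2 by apply: measurable_funM => //; exact: mfst.
have P10 z : 0 <= P1 z by rewrite mulr_ge0// mulr_ge0.
have Q10 z : 0 <= Q1 z by rewrite mulr_ge0.
have Q20 z : 0 <= Q2 z by rewrite mulr_ge0.
pose P z := cac_c p * E z + (P1 z + sw P1 z).
pose Q z := cac_C p * L * (Q1 z + sw Q1 z) + b * (Q2 z + sw Q2 z).
have sw0 F : (forall z, 0 <= F z) -> forall z, 0 <= sw F z by move=> F0 z; exact: F0.
have sP10 := sw0 _ P10; have sQ10 := sw0 _ Q10; have sQ20 := sw0 _ Q20.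
(* An integrand and its swap have the same double integral. *)
have isum (F g : T * T -> R) (cf cg : R) : measurable_fun setT F -> measurable_fun setT g ->
    (forall z, 0 <= F z) -> (forall z, 0 <= g z) -> 0 <= cf -> 0 <= cg ->
    (\int[mu2]_z (cf * F z + cg * (g z + sw g z))%:E =
     cf%:E * \int[mu2]_z (F z)%:E + (2 * cg)%:E * \int[mu2]_z (g z)%:E)%E.
  move=> mf' mg' f0 g0 cf0 cg0; have sg0 := sw0 _ g0.
  under eq_integral do rewrite EFinD EFinM EFinM.
  rewrite ge0_integralD//; last 4 first.
  - by move=> z _; rewrite -EFinM lee_fin mulr_ge0.
  - by apply: measurable_funeM; exact/measurable_EFinP.
  - by move=> z _; rewrite -EFinM lee_fin mulr_ge0// addr_ge0.
  - apply: measurable_funeM; apply/measurable_EFinP.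
    by apply: measurable_funD => //; exact: msw.
  congr (_ + _)%E.
    by rewrite ge0_integralZl//; [exact/measurable_EFinP|move=> z _; rewrite lee_fin].
  rewrite ge0_integralZl//; last 2 first.
  - by apply/measurable_EFinP; apply: measurable_funD => //; exact: msw.
  - by move=> z _; rewrite lee_fin addr_ge0.
  under eq_integral do rewrite EFinD.
  rewrite ge0_integralD//; last 4 first.
  - by move=> z _; rewrite lee_fin.
  - exact/measurable_EFinP.
  - by move=> z _; rewrite lee_fin.
  - by apply/measurable_EFinP; exact: msw.
  rewrite -(@integral_swap _ _ _ mu (fun z => (g z)%:E)); last 2 first.
  - exact/measurable_EFinP.
  - by move=> z; rewrite lee_fin.
  rewrite mulrC EFinM -muleA; congr (_ * _)%E.
  by rewrite -mule2n -mule_natl.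
have PWQ z : P z <= weak_integrand (fun x => - u x) v z + Q z.
  case: z => x y; rewrite /weak_integrand /=.
  (* [pJ] is odd, so the product splits into one term weighted by [v x] and one by [v y], each
     treated by the same one-sided bound. *)
  have far : a y * v x + a x * v y - b * (v x + v y) <=
      pJ p (- u x - - u y) * (v x - v y).
    have ge1 x' y' : (a y' - b) * v x' <= pJ p (u y' - u x') * v x'.
      have [xA|xA] := pselect (A x'); last by rewrite vNA// !mulr0.
      by rewrite ler_wpM2r// pJ_sub_ge// u0 ue.
    have h1 := ge1 x y; have h2 := ge1 y x.
    rewrite (_ : - u x - - u y = u y - u x); last by ring.
    move: h2; rewrite -(opprB (u y) (u x)) pJN; lra.
  have near : cac_c p * E (x, y) <=
      pJ p (- u x - - u y) * (v x - v y) * kern_near (x, y) +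
      cac_C p * L * (Q1 (x, y) + Q1 (y, x)).
    rewrite /E /kern_near/=; case: ifPn => [Nxy|_]; last first.
      by rewrite !mulr0 add0r; apply: mulr_ge0; [exact: mulr_ge0 (ltW C0) _|exact: addr_ge0].
    rewrite !subr0 -/(v x) -/(v y).
    (* If neither point lies in [A], both values of [v] vanish; otherwise the barrier bound applies
       at whichever point does. *)
    have [AA|nAA] := pselect (A x \/ A y); last first.
      rewrite !vNA ?subr0 ?normr0 ?powR0_pos ?(lt_trans ltr01)//; try by move=> ?; apply: nAA; tauto.
      by rewrite mul0r !mulr0 mul0r add0r; apply: mulr_ge0; [exact: mulr_ge0 (ltW C0) _|exact: addr_ge0].
    have [t t01 Ed] := max0_diff (- u x - w x) (- u y - w y).
    have := @caccioppoli_pointwise _ _ p1 (- u x - - u y) (w x - w y) t t01.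
    have {}Ed : t * (- u x - - u y - (w x - w y)) = v x - v y by rewrite /v Ed; congr (_ * _); ring.
    rewrite Ed => hc; rewrite mulrA; apply: (le_trans (ler_wpM2r (k0 _) hc)).
    rewrite mulrDl lerD2l -!mulrA ler_wpM2l ?(ltW C0)//.
    case: AA => [xA|yA].
      rewrite (le_trans (wL _ _ Nxy xA))// ler_wpM2l// /Q1/= indicE mem_set// mul1r lerDl.
      by rewrite mulr_ge0.
    rewrite distrC kC.
    rewrite (le_trans (wL _ _ _ yA)) 1?NC// ler_wpM2l// /Q1/= addrC [X in X * h (y, x)]indicE mem_set// mul1r lerDl.
    by rewrite mulr_ge0.
  rewrite (kern_split (x, y)) mulrDr.
  have := ler_wpM2r (Kf0 (x, y)) far.
  rewrite /P /Q /sw /P1 /Q2/= (kern_farC y x).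
  move: near; set J := pJ _ _ * _; set e1 := E _; set q1 := Q1 _; set q2 := Q1 _; lra.
have mP : measurable_fun setT P.
  apply: measurable_funD; first exact: measurable_funM.
  by apply: measurable_funD => //; exact: msw.
have mQ : measurable_fun setT Q.
  apply: measurable_funD; apply: measurable_funM => //; apply: measurable_funD => //;
    exact: msw.
have P0 z : 0 <= P z.
  by apply: addr_ge0; [exact: mulr_ge0 (ltW c0) _|exact: addr_ge0].
have Q0 z : 0 <= Q z.
  apply: addr_ge0; apply: mulr_ge0 => //; try exact: addr_ge0.
  exact: mulr_ge0 (ltW C0) _.
have H := ge0_le_integral_sum mP mQ P0 Q0 iW PWQ.
have EP : (\int[mu2]_z (P z)%:E = (cac_c p)%:E * \int[mu2]_z (E z)%:E +
    2%:E * \int[mu2]_z (P1 z)%:E)%E.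
  rewrite -[in RHS](mulr1 2) -isum ?(ltW c0)//.
  by apply: eq_integral => z _; rewrite /P mul1r.
have EQ : (\int[mu2]_z (Q z)%:E = (2 * (cac_C p * L))%:E * \int[mu2]_z (Q1 z)%:E +
    (2 * b)%:E * \int[mu2]_z (Q2 z)%:E)%E.
  have h1 := isum (fun=> 0) Q1 0 (cac_C p * L) (measurable_cst _) mQ1 (fun=> lexx _) Q10 (lexx _) (mulr_ge0 (ltW C0) L0).
  have h2 := isum (fun=> 0) Q2 0 b (measurable_cst _) mQ2 (fun=> lexx _) Q20 (lexx _) b0.
  rewrite mul0e add0e in h1; rewrite mul0e add0e in h2.
  rewrite -h1 -h2 -ge0_integralD//; last 4 first.
  - move=> z _; rewrite lee_fin mul0r add0r; apply: mulr_ge0; last exact: addr_ge0.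
    exact: mulr_ge0 (ltW C0) _.
  - apply/measurable_EFinP; apply: measurable_funD => //; apply: measurable_funM => //.
    by apply: measurable_funD => //; exact: msw.
  - by move=> z _; rewrite lee_fin mul0r add0r; apply: mulr_ge0 => //; exact: addr_ge0.
  - apply/measurable_EFinP; apply: measurable_funD => //; apply: measurable_funM => //.
    by apply: measurable_funD => //; exact: msw.
  by apply: eq_integral => z _; rewrite -EFinD !mul0r !add0r.
rewrite EP EQ in H.
have V0 : (0 <= \int[mu]_x (v x)%:E)%E by apply: integral_ge0 => x _; rewrite lee_fin.
apply: le_trans (le_trans H _).
  rewrite leeD2l// EFinM -muleA lee_wpmul2l//.
  apply: integral_product_ge => //.
  - by apply: measurable_funM => //; exact: msnd.
  - by move=> z; rewrite mulr_ge0.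
  - by move=> x /vA; exact: kfG.
apply: leeD => //; apply: leeD.
  rewrite (_ : 2 * (cac_C p * L * S) = 2 * (cac_C p * L) * S); last by ring.
  rewrite [in leRHS]EFinM -muleA lee_wpmul2l ?lee_fin//.
    by apply: mulr_ge0 => //; exact: mulr_ge0 (ltW C0) _.
  have <- : (\int[mu]_x (\1_A x)%:E = mu A)%E by rewrite integral_indic// setIT.
  by apply: integral_product_le => //; exact: measurable_indic.
rewrite (_ : 2 * (b * T0) = 2 * b * T0); last by ring.
rewrite [in leRHS]EFinM -muleA lee_wpmul2l ?lee_fin//; first by rewrite mulr_ge0.
by apply: integral_product_le.
Qed.

End energy_estimates.

(** * Approximation by test functions and truncation inequalities *)

Section approximation.
Context d (T : measurableType d) {R : realType}.
Variable mu : {sigma_finite_measure set T -> \bar R}.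
Local Notation mu2 := (mu \x mu)%E.
Variables (p : R) (Om : set T) (k : T * T -> R).
Hypotheses (p1 : 1 < p) (mOm : measurable Om)
  (mk : measurable_fun setT k) (k0 : forall z, 0 <= k z).

Definition pair_energy (f : T -> R) : \bar R :=
  (\int[mu2]_z (`|f z.1 - f z.2| `^ p * k z)%:E)%E.

Definition Lp_energy (f : T -> R) : \bar R :=
  (\int[mu]_(x in Om) (`|f x| `^ p)%:E)%E.

(** Stated with p-th powers, so that the errors are plain integrals that can be summed. *)
Definition approximated (g : T -> R) (psi : nat -> T -> R) :=
  forall e : R, 0 < e -> \forall j \near \oo,
    (pair_energy (fun x => g x - psi j x)%R <= e%:E)%E /\
    (Lp_energy (fun x => g x - psi j x)%R <= e%:E)%E.

Lemma measurable_pair_energy (f : T -> R) : measurable_fun setT f ->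
  measurable_fun setT (fun z : T * T => `|f z.1 - f z.2| `^ p * k z).
Proof.
move=> mf; apply: measurable_funM => //; apply: (measurableT_comp (measurable_powR _)).
apply: (measurableT_comp (@normr_measurable R setT)); apply: measurable_funB.
  exact: (measurableT_comp mf measurable_fst).
exact: (measurableT_comp mf measurable_snd).
Qed.

Lemma measurable_Lp_energy (f : T -> R) : measurable_fun setT f ->
  measurable_fun Om (fun x => `|f x| `^ p).
Proof.
move=> mf; apply: measurable_funTS; apply: (measurableT_comp (measurable_powR _)).
exact: (measurableT_comp (@normr_measurable R setT)).
Qed.

Lemma approximated_subseq (g : T -> R) psi : approximated g psi ->
  exists sigma : nat -> nat,
   (\sum_(0 <= j <oo) pair_energy (fun x => g x - psi (sigma j) x)%R < +oo)%E /\
   (\sum_(0 <= j <oo) Lp_energy (fun x => g x - psi (sigma j) x)%R < +oo)%E.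
Proof.
move=> H.
have /choice[sigma sP] : forall j, exists m,
    (pair_energy (fun x => g x - psi m x)%R <= (1 * 2^-1 ^+ j)%:E)%E /\
    (Lp_energy (fun x => g x - psi m x)%R <= (1 * 2^-1 ^+ j)%:E)%E.
  move=> j; have e0 : 0 < 1 * (2 : R)^-1 ^+ j by rewrite mul1r exprn_gt0// invr_gt0.
  by have [m _ /(_ m (leqnn m))] := H _ e0; exists m.
have h : 0 <= (2 : R)^-1 < 1 by rewrite invr_ge0 ler0n invf_lt1 ?ltr1n.
have fin := @geometric_nneseries R 1 2^-1 ler01 h.
have foo (a : nat -> \bar R) : (forall j, 0 <= a j)%E ->
    (forall j, (a j <= (1 * 2^-1 ^+ j)%:E)%E) -> (\sum_(0 <= j <oo) a j < +oo)%E.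
  move=> a0 ale; apply: (@le_lt_trans _ _ (\sum_(0 <= j <oo) (1 * 2^-1 ^+ j)%:E)%E).
    by apply: lee_nneseries => j _; [move=> _; exact: a0|exact: ale].
  by rewrite fin ltry.
exists sigma; split; apply: foo => j; try by case: (sP j).
- by apply: integral_ge0 => z _; rewrite lee_fin mulr_ge0 ?powR_ge0.
- by apply: integral_ge0 => z _; rewrite lee_fin powR_ge0.
Qed.

Lemma powR_cvg0 (a : nat -> R) : (fun j => `|a j| `^ p) @ \oo --> 0 -> a @ \oo --> 0.
Proof.
move=> h; apply/cvgr0Pnorm_lt => e e0.
have ep0 : 0 < e `^ p by rewrite powR_gt0.
move/cvgr0Pnorm_lt : h => /(_ _ ep0); apply: filterS => j.
rewrite ger0_norm ?powR_ge0// => hj; rewrite ltNge; apply/negP => eh.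
move: hj; rewrite ltNge => /negP; apply.
by apply: powR_le => //; [rewrite ltW// (lt_trans ltr01)|exact: ltW].
Qed.

(** For almost every pair with x in [Om] and y outside, the pair energy forces (g x - psi_j x) - g y
    -> 0 along a subsequence, while the L^p part forces g x - psi_j x -> 0. Hence g y = 0, and
    positive measure of [Om] turns this into a statement on [y] alone. *)
Lemma approximated_eq0 (g : T -> R) (psi : nat -> T -> R) :
  measurable_fun setT g -> (forall j, measurable_fun setT (psi j)) ->
  (forall j x, ~ Om x -> psi j x = 0) ->
  (forall x y, Om x -> ~ Om y -> 0 < k (x, y)) -> (0 < mu Om)%E ->
  approximated g psi -> \forall x \ae mu, ~ Om x -> g x = 0.
Proof.
move=> mg mpsi psi0 kgt0 Om0 /approximated_subseq[sigma [s1 s2]].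
pose F1 j (z : T * T) := `|(g z.1 - psi (sigma j) z.1) - (g z.2 - psi (sigma j) z.2)| `^ p * k z.
pose F2 j x := `|g x - psi (sigma j) x| `^ p.
have mgp j : measurable_fun setT (fun x => g x - psi (sigma j) x) by exact: measurable_funB.
have c1 : \forall z \ae mu2, F1 ^~ z @ \oo --> 0.
  have hm j : measurable_fun setT (F1 j).
    exact: (measurable_pair_energy (mgp j)).
  have h0 j z : 0 <= F1 j z by rewrite mulr_ge0 ?powR_ge0.
  have := @summable_ae_cvg _ _ R mu2 setT F1 measurableT hm h0 s1.
  by apply: filterS => z; apply.
have c2 : \forall x \ae mu, Om x -> F2 ^~ x @ \oo --> 0.
  apply: (@summable_ae_cvg _ _ R mu Om F2 mOm _ _ s2).
  - by move=> j; exact: measurable_Lp_energy.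
  - by move=> j x; exact: powR_ge0.
have c3 : \forall z \ae mu2, Om z.1 -> ~ Om z.2 -> g z.2 = 0.
  have := ae_fst c2; apply: filterS2 c1 => -[x y] /= h1 h2 Ox nOy.
  have /powR_cvg0 h3 := h2 Ox.
  have kxy := kgt0 _ _ Ox nOy.
  have h4 : (fun j => (g x - psi (sigma j) x) - g y) @ \oo --> 0.
    apply: powR_cvg0.
    rewrite (_ : (fun j => _) = fun j => F1 j (x, y) * (k (x, y))^-1); last first.
      apply/funext => j; rewrite /F1/= (psi0 _ _ nOy) subr0 mulfK//.
      by rewrite gt_eqF.
    by rewrite -[X in _ --> X](mul0r (k (x, y))^-1); apply: cvgM => //; exact: cvg_cst.
  have h5 : (fun j => (g x - psi (sigma j) x) - ((g x - psi (sigma j) x) - g y)) @ \oo --> (0 - 0 : R).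
    exact: cvgB.
  have {}h5 : (fun _ : nat => g y) @ \oo --> (0 : R).
    rewrite subr0 in h5; rewrite (_ : (fun=> g y) = fun j =>
      g x - psi (sigma j) x - (g x - psi (sigma j) x - g y))//.
    by apply/funext => j; ring.
  by rewrite -(cvg_lim (@Rhausdorff R) h5) (cvg_lim (@Rhausdorff R) (cvg_cst (g y))).
pose N := [set y | ~ Om y /\ g y != 0].
have mN : measurable N.
  rewrite (_ : N = ~` Om `&` g @^-1` [set~ 0]).
    apply: measurableI; first exact: measurableC.
    by rewrite -[X in measurable X]setTI; apply: mg => //; exact: measurableC.
  by apply/seteqP; split => y /= [? /eqP ?]; split => //; apply/eqP.
have N0 : mu N = 0%E.
  have [A [mA A0 sA]] := c3.
  have : mu2 (Om `*` N) = 0%E.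
    apply/eqP; rewrite -measure_le0 -A0 le_measure// ?inE//; first exact: measurableX.
    move=> [x y] /= [Ox [nOy gy]]; apply: sA => /= h.
    by move/eqP : gy; apply; exact: h.
  rewrite product_measure1E// => /eqP; rewrite mule_eq0 => /orP[/eqP h|/eqP//].
  by move: Om0; rewrite [X in (_ < X)%E]h ltxx.
exists N; split => // y /= h.
by split; [apply: contrapT => ?; apply: h|apply/eqP => ?; apply: h].
Qed.

Lemma barrier_ineq (q : T * T -> R) (g w : T -> R) (psi : nat -> T -> R) (Lam Mw : R) :
  (mu Om < +oo)%E ->
  measurable_fun setT q -> (forall z, 0 <= q z) -> (forall x y, q (x, y) = q (y, x)) ->
  measurable_fun setT g -> measurable_fun setT w -> (forall j, measurable_fun setT (psi j)) ->
  (forall x, ~ Om x -> g x = 0) -> (forall j x, ~ Om x -> psi j x = 0) ->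
  (forall x, ~ Om x -> 0 <= w x) -> (forall x, Om x -> `|w x| <= Mw) ->
  (forall x y, Om x -> `|w x - w y| <= q (x, y) \/ ~ Om y /\ `|w x| <= q (x, y)) ->
  (pair_energy g < +oo)%E -> (Lp_energy g < +oo)%E ->
  (\int[mu2]_z (q z `^ p * k z)%:E < +oo)%E ->
  approximated g psi ->
  (forall j m, \int[mu2]_z (weak_integrand p k g (fun x => soft m (psi j x - w x)) z)%:E
     <= \int[mu]_(x in Om) (Lam * soft m (psi j x - w x)%R)%:E)%E ->
  let v x := Num.max (g x - w x) 0 in
  [/\ mu2.-integrable setT (EFin \o weak_integrand p k g v),
      (\int[mu2]_z (weak_integrand p k g v z)%:E <= \int[mu]_x (Lam * v x)%:E)%E &
      mu.-integrable setT (fun x => (Lam * v x)%:E)].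
Proof.
move=> fOm mq q0 qC mg mw mpsi g0 psi0 w0 wM wq Eg Lg Eq /approximated_subseq[sigma [s1 s2]] weak v.
have s1' : (\sum_(0 <= j <oo) \int[mu2]_z (`|(g z.1 - g z.2) -
    (psi (sigma j) z.1 - psi (sigma j) z.2)| `^ p * k z)%:E < +oo)%E.
  have E j : (\int[mu2]_z (`|(g z.1 - g z.2) - (psi (sigma j) z.1 - psi (sigma j) z.2)|
      `^ p * k z)%:E)%E = pair_energy (fun x => g x - psi (sigma j) x).
    apply: eq_integral => z _.
    by rewrite (_ : g z.1 - g z.2 - _ =
      g z.1 - psi (sigma j) z.1 - (g z.2 - psi (sigma j) z.2))//; ring.
  by under eq_eseriesr do rewrite E.
pose ps j := psi (sigma j).
have v0 x : ~ Om x -> v x = 0.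
  by move=> xO; rewrite /v g0// max_r// sub0r oppr_le0 w0.
have vE : (\int[mu]_(x in Om) (Lam * v x)%:E = \int[mu]_x (Lam * v x)%:E)%E.
  rewrite integral_mkcond; apply: eq_integral => x _; rewrite patchE.
  by case: ifPn => //; rewrite notin_setE => /v0 ->; rewrite mulr0.
have [h1 _] := @limit_test_cvg _ _ _ mu p Om k q g w ps p1 mOm mk k0 mq q0 qC mg mw
  (fun j => mpsi _) g0 (fun j => psi0 _) w0 wq Eg Eq s1' s2.
have [h2 _] := @limit_test_rhs _ _ _ mu p Om g w ps Lam Mw p1 mOm fOm mg mw
  (fun j => mpsi _) g0 (fun j => psi0 _) wM Lg s2.
(* The sharpness of [soft] is tied to the position in the subsequence, so a single limit removes
   both approximations. *)
have h3 := @limit_test_le _ _ _ mu p Om k q g w ps Lam Mw p1 mOm fOm mk k0 mq q0 qC mg mw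
  (fun j => mpsi _) g0 (fun j => psi0 _) w0 wM wq Eg Lg Eq s1' s2 (fun j => weak (sigma j) j).
split; [exact: h1|by rewrite -vE; exact: h3|].
suff -> : (fun x => (Lam * v x)%:E) = (fun x => (Lam * v x)%:E) \_ Om.
  by apply/(integrable_mkcond _ mOm).
apply/funext => x; rewrite patchE.
by case: ifPn => //; rewrite notin_setE => /v0 ->; rewrite mulr0.
Qed.

(* The set [Q], on which [u] vanishes, drains the energy of [(u - M)^+]. *)
Lemma global_bound (u : T -> R) (Q : set T) (kap mQ Lam M : R) :
  measurable_fun setT u -> measurable Q -> mu Q = mQ%:E ->
  (forall x, 0 <= u x) -> (forall x, Q x -> u x = 0) ->
  0 <= kap -> (forall x y, 0 < u x -> Q y -> kap <= k (x, y)) ->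
  0 < M -> 0 <= Lam -> Lam < kap * M `^ (p - 1) * mQ ->
  let v x := Num.max (u x - M) 0 in
  mu2.-integrable setT (EFin \o weak_integrand p k u v) ->
  (\int[mu2]_z (weak_integrand p k u v z)%:E <= \int[mu]_x (Lam * v x)%:E)%E ->
  mu.-integrable setT (EFin \o v) ->
  mu [set x | (M < u x)%R] = 0%E.
Proof.
move=> mu_ mQ_ muQ u0 uQ kap0 kapk M0 Lam0 Lam1 v iW WLam iv.
have v0 x : 0 <= v x by rewrite le_max lexx orbT.
have mv : measurable_fun setT v by apply: measurable_maxr => //; exact: measurable_funB.
pose c := kap * M `^ (p - 1).
have c0 : 0 <= c by rewrite mulr_ge0 ?powR_ge0.
have mQ0 : 0 <= mQ by rewrite -lee_fin -muQ.
pose h (z : T * T) := c * \1_Q z.2.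
have mh : measurable_fun setT h.
  apply: measurable_funM => //.
  exact: (measurableT_comp (measurable_indic mQ_) measurable_snd).
have h0 z : 0 <= h z by rewrite mulr_ge0.
pose V := (\int[mu]_x (v x)%:E)%E.
have V0 : (0 <= V)%E by apply: integral_ge0 => x _; rewrite lee_fin.
have Vfin : V \is a fin_num by exact: integrable_fin_num.
have H1 : ((c * mQ)%:E * V <= \int[mu2]_z (v z.1 * h z)%:E)%E.
  apply: integral_product_ge => //; first by rewrite mulr_ge0.
  move=> x _; rewrite /h/= (integral_scaled_indic mu mQ_ c0).
  by rewrite [X in (_ * X)%E]muQ -EFinM.
have H2 : (\int[mu2]_z (v z.1 * h z)%:E <= \int[mu]_x (Lam * v x)%:E)%E.
  apply: le_trans WLam; rewrite -[leRHS]adde0 -(integral0 mu2 setT).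
  apply: (@ge0_le_integral_sum _ _ _ _ _ (fun=> 0)) => //.
  - by apply: measurable_funM => //; exact: (measurableT_comp mv measurable_fst).
  - by move=> z; rewrite mulr_ge0.
  move=> [x y]; rewrite addr0 /weak_integrand /h /=.
  (* Monotonicity makes the integrand nonnegative, so all pairs with [y] outside [Q] may be
     discarded. *)
  have mono : 0 <= pJ p (u x - u y) * (v x - v y).
    have [t /andP[t0 _] E] := max0_diff (u x - M) (u y - M).
    rewrite /v E (_ : u x - M - _ = u x - u y); last by ring.
    by rewrite mulrCA mulr_ge0// pJM// powR_ge0.
  rewrite indicE; have [yQ|_] := boolP (y \in Q); last by rewrite !mulr0 mulr_ge0.
  rewrite inE in yQ; rewrite mulr1.
  have vy : v y = 0 by rewrite /v (uQ _ yQ) max_r// sub0r oppr_le0 ltW.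
  rewrite vy (uQ _ yQ) !subr0.
  have [->|vx] := eqVneq (v x) 0; first by rewrite mulr0 !mul0r.
  have ux : M < u x.
    rewrite ltNge; apply/negP => xM; move/eqP : vx; apply.
    by rewrite /v max_r// subr_le0.
  rewrite pJ_ge0E// [_ * v x]mulrC -mulrA ler_wpM2l// /c mulrC.
  apply: ler_pM; rewrite ?powR_ge0//; last by apply: kapk => //; exact: lt_trans ux.
  by apply: powR_le; rewrite ?subr_ge0 ltW.
(* The bounds combine to c mQ V <= Lam V; as [V] is finite and Lam < c mQ, it must vanish. *)
have Vz : V = 0%E.
  move: (le_trans H1 H2).
  have -> : (\int[mu]_x (Lam * v x)%:E = Lam%:E * V)%E.
    under eq_integral do rewrite EFinM.
    by rewrite ge0_integralZl//; [exact/measurable_EFinP|move=> x _; rewrite lee_fin].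
  rewrite -(fineK Vfin) -!EFinM lee_fin => h1.
  have f0 : 0 <= fine V by rewrite fine_ge0.
  congr _%:E; apply/eqP; rewrite eq_le f0 andbT leNgt; apply/negP => f1.
  by move: h1; rewrite leNgt ltr_pM2r// Lam1.
have mA : measurable [set x | M < u x] := measurable_above M mu_.
have : \forall x \ae mu, [set: T] x -> (v x)%:E = 0%E.
  apply: (ae_eq_integral_abs mu measurableT _).1 => //; first exact/measurable_EFinP.
  by under eq_integral do rewrite gee0_abs ?lee_fin//.
move=> [A [mA' A0 sA]]; apply/eqP; rewrite -measure_le0 -A0 le_measure ?inE//.
move=> x /= xM; apply: sA => /= /(_ I) [] /eqP.
by rewrite /v gt_eqF// lt_max subr_gt0 xM.
Qed.

End approximation.

(** * Null-set modifications and zero extension *)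

Section ae_invariance.
Context d (T : measurableType d) {R : realType}.
Variable mu : {sigma_finite_measure set T -> \bar R}.
Local Notation mu2 := (mu \x mu)%E.
Variables (p : R) (Om : set T) (k : T * T -> R).
Hypotheses (p1 : 1 < p) (mOm : measurable Om)
  (mk : measurable_fun setT k) (k0 : forall z, 0 <= k z)
  (kC : forall x y, k (x, y) = k (y, x)).

Lemma pair_energy_ae (f g : T -> R) : measurable_fun setT f -> measurable_fun setT g ->
  (\forall x \ae mu, f x = g x) -> pair_energy mu p k f = pair_energy mu p k g.
Proof.
move=> mf mg fg; apply: ae_eq_integral.
- exact: measurableT.
- by apply/measurable_EFinP; exact: measurable_pair_energy.
- by apply/measurable_EFinP; exact: measurable_pair_energy.
- have := ae_fst fg; apply: filterS2 (ae_snd fg) => z /= e2 e1 _.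
  by rewrite e1 e2.
Qed.

Lemma measurable_weak_integrand (f g : T -> R) :
  measurable_fun setT f -> measurable_fun setT g ->
  measurable_fun setT (weak_integrand p k f g).
Proof.
move=> mf mg; apply: measurable_funM => //; apply: measurable_funM.
  apply: (measurableT_comp (@measurable_pJ _ p)); apply: measurable_funB.
    exact: (measurableT_comp mf measurable_fst).
  exact: (measurableT_comp mf measurable_snd).
apply: measurable_funB.
  exact: (measurableT_comp mg measurable_fst).
exact: (measurableT_comp mg measurable_snd).
Qed.

Lemma integral_weak_ae (f g phi : T -> R) :
  measurable_fun setT f -> measurable_fun setT g -> measurable_fun setT phi ->
  (\forall x \ae mu, f x = g x) ->
  (\int[mu2]_z (weak_integrand p k f phi z)%:E = \int[mu2]_z (weak_integrand p k g phi z)%:E)%E.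
Proof.
move=> mf mg mphi fg; apply: ae_eq_integral.
- exact: measurableT.
- by apply/measurable_EFinP; exact: measurable_weak_integrand.
- by apply/measurable_EFinP; exact: measurable_weak_integrand.
- have := ae_fst fg; apply: filterS2 (ae_snd fg) => z /= e2 e1 _.
  by rewrite /weak_integrand e1 e2.
Qed.

(** The energy is given only for pairs with first point in [Om]. Symmetry adds those with second
    point in [Om], and on all others [g] has no increment. *)
Lemma pair_energy_half (g : T -> R) : measurable_fun setT g ->
  (forall x, ~ Om x -> g x = 0) ->
  (\int[mu2]_(z in Om `*` setT) (`|g z.1 - g z.2| `^ p * k z)%:E < +oo)%E ->
  (pair_energy mu p k g < +oo)%E.
Proof.
move=> mg g0 fin.
pose F (z : T * T) := `|g z.1 - g z.2| `^ p * k z.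
have mF : measurable_fun setT F by exact: measurable_pair_energy.
have F0 z : 0 <= F z by rewrite mulr_ge0 ?powR_ge0.
pose H (z : T * T) := \1_Om z.1 * F z.
have mH : measurable_fun setT H.
  apply: measurable_funM => //.
  exact: (measurableT_comp (measurable_indic mOm) measurable_fst).
have H0 z : 0 <= H z by rewrite mulr_ge0.
have mHs : measurable_fun setT (fun z : T * T => H (z.2, z.1)).
  by apply: (measurableT_comp mH); exact: measurable_swap.
have HE : (\int[mu2]_z (H z)%:E = \int[mu2]_(z in Om `*` setT) (F z)%:E)%E.
  rewrite [RHS]integral_mkcond; apply: eq_integral => -[x y] _.
  rewrite patchE /H indicE /=; case: ifPn => [|]; rewrite ?inE ?notin_setE.
    by move=> [Ox _]; rewrite mem_set// mul1r.
  by move=> nO; rewrite memNset ?mul0r// => Ox; apply: nO.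
apply: (@le_lt_trans _ _ (\int[mu2]_z (H z + H (z.2, z.1))%:E)%E).
  apply: ge0_le_integral => //.
  - by move=> z _; rewrite lee_fin; exact: F0.
  - exact/measurable_EFinP.
  - by apply/measurable_EFinP; exact: measurable_funD.
  move=> [x y] _; rewrite lee_fin -/(F (x, y)) /H/=.
  have FC : F (y, x) = F (x, y) by rewrite /F/= distrC kC.
  rewrite FC -mulrDl; have [Ox|nOx] := pselect (Om x).
    by rewrite !indicE (mem_set Ox) ler_peMl// lerDl.
  have [Oy|nOy] := pselect (Om y).
    by rewrite !indicE (mem_set Oy) ler_peMl// lerDr.
  by rewrite /F/= !g0// subrr normr0 powR0_pos ?(lt_trans ltr01)// mul0r mulr0.
under eq_integral do rewrite EFinD.
rewrite ge0_integralD//.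
- rewrite -(@integral_swap _ _ _ mu (fun z => (H z)%:E)); last 2 first.
  + exact/measurable_EFinP.
  + by move=> z; rewrite lee_fin.
  by rewrite HE lte_add_pinfty.
- by move=> z _; rewrite lee_fin.
- exact/measurable_EFinP.
- by move=> z _; rewrite lee_fin.
- exact/measurable_EFinP.
Qed.

End ae_invariance.

(** Equality may fail when the positive and the negative part both have infinite integral: by the
    convention oo - oo = -oo the left-hand side is then -oo and the right-hand side +oo. This
    direction suffices for passing from [u] to [- u]. *)
Lemma integralN_le d (T : measurableType d) (R : realType)
    (mu : {measure set T -> \bar R}) (D : set T) (f : T -> \bar R) :
  (\int[mu]_(x in D) - f x <= - \int[mu]_(x in D) f x)%E.
Proof.
rewrite [in leRHS]integralE [leLHS]integralE.
rewrite funenegN funeposN.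
move: (\int[mu]_(x in D) _)%E (\int[mu]_(x in D) _)%E => a b.
by case: a => [r| |]; case: b => [t| |]//=; rewrite ?lee_fin ?opprB//; 
  rewrite ?leNye ?leey.
Qed.

Lemma LpNormE d (T : measurableType d) (R : realType)
    (mu : {measure set T -> \bar R}) (D : set T) (p : R) (f : T -> R) : 0 < p ->
  (LpNorm mu D p f `^ p = \int[mu]_(x in D) (`|f x| `^ p)%:E)%E.
Proof.
move=> p0; rewrite /LpNorm powR_Lnorm; last by rewrite gt_eqF.
rewrite [RHS]integral_mkcond.
apply: eq_integral => x _; rewrite /= !patchE /=; case: ifPn => // _.
by rewrite normr0 powR0_pos.
Qed.

Lemma poweR_cvg0_near (R : realType) (a : nat -> \bar R) (p e : R) : 0 < p -> 0 < e ->
  (forall j, 0 <= a j)%E -> (a @ \oo --> 0)%E ->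
  \forall j \near \oo, (a j `^ p <= e%:E)%E.
Proof.
move=> p0 e0 a0 ac.
have ep0 : 0 < e `^ p^-1 by rewrite powR_gt0.
have nb : nbhs (0%E : \bar R) [set x | (x < (e `^ p^-1)%:E)%E].
  by apply: open_nbhs_nbhs; split; [exact: open_ereal_lt_ereal|rewrite /= lte_fin].
have : \forall j \near \oo, (a j < (e `^ p^-1)%:E)%E by exact: (ac _ nb).
apply: filterS.
move=> j /= aj.
have -> : e%:E = ((e `^ p^-1)%:E `^ p)%E.
  by rewrite poweR_EFin -powRrM mulVf ?gt_eqF// powRr1// ltW.
apply: gt0_ler_poweR; rewrite ?(ltW p0)// ?in_itv/= ?lee_fin ?a0 ?leey ?powR_ge0//.
exact: ltW.
Qed.

(** V0 gives u = 0 outside the domain only almost everywhere; this representative vanishes there at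
    every point. *)
Definition zext {T : Type} {R : realType} (D : set T) (u : T -> R) : T -> R := u \_ D.

Lemma zext_in {T : Type} {R : realType} (D : set T) (u : T -> R) x : D x -> zext D u x = u x.
Proof. by move=> Dx; rewrite /zext patchE mem_set. Qed.

Lemma zext_out {T : Type} {R : realType} (D : set T) (u : T -> R) x : ~ D x -> zext D u x = 0.
Proof. by move=> Dx; rewrite /zext patchE memNset. Qed.

Lemma measurable_zext d (T : measurableType d) (R : realType) (D : set T) (u : T -> R) :
  measurable D -> measurable_fun setT u -> measurable_fun setT (zext D u).
Proof.
by move=> mD mu; apply/(measurable_restrictT _ mD).1; exact: measurable_funTS.
Qed.

Lemma measurable_scaled_indic d (T : measurableType d) (R : realType) (A : set T) (c : R) :
  measurable A -> measurable_fun setT (fun x => (c * \1_A x)%:E).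
Proof.
by move=> mA; apply/measurable_EFinP; apply: measurable_funM => //; exact: measurable_indic.
Qed.

Lemma ae_imply d (T : measurableType d) (R : realType)
    (mu : {measure set T -> \bar R}) (P Q : T -> Prop) : (forall x, P x -> Q x) ->
  (\forall x \ae mu, P x) -> \forall x \ae mu, Q x.
Proof. by move=> PQ; apply: filterS. Qed.

Lemma ae_imply2 d (T : measurableType d) (R : realType)
    (mu : {measure set T -> \bar R}) (P Q S : T -> Prop) :
  (forall x, P x -> Q x -> S x) ->
  (\forall x \ae mu, P x) -> (\forall x \ae mu, Q x) -> \forall x \ae mu, S x.
Proof. by move=> PQS; apply: filterS2. Qed.

Lemma zext_facts d (T : measurableType d) (R : realType)
    (mu : {sigma_finite_measure set T -> \bar R}) (p : R) (Om : set T) (k : T * T -> R)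
    (u : T -> R) (phi : nat -> T -> R) :
  1 < p -> measurable Om -> measurable_fun setT k -> (forall z, 0 <= k z) ->
  (forall x y, k (x, y) = k (y, x)) -> measurable_fun setT u ->
  (forall j, measurable_fun setT (phi j)) ->
  (\forall x \ae mu, ~ Om x -> u x = 0) -> approximated mu p Om k u phi ->
  (\int[mu \x mu]_(z in Om `*` setT) (`|u z.1 - u z.2| `^ p * k z)%:E < +oo)%E ->
  (\int[mu]_(x in Om) (`|u x| `^ p)%:E < +oo)%E ->
  [/\ approximated mu p Om k (zext Om u) phi,
      (pair_energy mu p k (zext Om u) < +oo)%E,
      (Lp_energy mu p Om (zext Om u) < +oo)%E &
      \forall x \ae mu, u x = zext Om u x].
Proof.
move=> p1 mOm mk k0 kC mu_ mphi ae0 ap fin finL.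
have mut : measurable_fun setT (zext Om u) := measurable_zext mOm mu_.
have aeE : \forall x \ae mu, u x = zext Om u x.
  apply: ae_imply ae0 => x h; have [Ox|nOx] := pselect (Om x).
    by rewrite zext_in.
  by rewrite zext_out// h.
split; [| | |exact: aeE].
- move=> e e0; apply: filterS (ap e e0) => j [h1 h2]; split.
    rewrite (@pair_energy_ae _ _ _ _ _ _ mk _ (fun x => u x - phi j x))//.
    + exact: measurable_funB.
    + exact: measurable_funB.
    + by apply: ae_imply aeE => x <-.
  apply: le_trans h2; rewrite le_eqVlt; apply/orP; left; apply/eqP.
  by apply: eq_integral => x; rewrite inE => xO; rewrite zext_in.
- apply: (pair_energy_half p1 mOm mk k0 kC mut); first by move=> x nOx; rewrite zext_out.
  apply: le_lt_trans fin; rewrite le_eqVlt; apply/orP; left; apply/eqP.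
  apply: ae_eq_integral.
  + exact: measurableX.
  + by apply/measurable_EFinP; apply: measurable_funTS; exact: measurable_pair_energy.
  + by apply/measurable_EFinP; apply: measurable_funTS; exact: measurable_pair_energy.
  by apply: ae_imply2 (ae_fst aeE) (ae_snd aeE) => z /= -> ->.
- apply: le_lt_trans finL; rewrite le_eqVlt; apply/orP; left; apply/eqP.
  by apply: eq_integral => x; rewrite inE => xO; rewrite zext_in.
Qed.

(** * Reflection and finiteness of barrier energies *)

Section barrier_energy.
Context d (T : measurableType d) {R : realType}.
Variable mu : {sigma_finite_measure set T -> \bar R}.
Local Notation mu2 := (mu \x mu)%E.
Variables (p : R) (Om : set T) (k : T * T -> R).
Hypotheses (mOm : measurable Om) (fOm : (mu Om < +oo)%E)
  (mk : measurable_fun setT k) (k0 : forall z, 0 <= k z).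

Lemma approximatedN (g : T -> R) psi : approximated mu p Om k g psi ->
  approximated mu p Om k (fun x => - g x) (fun j x => - psi j x).
Proof.
move=> H e e0; apply: filterS (H e e0) => j [h1 h2]; split.
  apply: le_trans h1; rewrite le_eqVlt; apply/orP; left; apply/eqP.
  apply: eq_integral => z _; congr (_ `^ _ * _)%:E.
  by rewrite -normrN; congr `|_|; ring.
apply: le_trans h2; rewrite le_eqVlt; apply/orP; left; apply/eqP.
apply: eq_integral => z _; congr (_ `^ _)%:E.
by rewrite -normrN; congr `|_|; ring.
Qed.

Lemma pair_energyN (g : T -> R) :
  pair_energy mu p k (fun x => - g x) = pair_energy mu p k g.
Proof.
apply: eq_integral => z _; congr (_ `^ _ * _)%:E.
by rewrite -normrN; congr `|_|; ring.
Qed.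

Lemma Lp_energyN (g : T -> R) :
  Lp_energy mu p Om (fun x => - g x) = Lp_energy mu p Om g.
Proof. by apply: eq_integral => z _; rewrite normrN. Qed.

(** Only pairs meeting [Om] count, and integrating [h] in the other variable costs at most [S]; so
    the energy is at most a multiple of S |Om|. *)
Lemma local_energy_fin (F h : T * T -> R) (c S : R) :
  measurable_fun setT F -> (forall z, 0 <= F z) ->
  measurable_fun setT h -> (forall z, 0 <= h z) ->
  (forall x y, h (x, y) = h (y, x)) -> 0 <= c -> 0 <= S ->
  (forall x, \int[mu]_y (h (x, y))%:E <= S%:E)%E ->
  (forall x y, F (x, y) <= c * ((\1_Om x + \1_Om y) * h (x, y))) ->
  (\int[mu2]_z (F z)%:E < +oo)%E.
Proof.
move=> mF F0 mh h0 hC c0 S0 hS Fh.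
pose H (z : T * T) : R := \1_Om z.1 * h z.
have mi : measurable_fun setT (\1_Om : T -> R) by exact: measurable_indic.
have mH : measurable_fun setT H.
  apply: measurable_funM => //; exact: (measurableT_comp mi measurable_fst).
have H0 z : 0 <= H z by rewrite mulr_ge0.
have mHs : measurable_fun setT (fun z : T * T => H (z.2, z.1)).
  by apply: (measurableT_comp mH); exact: measurable_swap.
have HS : (\int[mu2]_z (H z)%:E <= S%:E * mu Om)%E.
  have <- : (\int[mu]_x (\1_Om x)%:E = mu Om)%E by rewrite integral_indic// setIT.
  exact: integral_product_le.
have Hoo : (\int[mu2]_z (H z)%:E < +oo)%E.
  by rewrite (le_lt_trans HS)// lte_mul_pinfty.
apply: (@le_lt_trans _ _ (\int[mu2]_z (c%:E * (H z + H (z.2, z.1))%:E))%E).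
  apply: ge0_le_integral => //.
  - by move=> z _; rewrite lee_fin.
  - exact/measurable_EFinP.
  - by apply: measurable_funeM; apply/measurable_EFinP; exact: measurable_funD.
  move=> [x y] _; rewrite -EFinM lee_fin (le_trans (Fh x y))// ler_wpM2l//.
  by rewrite /H/= (hC y x) mulrDl.
rewrite ge0_integralZl//; last 2 first.
- by apply/measurable_EFinP; exact: measurable_funD.
- by move=> z _; rewrite lee_fin addr_ge0//; exact: (H0 (z.2, z.1)).
apply: lte_mul_pinfty => //.
under eq_integral do rewrite EFinD.
have E : (\int[mu2]_z ((H z)%:E + (H (z.2, z.1))%:E) =
    \int[mu2]_z (H z)%:E + \int[mu2]_z (H (z.2, z.1))%:E)%E.
  apply: ge0_integralD => //.
  - by move=> z _; rewrite lee_fin.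
  - exact/measurable_EFinP.
  - by move=> z _; rewrite lee_fin; exact: (H0 (z.2, z.1)).
  - exact/measurable_EFinP.
rewrite {}E -(@integral_swap _ _ _ mu (fun z => (H z)%:E)); last 2 first.
- exact/measurable_EFinP.
- by move=> z; rewrite lee_fin.
exact: lte_add_pinfty.
Qed.

End barrier_energy.

(** * Barriers for the fractional p-Laplacian *)

Section euclidean_facts.
Context {R : realType} {n : nat}.
Implicit Types (x y a : 'rV[R]_n).

Lemma paraboloid_lip (c l r : R) a x y :
  (forall i, `|x ord0 i - a ord0 i| <= r) -> (forall i, `|y ord0 i - a ord0 i| <= r) ->
  `|paraboloid c l a x - paraboloid c l a y| <= `|l| * (n%:R * (2 * r)) * enorm (x - y).
Proof.
move=> xr yr; rewrite /paraboloid.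
rewrite (_ : _ - _ = l * (enorm (x - a) ^+ 2 - enorm (y - a) ^+ 2)); last by ring.
rewrite normrM -mulrA ler_wpM2l// !enorm_sqr -sumrB.
rewrite (le_trans (ler_norm_sum _ _ _))//.
rewrite (le_trans (ler_sum _ (G := fun=> 2 * r * enorm (x - y)) _))//; last first.
  by rewrite sumr_const card_ord -[leLHS]mulr_natl !mulrA.
move=> i _; rewrite !mxE.
rewrite (_ : _ - _ = (x ord0 i - y ord0 i) * ((x ord0 i - a ord0 i) + (y ord0 i - a ord0 i))); last by ring.
rewrite normrM mulrC; apply: ler_pM => //.
  by rewrite (le_trans (ler_normD _ _))//; have := xr i; have := yr i; lra.
by have := enorm_coord (x - y) i; rewrite !mxE.
Qed.

Lemma bounded_coord (Om : set 'rV[R]_n) : bounded_set Om ->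
  exists2 r : R, 0 < r & forall x, Om x -> forall i, `|x ord0 i| <= r.
Proof.
move=> [M [_ hM]]; exists (Num.max 1 (M + 1)); first by rewrite lt_max ltr01.
move=> x Ox i.
have : `|x| <= Num.max 1 (M + 1).
  by apply: hM => //; rewrite lt_max ltrDl ltr01 orbT.
by apply: le_trans; rewrite [leRHS]mx_normrE; apply: (le_bigmax _ _ (ord0, i)).
Qed.

Lemma test_function_eq0 (Om : set 'rV[R]_n) phi x : test_function Om phi ->
  ~ Om x -> phi x = 0.
Proof.
move=> [_ _ sO] nOx; apply: contrapT => /eqP px; apply: nOx; apply: sO.
exact: subset_closure.
Qed.

Lemma measurable_test_function (Om : set 'rV[R]_n) phi : test_function Om phi ->
  measurable_fun [set: Rn R n] (phi : Rn R n -> R).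
Proof. by move=> [sphi _ _]; apply: continuous_measurable_Rn; exact: smooth_continuous. Qed.

Lemma measurable_paraboloid (c l : R) a :
  measurable_fun [set: Rn R n] (paraboloid c l a : Rn R n -> R).
Proof.
apply: continuous_measurable_Rn; apply: smooth_continuous; exact: smooth_paraboloid.
Qed.

End euclidean_facts.

(** * Transfer of the abstract estimates to the Gagliardo kernel *)

Section concrete.
Context {R : realType} {n : nat}.
Variables (p s : R) (Omega : set 'rV[R]_n).
Hypotheses (p1 : 1 < p) (s0 : 0 < s) (s1 : s < 1)
  (oO : open Omega) (bO : bounded_set Omega).
Local Notation mu := (@lebesgueRn R n).
Local Notation mu2 := (mu \x mu)%E.

Definition kerz (z : Rn R n * Rn R n) : R := ker p s z.1 z.2.

Let p0 : 0 < p. Proof. exact: lt_trans p1. Qed.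

Lemma measurable_kerz : measurable_fun setT kerz.
Proof. exact: (measurable_ker p s measurable_fst measurable_snd). Qed.

Lemma kerz_ge0 z : 0 <= kerz z. Proof. exact: ker_ge0. Qed.

Lemma kerzC x y : kerz (x, y) = kerz (y, x). Proof. exact: kerC. Qed.

Lemma kerz_gt0 x y : x <> y -> 0 < kerz (x, y).
Proof.
move=> xy; rewrite invr_gt0 powR_gt0// enorm_gt0// subr_eq0; exact/eqP.
Qed.

Lemma mOmega : measurable (Omega : set (Rn R n)).
Proof. exact: open_measurable_Rn. Qed.

Lemma Omega_fin : (mu Omega < +oo)%E.
Proof.
have [r r0 Or] := bounded_coord bO.
apply: (@le_lt_trans _ _ (mu (cube (0 : 'rV[R]_n) (r + 1)))).
  apply: le_measure; rewrite ?inE; [exact: mOmega|exact: measurable_cube|].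
  move=> x Ox i; rewrite mxE sub0r normrN (le_lt_trans (Or x Ox i))//.
  by rewrite ltrDl.
by rewrite lebesgueRn_cube ?ltry// addr_gt0.
Qed.

(** A nonempty open [Omega] has positive measure, as [approximated_eq0] requires for u = 0 almost
    everywhere outside. *)
Lemma in_V0_facts (u : Rn R n -> R) : Omega !=set0 ->
  measurable_fun setT u -> in_V0 s p Omega (u : 'rV[R]_n -> R) ->
  exists phi : nat -> Rn R n -> R,
   [/\ forall j, test_function Omega (phi j : 'rV[R]_n -> R),
       approximated mu p Omega kerz (zext (Omega : set (Rn R n)) u) phi,
       (pair_energy mu p kerz (zext (Omega : set (Rn R n)) u) < +oo)%E,
       (Lp_energy mu p Omega (zext (Omega : set (Rn R n)) u) < +oo)%E &
       \forall x \ae mu, u x = (zext (Omega : set (Rn R n)) u) x].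
Proof.
move=> [x0 Ox0] mu_ [[[_ uLp] [_ uV]] [phi [tphi c1 c2]]].
exists phi.
have mphi j : measurable_fun setT (phi j : Rn R n -> R) := measurable_test_function (tphi j).
have phi0 j (x : Rn R n) : ~ Omega x -> phi j x = 0 := test_function_eq0 (tphi j).
have ap : approximated mu p Omega kerz u phi.
  move=> e e0.
  have h1 : \forall j \near \oo, (gagliardo_seminorm s p (fun x => u x - phi j x)%R `^ p <= e%:E)%E.
    apply: (poweR_cvg0_near p0 e0 _ c1) => j; exact: poweR_ge0.
  have h2 : \forall j \near \oo, (LpNorm mu Omega p (fun x : Rn R n => (u x - phi j x)%R) `^ p <= e%:E)%E.
    apply: (poweR_cvg0_near p0 e0 _ c2) => j; exact: Lnorm_ge0.
  apply: filterS2 h1 h2 => j h1 h2; split.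
    move: h1; rewrite /gagliardo_seminorm -poweRrM mulVf ?gt_eqF// poweRe1//.
    by apply: integral_ge0 => z _; rewrite lee_fin; apply: mulr_ge0; rewrite ?invr_ge0 powR_ge0.
  by move: h2; rewrite LpNormE.
have ae0 : \forall x \ae mu, ~ Omega x -> u x = 0.
  apply: (approximated_eq0 p1 mOmega measurable_kerz kerz_ge0 mu_ mphi phi0 _ _ ap).
    by move=> x y Ox nOy; apply: kerz_gt0 => xy; apply: nOy; rewrite -xy.
  exact: open_gt0_Rn oO Ox0.
have fin : (\int[mu2]_(z in Omega `*` setT) (`|u z.1 - u z.2| `^ p * kerz z)%:E < +oo)%E.
  have : (LpNorm mu2 (Omega `*` setT) p (fun z : Rn R n * Rn R n =>
    ((u z.1 - u z.2) / enorm (z.1 - z.2 : 'rV[R]_n) `^ (n%:R / p + s))%R) `^ p < +oo)%E.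
    exact: poweR_lty.
  rewrite (LpNormE mu2 _ _ p0); apply: le_lt_trans.
  rewrite le_eqVlt; apply/orP; left; apply/eqP; apply: eq_integral => z _.
  rewrite normrM normfV (ger0_norm (powR_ge0 _ _)) powRM ?invr_ge0 ?powR_ge0//.
  rewrite powRV ?powR_ge0// -powRrM /kerz /ker.
  (* The exponents agree: (n/p + s) p = n + ps. *)
  by congr (_ * (_ `^ _)^-1)%:E; field; rewrite gt_eqF.
have finL : (\int[mu]_(x in Omega) (`|u x| `^ p)%:E < +oo)%E.
  by rewrite -(LpNormE mu _ _ p0); exact: poweR_lty.
have [h1 h2 h3 h4] := zext_facts p1 mOmega measurable_kerz kerz_ge0 kerzC mu_ mphi ae0 ap fin finL.
by split; [exact: tphi|exact: h1|exact: h2|exact: h3|exact: h4].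
Qed.

End concrete.

Section concrete_barrier.
Context {R : realType} {n : nat}.
Variables (p s : R) (Omega : set 'rV[R]_n).
Hypotheses (p1 : 1 < p) (s0 : 0 < s) (s1 : s < 1)
  (oO : open Omega) (bO : bounded_set Omega).
Local Notation mu := (@lebesgueRn R n).
Local Notation mu2 := (mu \x mu)%E.

Let p0 : 0 < p. Proof. exact: lt_trans p1. Qed.

Lemma weak_sub (u : Rn R n -> R) : measurable_fun setT u ->
  (\forall x \ae mu, u x = zext (Omega : set (Rn R n)) u x) ->
  fracplap_le s p Omega (u : 'rV[R]_n -> R) (fun=> 1) ->
  forall phi : 'rV[R]_n -> R, test_function Omega phi -> (forall x, 0 <= phi x) ->
  (\int[mu2]_z (weak_integrand p (kerz p s) (zext (Omega : set (Rn R n)) u) phi z)%:E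
    <= \int[mu]_(x in Omega) (1 * phi x)%:E)%E.
Proof.
move=> mu_ ae [_ _ _ H] phi tphi phi0.
rewrite -(@integral_weak_ae _ _ _ _ _ _ (measurable_kerz p s) u)//; first exact: H.
- exact: measurable_zext (mOmega oO) mu_.
- exact: measurable_test_function tphi.
Qed.

(** The lower bound on [u] is an upper bound on [- u], so one limit argument covers both
    inequalities. *)
Lemma weak_super (u : Rn R n -> R) (c : R) : measurable_fun setT u ->
  (\forall x \ae mu, u x = zext (Omega : set (Rn R n)) u x) -> 0 <= c ->
  fracplap_ge s p Omega (u : 'rV[R]_n -> R) (fun=> - c) ->
  forall phi : 'rV[R]_n -> R, test_function Omega phi -> (forall x, 0 <= phi x) ->
  (\int[mu2]_z (weak_integrand p (kerz p s)
      (fun x => - zext (Omega : set (Rn R n)) u x) phi z)%:E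
    <= \int[mu]_(x in Omega) (c * phi x)%:E)%E.
Proof.
move=> mu_ ae c0 [_ _ _ H] phi tphi phi0.
have mphi := measurable_test_function tphi.
have E : (\int[mu2]_z (weak_integrand p (kerz p s) (zext (Omega : set (Rn R n)) u) phi z)%:E =
    weak_form s p u phi)%E.
  rewrite -(@integral_weak_ae _ _ _ _ _ _ (measurable_kerz p s) u)//.
  exact: measurable_zext (mOmega oO) mu_.
rewrite (_ : (\int[mu2]_z _)%E = (\int[mu2]_z - (weak_integrand p (kerz p s)
    (zext (Omega : set (Rn R n)) u) phi z)%:E)%E); last first.
  apply: eq_integral => z _; rewrite -EFinN; congr _%:E; rewrite /weak_integrand.
  by rewrite -opprD pJN mulNr mulNr.
apply: le_trans (integralN_le _ _ _) _; rewrite E leeNl.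
apply: le_trans (H phi tphi phi0).
rewrite le_eqVlt; apply/orP; left; apply/eqP.
rewrite -integral_ge0N; last by move=> x _; rewrite lee_fin mulr_ge0.
by apply: eq_integral => x _; rewrite mulNr.
Qed.

(** The point is the choice of the majorant [q] for [barrier_ineq]: linear in |x - y| near the
    diagonal, constant far away, and zero on pairs that miss [Omega]. *)
Lemma paraboloid_barrier (g : Rn R n -> R) (phi : nat -> Rn R n -> R) (c l Lam : R)
    (a : 'rV[R]_n) :
  measurable_fun setT g -> (forall x : Rn R n, ~ Omega x -> g x = 0) ->
  (forall j, test_function Omega (phi j : 'rV[R]_n -> R)) ->
  approximated mu p (Omega : set (Rn R n)) (kerz p s) g phi ->
  (pair_energy mu p (kerz p s) g < +oo)%E ->
  (Lp_energy mu p (Omega : set (Rn R n)) g < +oo)%E ->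
  compact [set x | paraboloid c l a x <= 0] ->
  [set x | paraboloid c l a x <= 0] `<=` Omega ->
  (forall f : 'rV[R]_n -> R, test_function Omega f -> (forall x, 0 <= f x) ->
    (\int[mu2]_z (weak_integrand p (kerz p s) g f z)%:E <=
     \int[mu]_(x in Omega) (Lam * f x)%:E)%E) ->
  let v (x : Rn R n) := Num.max (g x - paraboloid c l a x) 0 in
  [/\ mu2.-integrable setT (EFin \o weak_integrand p (kerz p s) g v),
      (\int[mu2]_z (weak_integrand p (kerz p s) g v z)%:E <= \int[mu]_x (Lam * v x)%:E)%E &
      mu.-integrable setT (fun x => (Lam * v x)%:E)].
Proof.
move=> mg g0 tphi ap Eg Lg cw wO weak v.
have [r r0 Or] := bounded_coord bO.
(* The summand 1 covers the points at distance below 1 from [Omega], where the Lipschitz bound is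
   also used. *)
pose rho := r + enorm a + 1.
have a0 : 0 <= enorm a := enorm_ge0 a.
have rho0 : 0 < rho by rewrite /rho; lra.
pose Lc := `|l| * (n%:R * (2 * rho)).
have Lc0 : 0 <= Lc by rewrite mulr_ge0// mulr_ge0// mulr_ge0// ltW.
pose Mw := `|c| + `|l| * (n%:R * rho) ^+ 2.
have Mw0 : 0 <= Mw by rewrite addr_ge0// mulr_ge0// sqr_ge0.
pose w := paraboloid c l a.
have Oa x : Omega x -> forall i, `|x ord0 i - a ord0 i| <= rho.
  move=> Ox i; rewrite (le_trans (ler_normB _ _))//.
  have := Or x Ox i; have := enorm_coord a i; rewrite /rho; lra.
have wM x : Omega x -> `|w x| <= Mw.
  move=> Ox; rewrite /w /paraboloid (le_trans (ler_normD _ _))// lerD2l normrM ler_wpM2l//.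
  rewrite ger0_norm ?sqr_ge0// lerXn2r ?nnegrE ?enorm_ge0 ?mulr_ge0 ?(ltW rho0)//.
  by apply: enorm_le; [exact: ltW|move=> i; rewrite !mxE; exact: Oa].
(* [Lc] serves pairs at distance below 1, [2 * Mw] all others. *)
pose L := Lc + 2 * Mw.
have L0 : 0 <= L by rewrite /L; lra.
pose ind (x : Rn R n) : R := \1_(Omega : set (Rn R n)) x.
have ind01 x : 0 <= ind x <= 1 by rewrite /ind indicE; case: (_ \in _); rewrite ?lexx ?ler01.
pose mn (z : Rn R n * Rn R n) : R := Num.min 1 (enorm (z.1 - z.2 : 'rV[R]_n)).
have mn0 z : 0 <= mn z by rewrite le_min ler01 enorm_ge0.
pose q (z : Rn R n * Rn R n) : R := L * mn z * Num.max (ind z.1) (ind z.2).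
have q0 z : 0 <= q z.
  rewrite mulr_ge0//; first exact: mulr_ge0.
  by rewrite le_max; case/andP: (ind01 z.1) => ->.
have qC x y : q (x, y) = q (y, x) by rewrite /q /mn/= enormB maxC.
have mind : measurable_fun setT ind := measurable_indic (mOmega oO).
have men : measurable_fun setT (fun z : Rn R n * Rn R n => enorm (z.1 - z.2 : 'rV[R]_n)).
  exact: (measurable_enorm measurable_fst measurable_snd).
have mmn : measurable_fun setT mn.
  by apply: measurable_minr; [exact: measurable_cst|exact: men].
have mq : measurable_fun setT q.
  apply: measurable_funM.
    by apply: measurable_funM; [exact: measurable_cst|exact: mmn].
  apply: measurable_maxr.
    exact: (measurableT_comp mind measurable_fst).
  exact: (measurableT_comp mind measurable_snd).
pose h (z : Rn R n * Rn R n) : R := ker_near p s 1 z.1 z.2 + ker_far p s 1 z.1 z.2.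
have mkn := measurable_ker_near p s 1 (@measurable_fst _ _ (Rn R n) (Rn R n)) (@measurable_snd _ _ (Rn R n) (Rn R n)).
have mkf := measurable_ker_far p s 1 (@measurable_fst _ _ (Rn R n) (Rn R n)) (@measurable_snd _ _ (Rn R n) (Rn R n)).
have mh : measurable_fun setT h := measurable_funD mkn mkf.
have h0 z : 0 <= h z by rewrite addr_ge0// ?ker_near_ge0 ?ker_far_ge0.
have hC x y : h (x, y) = h (y, x) by rewrite /h/= ker_nearC ker_farC.
have [S S0 hS] := @integral_ker_near R n p s p1 s0 s1 1 ltr01.
have [T0 T00 hT] := @integral_ker_far R n p s p1 s0 1 ltr01.
have hI x : (\int[mu]_y (h (x, y))%:E <= (S + T0)%:E)%E.
  rewrite /h /=; under eq_integral do rewrite EFinD.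
  rewrite ge0_integralD; last 5 first.
  - exact: measurableT.
  - by move=> y _; rewrite lee_fin ker_near_ge0.
  - apply/measurable_EFinP; exact: (measurableT_comp mkn (@pair1_measurable _ _ _ _ x)).
  - by move=> y _; rewrite lee_fin ker_far_ge0.
  - apply/measurable_EFinP; exact: (measurableT_comp mkf (@pair1_measurable _ _ _ _ x)).
  by rewrite EFinD leeD.
have fq : (\int[mu2]_z (q z `^ p * kerz p s z)%:E < +oo)%E.
  apply: (@local_energy_fin _ _ _ _ (Omega : set (Rn R n)) (mOmega oO) (Omega_fin oO bO) _ h (L `^ p) (S + T0)).
  - apply: measurable_funM; last exact: measurable_kerz.
    exact: (measurableT_comp (measurable_powR _) mq).
  - by move=> z; rewrite mulr_ge0 ?powR_ge0 ?kerz_ge0.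
  - exact: mh.
  - exact: h0.
  - exact: hC.
  - exact: powR_ge0.
  - exact: addr_ge0.
  - exact: hI.
  move=> x y; rewrite /q /= powRM//; last 2 first.
  - exact: mulr_ge0.
  - by rewrite le_max; case/andP: (ind01 x) => ->.
  rewrite powRM// -!mulrA ler_wpM2l ?powR_ge0//.
  (* The minimum with 1 splits at distance 1 into exactly the near and the far kernel. *)
  have -> : h (x, y) = mn (x, y) `^ p * kerz p s (x, y).
    rewrite /h /mn /ker_near /ker_far /kerz/=; case: (ltP (enorm (x - y)) 1) => xy1.
      by rewrite addr0.
    by rewrite add0r powR1 mul1r.
  rewrite [leLHS]mulrCA; apply: ler_wpM2r; first by rewrite mulr_ge0 ?powR_ge0 ?kerz_ge0.
  rewrite /ind !indicE.
  case: (x \in _); case: (y \in _); rewrite ?maxxx ?powR1 ?addr0 ?add0r ?powR0_pos//;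
    rewrite ?(max_l ler01) ?(max_r ler01) ?powR1 ?lerDl//.
have wOut x : ~ Omega x -> 0 <= w x.
  by move=> nOx; rewrite ltW// ltNge; apply/negP => /wO.
have wq x y : Omega x -> `|w x - w y| <= q (x, y) \/ ~ Omega y /\ `|w x| <= q (x, y).
  move=> Ox.
  have mx1 : Num.max (ind x) (ind y) = 1.
    rewrite max_l; first by rewrite /ind indicE mem_set.
    by rewrite {2}/ind indicE mem_set//; case/andP : (ind01 y).
  rewrite /q /= mx1 mulr1; have [xy|xy] := ltP (enorm (x - y)) 1.
    left; rewrite /mn /= min_r; last exact: ltW.
    apply: (@le_trans _ _ (Lc * enorm (x - y))); last first.
      by rewrite ler_wpM2r ?enorm_ge0// /L lerDl mulr_ge0.
    apply: paraboloid_lip; first exact: Oa.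
    move=> i; have := Or x Ox i; have := enorm_coord a i.
    have := enorm_coord (x - y) i; rewrite !mxE => h1 h2 h3.
    rewrite (_ : y ord0 i - a ord0 i = x ord0 i - (x ord0 i - y ord0 i) - a ord0 i); last by ring.
    rewrite (le_trans (ler_normB _ _))//.
    have := ler_normB (x ord0 i) (x ord0 i - y ord0 i); rewrite /rho; lra.
  rewrite /mn/= min_l// mulr1; have [Oy|nOy] := pselect (Omega y).
    left; rewrite (le_trans (ler_normB _ _))//.
    by have := wM _ Ox; have := wM _ Oy; rewrite /L; lra.
  by right; split => //; have := wM _ Ox; rewrite /L; lra.
have mphi j := measurable_test_function (tphi j).
apply: (@barrier_ineq _ _ _ mu p (Omega : set (Rn R n)) (kerz p s) p1 (mOmega oO)
  (measurable_kerz p s) (kerz_ge0 p s) q g w phi Lam Mw (Omega_fin oO bO) mq q0 qC mg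
  (measurable_paraboloid c l a) mphi g0 (fun j x => test_function_eq0 (tphi j))
  wOut wM wq Eg Lg fq ap).
move=> j m; apply: weak; last by move=> x; exact: soft_ge0.
exact: (test_function_soft m (tphi j) (smooth_paraboloid c l a) cw wO).
Qed.

End concrete_barrier.

(** * Bounds for solutions *)

Section solutions.
Context {R : realType} {n : nat}.
Variables (p s : R) (Omega K : set 'rV[R]_n) (delta : R).
Hypotheses (n_gt0 : (0 < n)%N) (p1 : 1 < p) (s0 : 0 < s) (s1 : s < 1)
  (oO : open Omega) (bO : bounded_set Omega)
  (mK : measurable (K : set (Rn R n))) (KO : compactly_contained K Omega)
  (delta0 : 0 < delta).
Local Notation mu := (@lebesgueRn R n).
Local Notation mu2 := (mu \x mu)%E.
Local Notation sg := (n%:R + p * s).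

Let p0 : 0 < p. Proof. exact: lt_trans p1. Qed.

Definition lower_rhs (u : 'rV[R]_n -> R) : R :=
  2 * diam Omega `^ (- sg) * \int[mu]_(y in K) (u y `^ (p - 1)).

Definition solution (u : 'rV[R]_n -> R) :=
  [/\ {within closure (neighborhood Omega delta), continuous u},
      in_V0 s p Omega u,
      forall x, Omega x -> 0 < u x,
      fracplap_ge s p Omega u (fun=> - lower_rhs u) &
      fracplap_le s p Omega u (fun=> 1)].

Definition ext (u : 'rV[R]_n -> R) : Rn R n -> R := zext (Omega : set (Rn R n)) u.

Lemma lower_rhs_ge0 u : 0 <= lower_rhs u.
Proof.
rewrite mulr_ge0//; first by rewrite mulr_ge0 ?powR_ge0.
by apply: Rintegral_ge0 => y _; exact: powR_ge0.
Qed.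

Lemma solution_continuous u x : solution u -> Omega x -> {for x, continuous u}.
Proof.
move=> [cu _ _ _ _] Ox.
have ON : Omega `<=` closure (neighborhood Omega delta).
  move=> y Oy; apply: subset_closure; rewrite /neighborhood/=.
  apply: (@le_lt_trans _ _ 0%:E); last by rewrite lte_fin.
  apply: ereal_inf_lbound; exists y; first exact: subset_closure.
  by rewrite subrr enorm0.
have := continuous_subspaceW ON cu.
by rewrite continuous_open_subspace// => /(_ x); apply; rewrite inE.
Qed.

Lemma solution_measurable u : solution u -> measurable_fun [set: Rn R n] (u : Rn R n -> R).
Proof. by move=> [_ _ _ _ [_ []]]. Qed.

Lemma measurable_ext u : solution u -> measurable_fun [set: Rn R n] (ext u).
Proof. by move=> /solution_measurable su; exact: measurable_zext (mOmega oO) su. Qed.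

Lemma ext_ge0 u x : solution u -> 0 <= ext u x.
Proof.
move=> [_ _ u0 _ _]; have [Ox|nOx] := pselect (Omega x).
  by rewrite /ext zext_in// ltW// u0.
by rewrite /ext zext_out.
Qed.

Lemma solution_facts u : Omega !=set0 -> solution u ->
  exists phi : nat -> Rn R n -> R,
   [/\ forall j, test_function Omega (phi j : 'rV[R]_n -> R),
       approximated mu p (Omega : set (Rn R n)) (kerz p s) (ext u) phi,
       (pair_energy mu p (kerz p s) (ext u) < +oo)%E,
       (Lp_energy mu p (Omega : set (Rn R n)) (ext u) < +oo)%E &
       \forall x \ae mu, u x = ext u x].
Proof.
move=> O0 su; have mu_ := solution_measurable su.
by case: su => _ V0 _ _ _; exact: (in_V0_facts p1 oO O0 mu_ V0).
Qed.

(** For t > 0 the constant barrier has empty sublevel set, which is trivially compact in [Omega]. *)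
Lemma sub_barrier u (t : R) : Omega !=set0 -> solution u -> 0 < t ->
  let v x := Num.max (ext u x - t) 0 in
  [/\ mu2.-integrable setT (EFin \o weak_integrand p (kerz p s) (ext u) v),
      (\int[mu2]_z (weak_integrand p (kerz p s) (ext u) v z)%:E <=
       \int[mu]_x (1 * v x)%:E)%E &
      mu.-integrable setT (EFin \o v)].
Proof.
move=> O0 su t0 v; have [phi [tphi ap E1 E2 ae]] := solution_facts O0 su.
have wE : paraboloid t 0 (0 : 'rV[R]_n) = fun=> t.
  by apply/funext => x; rewrite /paraboloid mul0r addr0.
have w0 : [set x | paraboloid t 0 (0 : 'rV[R]_n) x <= 0] = set0.
  by rewrite wE; apply/seteqP; split => x //=; rewrite leNgt t0.
have mu_ := solution_measurable su.
have [_ _ _ _ le1] := su.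
have gO (x : Rn R n) : ~ Omega x -> ext u x = 0 by exact: zext_out.
have := @paraboloid_barrier R n p s Omega p1 s0 s1 oO bO (ext u) phi t 0 1 0
  (measurable_ext su) gO tphi ap E1 E2.
rewrite w0 wE => /(_ compact0 (@sub0set _ _) (weak_sub oO mu_ ae le1)) [h1 h2 h3].
split => //; move: h3; rewrite (_ : (fun x => _) = EFin \o v)//.
by apply/funext => x; rewrite mul1r.
Qed.

Lemma super_barrier u (c l : R) (a : 'rV[R]_n) : Omega !=set0 -> solution u ->
  compact [set x | paraboloid c l a x <= 0] ->
  [set x | paraboloid c l a x <= 0] `<=` Omega ->
  let v (x : Rn R n) := Num.max (- ext u x - paraboloid c l a x) 0 in
  [/\ mu2.-integrable setT (EFin \o weak_integrand p (kerz p s) (fun x => - ext u x) v),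
      (\int[mu2]_z (weak_integrand p (kerz p s) (fun x => - ext u x)%R v z)%:E <=
       \int[mu]_x (lower_rhs u * v x)%:E)%E &
      mu.-integrable setT (fun x => (lower_rhs u * v x)%:E)].
Proof.
move=> O0 su cw wO v; have [phi [tphi ap E1 E2 ae]] := solution_facts O0 su.
have mu_ := solution_measurable su.
have [_ _ _ ge1 _] := su.
apply: (@paraboloid_barrier R n p s Omega p1 s0 s1 oO bO (fun x => - ext u x)
  (fun j x => - phi j x) c l (lower_rhs u) a _ _ _ _ _ _ cw wO
  (weak_super oO mu_ ae (lower_rhs_ge0 u) ge1)).
- exact: measurable_funN (measurable_ext su).
- by move=> x nOx; rewrite /ext zext_out// oppr0.
- by move=> j; exact: test_functionN.
- exact: approximatedN.
- by rewrite pair_energyN.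
- by rewrite Lp_energyN.
Qed.

Lemma nbhs_measure_gt0 (x : 'rV[R]_n) (A B : set 'rV[R]_n) :
  nbhs x A -> A `<=` B -> measurable (B : set (Rn R n)) -> (0 < mu B)%E.
Proof.
move=> /nbhs_ballP[e e0 eA] AB mB; rewrite (cube_ball _ e0) in eA.
apply: (@lt_le_trans _ _ (mu (cube x e))).
  by rewrite lebesgueRn_cube// lte_fin exprn_gt0// mulr_gt0.
by apply: le_measure; rewrite ?inE; [exact: measurable_cube|exact: mB|move=> y /eA/AB].
Qed.

(** By continuity a pointwise value yields positive measure; this converts almost-everywhere
    conclusions back into pointwise ones. *)
Lemma above_ext_gt0 u x t : solution u -> Omega x -> t < u x ->
  (0 < mu (above (ext u) t))%E.
Proof.
move=> su Ox tu.
apply: (@nbhs_measure_gt0 x (Omega `&` u @^-1` [set y | t < y])).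
- apply: filterI; first exact: open_nbhs_nbhs.
  by apply: (solution_continuous su Ox); apply: open_nbhs_nbhs; split.
- by move=> y [Oy /= ty]; rewrite /above/= /ext zext_in.
- exact: measurable_above (measurable_ext su).
Qed.

Lemma solution_bounded : Omega !=set0 -> exists2 M : R, 0 < M &
  forall u, solution u -> forall x, Omega x -> u x <= M.
Proof.
move=> O0; have [r r0 Or] := bounded_coord bO.
(* Points of [cube c 1] have coordinates above r + 1, those of [Omega] at most [r]. *)
pose c : 'rV[R]_n := const_mx (r + 2).
pose Q : set (Rn R n) := cube c 1.
have QO (x y : 'rV[R]_n) : Omega x -> Q y -> x <> y.
  move=> Ox Qy xy; have := Qy (Ordinal n_gt0); have := Or x Ox (Ordinal n_gt0).
  by rewrite xy mxE ler_norml ltr_norml => /andP[_ h1] /andP[h2 h3]; lra.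
(* Coordinates of points in [Omega] and in [Q] differ by at most 2r + 3. *)
pose D0 := n%:R * (2 * r + 3).
have n0 : 0 < n%:R :> R by rewrite ltr0n.
have D00 : 0 < D0 by rewrite mulr_gt0//; lra.
pose kap := (D0 `^ sg)^-1.
have kap0 : 0 < kap by rewrite invr_gt0 powR_gt0.
have QD (x y : 'rV[R]_n) : Omega x -> Q y -> kap <= kerz p s (x, y).
  move=> Ox Qy; apply: ker_ge => //; first by apply/eqP; exact: QO.
  apply: enorm_le; first lra.
  move=> i; rewrite !mxE; have := Or x Ox i; have := Qy i; rewrite mxE.
  rewrite ltr_norml !ler_norml => /andP[h1 h2] /andP[h3 h4].
  by apply/andP; split; lra.
pose m : R := (2 * 1) ^+ n.
have m0 : 0 < m by rewrite exprn_gt0.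
(* [M] then solves kap M^(p-1) m = 2, which exceeds the right-hand side 1. *)
pose b := 2 / (kap * m).
have b0 : 0 < b by rewrite divr_gt0// mulr_gt0.
pose M := b `^ (p - 1)^-1.
have M0 : 0 < M by rewrite powR_gt0.
have p10 : p - 1 != 0 by rewrite gt_eqF// subr_gt0.
have HM : 1 < kap * M `^ (p - 1) * m.
  rewrite /M -powRrM mulVf// powRr1 ?(ltW b0)// /b mulrAC mulrCA divff ?mulr1 ?ltr1n//.
  by rewrite gt_eqF// mulr_gt0.
exists M => // u su x Ox.
have [h1 h2 h3] := sub_barrier O0 su M0.
have uQ y : Q y -> ext u y = 0.
  by move=> Qy; rewrite /ext zext_out// => Oy; exact: (QO y y).
have muQ : mu Q = m%:E by rewrite /Q lebesgueRn_cube.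
have ukap (x' y : Rn R n) : 0 < ext u x' -> Q y -> kap <= kerz p s (x', y).
  move=> ux Qy; apply: QD => //; apply: contrapT => nOx.
  by move: ux; rewrite /ext zext_out// ltxx.
have := @global_bound _ _ _ mu p (kerz p s) p1 (kerz_ge0 p s) (ext u) Q kap m 1 M
  (measurable_ext su) (measurable_cube c 1) muQ (fun x => ext_ge0 x su) uQ (ltW kap0) ukap
  M0 ler01 HM h1 h2 h3.
move=> H; rewrite leNgt; apply/negP => Mu.
have := above_ext_gt0 su Ox Mu.
by rewrite /above H ltxx.
Qed.

Definition nearb (r0 : R) (z : Rn R n * Rn R n) : bool :=
  enorm (z.1 - z.2 : 'rV[R]_n) < r0.

Lemma measurable_nearb r0 : measurable_fun setT (nearb r0).
Proof.
apply: measurable_fun_ltr; last exact: measurable_cst.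
exact: (measurable_enorm measurable_fst measurable_snd).
Qed.

Lemma nearbC r0 x y : nearb r0 (x, y) = nearb r0 (y, x).
Proof. by rewrite /nearb/= enormB. Qed.

Lemma de_giorgi_Rn (r0 E : R) : 0 < r0 -> 0 <= E -> exists2 nu : R, 0 < nu &
  forall (f : Rn R n -> R) (h : R), measurable_fun setT f -> 0 < h ->
  (forall t, 0 <= t < h ->
    (trunc_energy mu p (kern_near (kerz p s) (nearb r0)) f t
       <= (E * h `^ p)%:E * mu (above f t))%E) ->
  (mu (above f 0) <= nu%:E)%E -> mu [set x | (h <= f x)%R] = 0%E.
Proof.
move=> r00 E0.
have n0 : 0 < n%:R :> R by rewrite ltr0n.
(* Points of [cube x r] are within n r of [x], whence c = n; radii up to r0 / (2n) keep them among
   the near pairs. *)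
apply: (@de_giorgi _ _ _ mu n p s n%:R (r0 / (2 * n%:R))
  (kern_near (kerz p s) (nearb r0)) (fun x r => cube (x : 'rV[R]_n) r)) => //.
- by rewrite divr_gt0// mulr_gt0.
- exact: (measurable_kern_near (measurable_kerz p s) (measurable_nearb r0)).
- exact: kern_near_ge0 (kerz_ge0 p s).
- by move=> x r; exact: measurable_cube.
- by move=> x r; exact: lebesgueRn_cube.
- move=> x y r /andP[r1 r2] xy nxy.
  have h1 := enorm_cube r1 xy.
  rewrite /kern_near /nearb ifT/=; last first.
    rewrite (le_lt_trans h1)// (@le_lt_trans _ _ (r0 / 2))//; last lra.
    move: r2; rewrite ler_pdivlMr ?mulr_gt0// => r2; lra.
  by apply: ker_ge => //; apply/eqP.
Qed.

(* If [{u > D/4}] were small, De Giorgi's iteration would force [u <= 3D/4]. *)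
Lemma point_mass (x0 : 'rV[R]_n) (D M : R) : Omega x0 -> 0 < D -> 0 < M ->
  exists2 nu : R, 0 < nu & forall u, solution u -> (forall x, Omega x -> u x <= M) ->
    D <= u x0 -> (nu%:E <= mu (above (ext u) (D / 4)))%E.
Proof.
move=> Ox D0 M0; have O0 : Omega !=set0 by exists x0.
have c0 := cac_c_gt0 p.
(* Starting at D/4, an iteration of height D/2 ends at 3D/4, still below u x0. *)
pose h := D / 2; have h0 : 0 < h by rewrite divr_gt0.
(* Makes E h^p the constant M / cac_c supplied by [sub_energy]. *)
pose E := M / cac_c p / h `^ p.
have E0 : 0 <= E by rewrite !divr_ge0 ?powR_ge0 ?(ltW c0)// ltW.
have [nu nu0 H] := @de_giorgi_Rn 1 E ltr01 E0.
exists nu => // u su uM Du; rewrite leNgt; apply/negP => small.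
pose f (x : Rn R n) := ext u x - D / 4.
have mu_ := measurable_ext su.
have mf : measurable_fun setT f by apply: measurable_funB; [exact: mu_|exact: measurable_cst].
have aE t : above f t = above (ext u) (D / 4 + t).
  by apply/seteqP; split => x; rewrite /above /f/= ltrBrDl.
have uM' x : ext u x <= M.
  have [xO|xO] := pselect (Omega x); first by rewrite /ext zext_in// uM.
  by rewrite /ext zext_out// ltW.
have := H f h mf h0 _ _.
rewrite aE addr0 => /(_ _ (ltW small)) H'.
have {}H' : mu [set x | (h <= f x)%R] = 0%E.
  apply: H' => t /andP[t0 th].
  have t40 : 0 < D / 4 + t by rewrite ltr_wpDr// divr_gt0.
  have [h1 h2 _] := sub_barrier O0 su t40.
  have := @sub_energy _ _ _ mu p (kerz p s) (nearb 1) p1 (measurable_kerz p s)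
    (kerz_ge0 p s) (measurable_nearb 1) (ext u) (D / 4 + t) 1 M mu_ uM' (ltW t40) ler01
    (ltW M0) h1 h2.
  have -> : trunc_energy mu p (kern_near (kerz p s) (nearb 1)) f t =
      trunc_energy mu p (kern_near (kerz p s) (nearb 1)) (ext u) (D / 4 + t).
    apply: eq_integral => z _; rewrite /f; congr (`|_ - _| `^ _ * _)%:E;
      congr Num.max; ring.
  rewrite aE -lee_pdivlMl// => /le_trans; apply.
  rewrite muleA -EFinM lee_wpmul2r// lee_fin le_eqVlt; apply/orP; left; apply/eqP.
  by rewrite /E; field; rewrite !gt_eqF// powR_gt0.
have : (0 < mu (above (ext u) (3 * D / 4)))%E.
  by apply: (above_ext_gt0 su Ox); lra.
suff : (mu (above (ext u) (3 * D / 4)) <= 0)%E by move=> /le_lt_trans h1 /h1; rewrite ltxx.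
rewrite -H'; apply: le_measure; rewrite ?inE.
- exact: measurable_above.
- rewrite (_ : [set x | _] = f @^-1` `[h, +oo[).
    by rewrite -[X in measurable X]setTI; exact: mf.
  by apply/seteqP; split => x /=; rewrite in_itv/= andbT.
- by move=> x; rewrite /above /f /h/= => hx; lra.
Qed.

Lemma norm_mass (q D M : R) : 1 <= q -> 0 < D -> 0 < M ->
  exists2 t : R, 0 < t & exists2 nu : R, 0 < nu &
  forall u, solution u -> (forall x, Omega x -> u x <= M) ->
    (D%:E <= LpNorm mu (Omega `\` K : set (Rn R n)) q u)%E ->
    (nu%:E <= mu (above (ext u) t))%E.
Proof.
move=> q1 D0 M0; have q0 : 0 < q by exact: lt_le_trans q1.
have Ofin := Omega_fin oO bO.
pose mO := fine (mu Omega).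
have muO : mu Omega = mO%:E by rewrite /mO fineK// ge0_fin_numE// measure_ge0.
have mO0 : 0 <= mO by rewrite -lee_fin -muO measure_ge0.
have Dq : 0 < D `^ q by rewrite powR_gt0.
(* With t^q = b the set {u <= t} contributes at most D^q / 2 to the integral; the other half must
   come from {u > t}, where u <= M. *)
pose b := D `^ q / (2 * (mO + 1)).
have b0 : 0 < b by rewrite divr_gt0// mulr_gt0// ltr_wpDl.
pose t := b `^ q^-1; have t0 : 0 < t by rewrite powR_gt0.
have tq : t `^ q = b by rewrite /t -powRrM mulVf ?gt_eqF// powRr1// ltW.
have Mq : 0 < M `^ q by rewrite powR_gt0.
exists t => //; exists (D `^ q / (2 * M `^ q)); first by rewrite divr_gt0// mulr_gt0.
move=> u su uM DN.
have mu_ := solution_measurable su.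
have mA := measurable_above t (measurable_ext su).
have mOK : measurable (Omega `\` K : set (Rn R n)).
  by apply: measurableD; [exact: mOmega|exact: mK].
have h1 : ((D `^ q)%:E <= \int[mu]_(x in Omega `\` K) (`|u x| `^ q)%:E)%E.
  rewrite -(LpNormE mu _ _ q0) -poweR_EFin; apply: gt0_ler_poweR.
  - exact: ltW.
  - by rewrite in_itv/= lee_fin (ltW D0) leey.
  - by rewrite in_itv/= leey andbT Lnorm_ge0.
  - exact: DN.
have h2 : (\int[mu]_(x in Omega `\` K) (`|u x| `^ q)%:E <=
    \int[mu]_x ((b * \1_(Omega : set (Rn R n)) x)%:E + (M `^ q * \1_(above (ext u) t) x)%:E))%E.
  rewrite integral_mkcond; apply: ge0_le_integral.
  - exact: measurableT.
  - by move=> x _; rewrite patchE; case: ifP => // _; rewrite lee_fin powR_ge0.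
  - apply/(measurable_restrictT _ mOK).1; apply: measurable_funTS; apply/measurable_EFinP.
    apply: (measurableT_comp (measurable_powR _)).
    exact: (measurableT_comp (@normr_measurable R setT) mu_).
  - apply: emeasurable_funD; first exact: measurable_scaled_indic (mOmega oO).
    exact: measurable_scaled_indic mA.
  move=> x _; rewrite -EFinD patchE; case: ifPn => [|_]; last first.
    by rewrite lee_fin addr_ge0// mulr_ge0// ltW.
  rewrite inE => -[Ox _]; rewrite lee_fin !indicE mem_set// mulr1.
  have u0 : 0 < u x by case: su => _ _ + _ _; apply.
  rewrite ger0_norm ?(ltW u0)//.
  have [xA|xA] := boolP (x \in above (ext u) t).
    rewrite mulr1 (@le_trans _ _ (M `^ q))//; last by rewrite lerDr ltW.
    by apply: powR_le; [exact: ltW|exact: ltW|exact: uM].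
  move: xA; rewrite notin_setE /above/= /ext zext_in// => /negP; rewrite -leNgt => ut.
  rewrite mulr0 addr0 -tq; apply: powR_le => //; exact: ltW.
have := le_trans h1 h2.
rewrite ge0_integralD; last 5 first.
- exact: measurableT.
- by move=> x _; rewrite lee_fin mulr_ge0// ltW.
- exact: measurable_scaled_indic (mOmega oO).
- by move=> x _; rewrite lee_fin mulr_ge0// ltW.
- exact: measurable_scaled_indic mA.
rewrite (integral_scaled_indic mu (mOmega oO) (ltW b0)) (integral_scaled_indic mu mA (ltW Mq)).
have Afin : (mu (above (ext u) t) < +oo)%E.
  apply: le_lt_trans Ofin; apply: le_measure; rewrite ?inE; [exact: mA|exact: mOmega|].
  move=> x; rewrite /above/= => tx; apply: contrapT => nOx.
  by move: tx; rewrite /ext zext_out// ltNge (ltW t0).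
pose m := fine (mu (above (ext u) t)).
have muA : mu (above (ext u) t) = m%:E by rewrite /m fineK// ge0_fin_numE// measure_ge0.
have E : (b%:E * mu Omega + (M `^ q)%:E * mu (above (ext u) t) =
    (b * mO + M `^ q * m)%:E)%E.
  by rewrite EFinD !EFinM; congr (_ * _ + _ * _)%E; [exact: muO|exact: muA].
rewrite E lee_fin => h3.
apply: (@le_trans _ _ m%:E); last by rewrite muA.
rewrite lee_fin.
rewrite ler_pdivrMr ?mulr_gt0//.
have h4 : b * mO <= D `^ q / 2.
  rewrite /b invfM mulrA -mulrA ler_piMr//; first by rewrite divr_ge0// ltW.
  by rewrite mulrC ler_pdivrMr ?mul1r ?lerDl// ltr_wpDl.
lra.
Qed.

End solutions.

(** * Geometry of the domain and of the paraboloid *)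

Section geometry.
Context {R : realType} {n : nat}.
Variable Omega : set 'rV[R]_n.
Hypotheses (n_gt0 : (0 < n)%N) (oO : open Omega) (bO : bounded_set Omega).

Lemma enorm_le_diam x y : Omega x -> Omega y -> enorm (x - y) <= diam Omega.
Proof.
move=> Ox Oy; apply: ub_le_sup; last by exists (x, y).
have [r r0 Or] := bounded_coord bO.
exists (n%:R * (2 * r)) => _ [[a b] [/= Oa Ob] <-].
apply: enorm_le; first by rewrite mulr_ge0// ltW.
move=> i; rewrite !mxE (le_trans (ler_normB _ _))//.
by have := Or a Oa i; have := Or b Ob i; lra.
Qed.

Lemma diam_gt0 : Omega !=set0 -> 0 < diam Omega.
Proof.
move=> [x Ox]; have /nbhs_ballP[e /= e0 eA] := open_nbhs_nbhs (conj oO Ox : open_nbhs x Omega).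
rewrite (cube_ball _ e0) in eA.
pose y := x + const_mx (e / 2).
have Oy : Omega y.
  by apply: eA => i; rewrite !mxE opprD addNKr normrN ger0_norm ?divr_ge0 ?(ltW e0)//; lra.
apply: lt_le_trans (enorm_le_diam Oy Ox); rewrite enorm_gt0// /y addrAC subrr add0r.
apply/eqP => /rowP/(_ (Ordinal n_gt0)); rewrite !mxE => /eqP.
by rewrite gt_eqF// divr_gt0.
Qed.

(* Extend the segment from [y] to [x] beyond [x], inside [cube x r]. *)
Lemma enorm_diam_gap x y r : 0 < r -> cube x r `<=` Omega -> Omega y ->
  (1 + r / (2 * diam Omega)) * enorm (x - y) <= diam Omega.
Proof.
move=> r0 xO Oy.
have Ox : Omega x by apply: xO => i; rewrite subrr normr0.
have d0 : 0 < diam Omega by apply: diam_gt0; exists x.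
(* The extension has length tau |x - y| <= r/2, so its endpoint stays in the cube. *)
set tau := r / _; have tau0 : 0 < tau by rewrite divr_gt0// mulr_gt0.
pose z := x + tau *: (x - y).
have Oz : Omega z.
  apply: xO => i; rewrite /z !mxE opprD addNKr normrN normrM (gtr0_norm tau0).
  apply: (@le_lt_trans _ _ (tau * diam Omega)).
    rewrite ler_wpM2l ?(ltW tau0)// (le_trans _ (enorm_le_diam Ox Oy))//.
    by have := enorm_coord (x - y) i; rewrite !mxE.
  rewrite /tau invfM mulrA -mulrA mulVf ?gt_eqF// mulr1; lra.
have := enorm_le_diam Oz Oy.
rewrite (_ : z - y = (1 + tau) *: (x - y)); last by rewrite /z scalerDl scale1r addrAC.
by rewrite enormZ ger0_norm// addr_ge0// ltW.
Qed.

Lemma sublevel_paraboloid (x1 : 'rV[R]_n) (e t r : R) : 0 < r -> 0 < e -> 0 <= t ->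
  forall x, paraboloid (- (2 * e) + t) (2 * e / r ^+ 2) x1 x <= 0 -> enorm (x - x1) <= r.
Proof.
move=> r0 e0 t0 x; rewrite /paraboloid => h.
have h1 : 2 * e / r ^+ 2 * enorm (x - x1) ^+ 2 <= 2 * e by lra.
move: h1; rewrite mulrAC ler_pdivrMr ?exprn_gt0// ler_pM2l ?mulr_gt0//.
by rewrite ler_sqr ?nnegrE ?enorm_ge0// ltW.
Qed.

Lemma compact_sublevel_paraboloid (c l : R) (a : 'rV[R]_n) :
  [set x | paraboloid c l a x <= 0] `<=` Omega ->
  compact [set x | paraboloid c l a x <= 0].
Proof.
move=> sO.
have cl : closed [set x | paraboloid c l a x <= 0].
  apply: (@preimage_closed _ _ (paraboloid c l a) [set y | y <= 0]).
    by move=> x _; exact: (smooth_continuous (smooth_paraboloid c l a)).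
  exact: closed_le.
have bd : bounded_set [set x | paraboloid c l a x <= 0].
  by move: bO => [M [Mr hM]]; exists M; split => // y /hM MO x /sO; exact: MO.
exact: bounded_closed_compact.
Qed.

End geometry.

Lemma ker_ge_dilation (R : realType) (n : nat) (p s d tau : R) (x y : 'rV[R]_n) :
  1 < p -> 0 < s -> 0 < tau -> 0 < enorm (x - y) -> (1 + tau) * enorm (x - y) <= d ->
  (1 + tau) `^ (n%:R + p * s) * d `^ (- (n%:R + p * s)) <= ker p s x y.
Proof.
move=> p1 s0 tau0 exy le_d.
have t1 : 0 < 1 + tau by rewrite addr_gt0.
have d0 : 0 < d by exact: lt_le_trans (mulr_gt0 t1 exy) le_d.
have -> : (1 + tau) `^ (n%:R + p * s) * d `^ (- (n%:R + p * s)) =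
    ((d / (1 + tau)) `^ (n%:R + p * s))^-1.
  rewrite powRM ?invr_ge0 ?(ltW d0) ?(ltW t1)// powRV ?(ltW t1)//.
  by rewrite powRN invfM invrK mulrC.
apply: ker_ge => //; last by rewrite ler_pdivlMr// mulrC.
by apply/eqP => exy'; move: exy; rewrite exy' subrr enorm0 ltxx.
Qed.

Lemma cube_sub_double (R : realType) (n : nat) (x x1 : 'rV[R]_n) (r : R) :
  enorm (x - x1) <= r -> cube x r `<=` cube x1 (2 * r).
Proof.
move=> xr y xy i; have := enorm_coord (x - x1) i; have := xy i; rewrite !mxE => h1 h2.
rewrite (_ : x1 ord0 i - y ord0 i = (x ord0 i - y ord0 i) - (x ord0 i - x1 ord0 i)); last by ring.
by rewrite (le_lt_trans (ler_normB _ _))//; lra.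
Qed.

(** The Lipschitz constant of the paraboloid is proportional to [e], so its near energy is of order
    e^p. This smallness is what the lower bound exploits. *)
Lemma paraboloid_ker_near (R : realType) (n : nat) (p s r r0 e c : R)
    (x1 x y : 'rV[R]_n) :
  1 < p -> 0 < r -> 0 < r0 -> 0 < e -> enorm (x - x1) <= r -> enorm (x - y) < r0 ->
  `|paraboloid c (2 * e / r ^+ 2) x1 x - paraboloid c (2 * e / r ^+ 2) x1 y| `^ p *
    ker p s x y <=
  (2 * (n%:R * (2 * (r + r0))) / r ^+ 2) `^ p * e `^ p * ker_near p s r0 x y.
Proof.
move=> p1 r_0 r00 e0 xr xy.
have rr : 0 <= 2 * (n%:R * (2 * (r + r0))) / r ^+ 2.
  by rewrite divr_ge0 ?exprn_ge0 ?(ltW r_0)// !mulr_ge0// addr_ge0// ltW.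
have p0 : 0 <= p by rewrite ltW// (lt_trans ltr01).
rewrite /ker_near xy mulrA -(powRM p rr (ltW e0)) -powRM ?enorm_ge0//; last first.
  by rewrite mulr_ge0// ltW.
rewrite [leRHS]mulrC [leLHS]mulrC ler_wpM2l ?ker_ge0//.
apply: powR_le => //.
have xr' i : `|x ord0 i - x1 ord0 i| <= r + r0.
  by have := enorm_coord (x - x1) i; rewrite !mxE; lra.
have yr' i : `|y ord0 i - x1 ord0 i| <= r + r0.
  have := enorm_coord (x - x1) i; have := enorm_coord (x - y) i; rewrite !mxE => h3 h4.
  rewrite (_ : y ord0 i - _ = (x ord0 i - x1 ord0 i) - (x ord0 i - y ord0 i)); last by ring.
  by rewrite (le_trans (ler_normB _ _))//; lra.
have := @paraboloid_lip R n c (2 * e / r ^+ 2) (r + r0) x1 x y xr' yr'.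
move/le_trans; apply; rewrite le_eqVlt; apply/orP; left; apply/eqP.
rewrite ger0_norm; last by rewrite divr_ge0 ?exprn_ge0 ?(ltW r_0)// mulr_ge0// ltW.
ring.
Qed.

(** The energy [a] may be infinite a priori; only real terms are moved across. *)
Lemma lee_cancel (R : realType) (a x : \bar R) (g l b : R) :
  (a + g%:E <= l%:E + (x + b%:E) -> a + (g - l - b)%:E <= x)%E.
Proof.
case: a => [a| |]; case: x => [x| |] //=; rewrite ?lee_fin ?leey ?leNye//.
lra.
Qed.

(** * Energy estimate below the paraboloid *)

Section lower.
Context {R : realType} {n : nat}.
Variables (p s : R) (Omega K : set 'rV[R]_n) (delta : R).
Hypotheses (n_gt0 : (0 < n)%N) (p1 : 1 < p) (s0 : 0 < s) (s1 : s < 1)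
  (oO : open Omega) (bO : bounded_set Omega)
  (mK : measurable (K : set (Rn R n))) (KO : compactly_contained K Omega)
  (delta0 : 0 < delta) (O0 : Omega !=set0).
Local Notation mu := (@lebesgueRn R n).
Local Notation mu2 := (mu \x mu)%E.
Local Notation sg := (n%:R + p * s).
Local Notation sol := (solution p s Omega K delta).
Local Notation ext := (ext Omega).

Let p0 : 0 < p. Proof. exact: lt_trans p1. Qed.
Let p10 : 0 < p - 1. Proof. by rewrite subr_gt0. Qed.

Definition power_mass (u : 'rV[R]_n -> R) : \bar R :=
  (\int[mu]_x (ext u x `^ (p - 1))%:E)%E.

Lemma measurable_ext_powR u : sol u ->
  measurable_fun setT (fun x : Rn R n => ext u x `^ (p - 1)).
Proof.
move=> su; have mu_ := measurable_ext oO su.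
exact: (measurableT_comp (measurable_powR _) mu_).
Qed.

Lemma power_mass_fin u M : sol u -> 0 < M -> (forall x, Omega x -> u x <= M) ->
  power_mass u \is a fin_num.
Proof.
move=> su M0 uM.
have mO := mOmega oO; have fO := Omega_fin oO bO.
rewrite ge0_fin_numE; last by apply: integral_ge0 => x _; rewrite lee_fin powR_ge0.
apply: (@le_lt_trans _ _ (\int[mu]_x (M `^ (p - 1) * \1_(Omega : set (Rn R n)) x)%:E)%E).
  apply: ge0_le_integral.
  - exact: measurableT.
  - by move=> x _; rewrite lee_fin powR_ge0.
  - by apply/measurable_EFinP; exact: measurable_ext_powR.
  - exact: measurable_scaled_indic mO.
  move=> x _; rewrite lee_fin indicE; have [xO|xO] := pselect (Omega x).
    rewrite mem_set// mulr1 /ext zext_in//; apply: powR_le; [exact: ltW| |exact: uM].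
    by case: su => _ _ u0 _ _; exact/ltW/u0.
  by rewrite memNset// mulr0 /ext zext_out// powR0_pos.
rewrite (integral_scaled_indic mu mO (powR_ge0 _ _)); apply: lte_mul_pinfty => //.
by rewrite lee_fin powR_ge0.
Qed.

Lemma power_mass_ge u (t m : R) : sol u -> 0 < t -> (m%:E <= mu (above (ext u) t))%E ->
  ((t `^ (p - 1) * m)%:E <= power_mass u)%E.
Proof.
move=> su t0 um; have mA := measurable_above t (measurable_ext oO su).
have tp : 0 <= t `^ (p - 1) by exact: powR_ge0.
apply: (@le_trans _ _ ((t `^ (p - 1))%:E * mu (above (ext u) t))%E).
  by rewrite EFinM; apply: lee_wpmul2l; [rewrite lee_fin|exact: um].
rewrite -(integral_scaled_indic mu mA tp); apply: ge0_le_integral.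
- exact: measurableT.
- by move=> x _; rewrite lee_fin mulr_ge0.
- exact: measurable_scaled_indic mA.
- by apply/measurable_EFinP; exact: measurable_ext_powR.
move=> x _; rewrite lee_fin indicE; have [|xA] := boolP (x \in above (ext u) t).
  rewrite inE /above/= mulr1 => tx; apply: powR_le; [exact: ltW|exact: ltW|exact: ltW].
by rewrite mulr0 powR_ge0.
Qed.

(** Enlarging [K] to [Omega] makes the right-hand side and the nonlocal gain comparable multiples of
    one quantity, [power_mass]. *)
Lemma lower_rhs_le u M : sol u -> 0 < M -> (forall x, Omega x -> u x <= M) ->
  lower_rhs p s Omega K u <= 2 * diam Omega `^ (- sg) * fine (power_mass u).
Proof.
move=> su M0 uM; rewrite /lower_rhs ler_wpM2l ?mulr_ge0 ?powR_ge0// /Rintegral.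
have KO' x : K x -> Omega x by move=> Kx; apply: KO; exact: subset_closure.
have le : (\int[mu]_(x in K) (u x `^ (p - 1))%:E <= power_mass u)%E.
  rewrite integral_mkcond; apply: ge0_le_integral.
  - exact: measurableT.
  - by move=> x _; rewrite patchE; case: ifP => // _; rewrite lee_fin powR_ge0.
  - apply/(measurable_restrictT _ mK).1; apply: measurable_funTS; apply/measurable_EFinP.
    apply: (measurableT_comp (measurable_powR _)).
    exact: solution_measurable su.
  - by apply/measurable_EFinP; exact: measurable_ext_powR.
  move=> x _; rewrite patchE; case: ifPn => [|_]; last by rewrite lee_fin powR_ge0.
  by rewrite inE => /KO' Ox; rewrite lee_fin /ext zext_in.
have fin := power_mass_fin su M0 uM.
apply: (fine_le _ fin le).
rewrite ge0_fin_numE; last by apply: integral_ge0 => x _; rewrite lee_fin powR_ge0.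
by rewrite (le_lt_trans le)// ltey_eq fin.
Qed.

(** Beyond distance [r0] the kernel beats diam^-(n+ps) by the factor (1 + tau)^(n+ps). The removed
    neighbourhood lies in [cube x r0], where u <= M, and costs the last term. *)
Lemma far_mass u M r r0 b (x : Rn R n) : sol u -> 0 < M -> (forall x, Omega x -> u x <= M) ->
  0 < r -> 0 < r0 -> cube x r `<=` Omega -> 0 <= b ->
  ((b * diam Omega `^ (- sg))%:E * power_mass u <=
    \int[mu]_y (b / (1 + r / (2 * diam Omega)) `^ sg *
      ext u y `^ (p - 1) * ker_far p s r0 x y)%:E +
    (b * diam Omega `^ (- sg) * M `^ (p - 1) * (2 * r0) ^+ n)%:E)%E.
Proof.
move=> su M0 uM r_0 r00 xO b0; set dd := _ `^ (- sg).
have dO0 : 0 < diam Omega := diam_gt0 n_gt0 oO bO O0.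
set tau := r / _; have tau0 : 0 < tau by rewrite divr_gt0// mulr_gt0.
set kap := _ `^ sg; have kap0 : 0 < kap by rewrite powR_gt0// addr_gt0.
have bk0 : 0 <= b / kap by rewrite divr_ge0// ltW.
have dd0 : 0 < dd by rewrite powR_gt0.
have Mp0 : 0 < M `^ (p - 1) by rewrite powR_gt0.
have bdd0 : 0 <= b * dd by rewrite mulr_ge0 ?(ltW dd0).
have c0 : 0 <= b * dd * M `^ (p - 1) := mulr_ge0 bdd0 (ltW Mp0).
have mc := measurable_cube x r0.
have mp := measurable_ext_powR su.
have u0 y : 0 <= ext u y by exact: ext_ge0 su.
have mfar : measurable_fun [set: Rn R n] (fun y => ker_far p s r0 x y).
  exact: (measurable_ker_far p s r0 (measurable_cst _) (@measurable_id _ _ _)).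
pose F y := b / kap * ext u y `^ (p - 1) * ker_far p s r0 x y.
have F0 y : 0 <= F y.
  by apply: mulr_ge0; [apply: mulr_ge0; [exact: bk0|exact: powR_ge0]|exact: ker_far_ge0].
have mF : measurable_fun [set: Rn R n] F.
  apply: measurable_funM; last exact: mfar.
  by apply: measurable_funM; [exact: measurable_cst|exact: mp].
rewrite [X in (_ <= _ + X)%E]EFinM -(lebesgueRn_cube x r00).
rewrite -(integral_scaled_indic mu mc c0) -ge0_integralZl; last 4 first.
- exact: measurableT.
- by apply/measurable_EFinP; exact: mp.
- by move=> y _; rewrite lee_fin powR_ge0.
- by rewrite lee_fin.
rewrite -ge0_integralD; last 5 first.
- exact: measurableT.
- by move=> y _; rewrite lee_fin; exact: F0.
- by apply/measurable_EFinP; exact: mF.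
- by move=> y _; rewrite lee_fin mulr_ge0.
- exact: measurable_scaled_indic mc.
apply: ge0_le_integral.
- exact: measurableT.
- by move=> y _; rewrite -EFinM lee_fin mulr_ge0 ?powR_ge0.
- by apply: measurable_funeM; apply/measurable_EFinP; exact: mp.
- apply: emeasurable_funD; first by apply/measurable_EFinP; exact: mF.
  exact: measurable_scaled_indic mc.
move=> y _; rewrite -EFinM -EFinD lee_fin -/(F y).
have [yO|yO] := pselect (Omega y); last first.
  have E0 : ext u y `^ (p - 1) = 0 by rewrite /ext zext_out// powR0_pos.
  by rewrite E0 mulr0 addr_ge0// mulr_ge0.
have [xy|xy] := ltP (enorm (x - y)) r0.
  rewrite indicE mem_set; last exact: cube_enorm.
  rewrite (@le_trans _ _ (b * dd * M `^ (p - 1)))//; last by rewrite mulr1 lerDr.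
  apply: ler_wpM2l => //; apply: powR_le; [exact: ltW|exact: u0|].
  by rewrite /ext zext_in// uM.
apply: (@le_trans _ _ (F y)); last by rewrite lerDl mulr_ge0.
rewrite /F /ker_far xy [leRHS]mulrAC; apply: ler_wpM2r; first exact: powR_ge0.
have exy : 0 < enorm (x - y) by exact: lt_le_trans xy.
have dgap := enorm_diam_gap n_gt0 oO bO r_0 xO yO.
have := ler_wpM2l bk0 (@ker_ge_dilation R n p s (diam Omega) tau x y p1 s0 tau0 exy dgap).
by rewrite mulrA divfK ?gt_eqF.
Qed.

(** The concave bump of height 2e minus [u], written as a truncation of [- u] against a barrier so
    that it fits [super_energy]. *)
Definition gap (u : 'rV[R]_n -> R) (x1 : 'rV[R]_n) (e r : R) : Rn R n -> R :=
  fun x => - ext u x - paraboloid (- (2 * e)) (2 * e / r ^+ 2) x1 x.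

(* [th] splits the gain [(1 + tau)^sg] between the nonlinearity and the removed
   neighbourhood of the diagonal. *)
Lemma lower_energy (M t m r : R) : 0 < M -> 0 < t -> 0 < m -> 0 < r ->
  exists r0 gam C eps0 : R, [/\ 0 < r0, 0 < gam, 0 <= C, 0 < eps0 &
  forall u (x1 : 'rV[R]_n) (e t' : R), sol u -> (forall x, Omega x -> u x <= M) ->
    (m%:E <= mu (above (ext u) t))%E -> cube x1 (2 * r) `<=` Omega ->
    0 < e <= eps0 -> 0 <= t' ->
    ((cac_c p)%:E * trunc_energy mu p (kern_near (kerz p s) (nearb r0)) (gap u x1 e r) t'
      + gam%:E * \int[mu]_x (Num.max (gap u x1 e r x - t') 0)%:E
      <= (C * e `^ p)%:E * mu (above (gap u x1 e r) t'))%E].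
Proof.
move=> M0 t0 m0 r_0.
have dO0 : 0 < diam Omega := diam_gt0 n_gt0 oO bO O0.
have sg0 : 0 < sg := @sg_gt0 R n p s p1 s0.
pose tau := r / (2 * diam Omega); have tau0 : 0 < tau by rewrite divr_gt0// mulr_gt0.
pose kap := (1 + tau) `^ sg.
have kap1 : 1 < kap.
  have <- : 1 `^ sg = 1 :> R by rewrite powR1.
  by apply: gt0_ltr_powR; rewrite ?nnegrE//; lra.
pose dd := diam Omega `^ (- sg); have dd0 : 0 < dd by rewrite powR_gt0.
(* Halfway between 1 and [kap]: the factor b / kap is given up to the nonlinearity through [th], and
   b > 1 remains as gain. *)
pose b := (1 + kap) / 2.
have b1 : 1 < b by rewrite /b; lra.
have bk : b < kap by rewrite /b; lra.
have bk0 : 0 < b / kap by rewrite divr_gt0//; lra.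
pose th := 1 - (b / kap) `^ (p - 1)^-1.
have thE : (1 - th) `^ (p - 1) = b / kap.
  by rewrite /th opprB addrCA subrr addr0 -powRrM mulVf ?gt_eqF// powRr1// ltW.
have th01 : 0 < th < 1.
  have h1 : 0 < (b / kap) `^ (p - 1)^-1 by rewrite powR_gt0.
  have h2 : (b / kap) `^ (p - 1)^-1 < 1.
    have e1 : 1 `^ (p - 1)^-1 = 1 :> R by rewrite powR1.
    rewrite -[X in _ < X]e1.
    apply: gt0_ltr_powR; rewrite ?nnegrE ?invr_gt0 ?(ltW bk0)// ltr_pdivrMr ?mul1r//; lra.
  by rewrite /th; apply/andP; split; lra.
have kapN0 : kap != 0 by rewrite gt_eqF//; lra.
pose I0 := t `^ (p - 1) * m; have I00 : 0 < I0 by rewrite mulr_gt0// powR_gt0.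
pose Mp := M `^ (p - 1); have Mp0 : 0 < Mp by rewrite powR_gt0.
pose gI := (b - 1) * I0; have gI0 : 0 < gI by rewrite mulr_gt0// subr_gt0.
(* As 2 r0 <= 1 and n > 0, the removed cube has volume at most 2 r0 and costs at most half of the
   margin [gI]. *)
pose r0 := Num.min 2^-1 (gI / (4 * b * Mp)).
have r00 : 0 < r0.
  by rewrite lt_min invr_gt0 ltr0n/= divr_gt0// !mulr_gt0//; lra.
have r0M : b * (Mp * (2 * r0) ^+ n) <= gI / 2.
  have h1 : (2 * r0) ^+ n <= 2 * r0.
    have h2 : 0 <= 2 * r0 <= 1.
      rewrite mulr_ge0 ?(ltW r00)//=.
      have : r0 <= 2^-1 by rewrite /r0 ge_min lexx.
      lra.
    case/andP : h2 => h2 h3; rewrite -[leRHS]expr1; exact: ler_wiXn2l.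
  have h4 : r0 <= gI / (4 * b * Mp) by rewrite /r0 ge_min lexx orbT.
  move: h4; rewrite ler_pdivlMr ?mulr_gt0//; last lra.
  have bM : 0 < b * Mp by rewrite mulr_gt0//; lra.
  by have := ler_wpM2l (ltW bM) h1; lra.
have scal I : I0 <= I -> dd * (I + gI / 2) + b * dd * Mp * (2 * r0) ^+ n <= b * dd * I.
  move=> II0.
  have h1 : dd * (b * (Mp * (2 * r0) ^+ n)) <= dd * (gI / 2) by rewrite ler_wpM2l// ltW.
  have h2 : dd * ((b - 1) * I0) <= dd * ((b - 1) * I).
    by rewrite ler_wpM2l ?(ltW dd0)// ler_wpM2l//; lra.
  move: h1 h2; rewrite -/gI; lra.
have [S S0 hS] := @integral_ker_near R n p s p1 s0 s1 r0 r00.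
have [T0 T00 hT] := @integral_ker_far R n p s p1 s0 r0 r00.
(* A cap for (2e / th)^(p-1) that keeps the far error [be * T0] below a quarter of [dd * gI]. *)
pose b2 := dd * gI / (8 * (T0 + 1)).
have T1 : 0 < 8 * (T0 + 1) by lra.
have b20 : 0 < b2 := divr_gt0 (mulr_gt0 dd0 gI0) T1.
pose e0 := th * b2 `^ (p - 1)^-1.
have th0 : 0 < th by case/andP: th01.
have e00 : 0 < e0 by rewrite mulr_gt0// powR_gt0.
have e0E : (e0 / th) `^ (p - 1) = b2.
  by rewrite /e0 mulrAC divff ?gt_eqF// mul1r -powRrM mulVf ?gt_eqF// powRr1// ltW.
pose cL := (2 * (n%:R * (2 * (r + r0))) / r ^+ 2) `^ p.
pose C := 2 * (cac_C p * cL * S).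
have C0 := cac_C_gt0 p.
exists r0, (dd * gI / 2), C, (e0 / 2); split.
- exact: r00.
- by rewrite divr_gt0// mulr_gt0.
- by rewrite /C mulr_ge0// mulr_ge0// mulr_ge0 ?powR_ge0// ltW.
- by rewrite divr_gt0.
move=> u x1 e t' su uM um x1O /andP[eps0 epse] t'0; set f := gap u x1 e r.
have mext := measurable_ext oO su.
(* Truncating the gap at level t' amounts to raising the barrier by t', so every level is itself an
   admissible test. *)
pose w := paraboloid (- (2 * e) + t') (2 * e / r ^+ 2) x1.
have wf x : - ext u x - w x = f x - t' by rewrite /f /gap /w /paraboloid; ring.
have wr x : w x <= 0 -> enorm (x - x1) <= r by exact: sublevel_paraboloid.
have wO : [set x | w x <= 0] `<=` Omega.
  move=> x /= /wr xr; apply: x1O => i; rewrite distrC.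
  by have := enorm_coord (x - x1) i; rewrite !mxE; lra.
have cw := compact_sublevel_paraboloid bO wO.
have [h1 h2 _] := super_barrier p1 s0 s1 oO bO O0 su cw wO.
pose v (x : Rn R n) := Num.max (- ext u x - w x) 0.
have u0 x : 0 <= ext u x by exact: ext_ge0 su.
have Aw x : 0 < - ext u x - w x -> w x <= 0 by move=> h; have := u0 x; lra.
have AO x : 0 < - ext u x - w x -> Omega x by move=> /Aw/wO.
have extM x : ext u x <= M.
  have [xO|xO] := pselect (Omega x); first by rewrite /ext zext_in// uM.
  by rewrite /ext zext_out// ltW.
pose I := fine (power_mass u).
have Ifin := power_mass_fin su M0 uM.
have IE : power_mass u = I%:E by rewrite /I fineK.
have II0 : I0 <= I by rewrite -lee_fin -IE; exact: power_mass_ge.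
pose Gam := dd * (I + gI / 2).
have Gam0 : 0 <= Gam by rewrite mulr_ge0 ?(ltW dd0)//; lra.
pose be := 2 * (2 * e / th) `^ (p - 1).
have be0 : 0 <= be by rewrite mulr_ge0 ?powR_ge0.
have beT : be * T0 <= dd * gI / 4.
  have h3 : (2 * e / th) `^ (p - 1) <= b2.
    rewrite -e0E; apply: powR_le; first exact: ltW.
      by rewrite divr_ge0 ?mulr_ge0 ?(ltW eps0) ?(ltW th0).
    rewrite ler_pM2r ?invr_gt0//; lra.
  have h4 : be * T0 <= 2 * b2 * T0 by rewrite ler_wpM2r// ler_wpM2l.
  apply: le_trans h4 _.
  have h5 : b2 * (8 * (T0 + 1)) = dd * gI by rewrite /b2 divfK// gt_eqF.
  rewrite -h5; lra.
pose h (z : Rn R n * Rn R n) : R := ker_near p s r0 z.1 z.2.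
have mh : measurable_fun setT h.
  exact: (measurable_ker_near p s r0 (@measurable_fst _ _ (Rn R n) (Rn R n)) (@measurable_snd _ _ (Rn R n) (Rn R n))).
have h0 z : 0 <= h z by exact: ker_near_ge0.
have hC x y : h (x, y) = h (y, x) by exact: ker_nearC.
have farE x y : kern_far (kerz p s) (nearb r0) (x, y) = ker_far p s r0 x y.
  by rewrite /kern_far /ker_far /nearb/= leNgt; case: ltP.
have mfar x : measurable_fun [set: Rn R n] (fun y => ker_far p s r0 x y).
  exact: (measurable_ker_far p s r0 (measurable_cst _) (@measurable_id _ _ _)).
pose L := cL * e `^ p.
have L0 : 0 <= L by rewrite mulr_ge0 ?powR_ge0.
have wL (x y : Rn R n) : nearb r0 (x, y) -> 0 < - ext u x - w x ->
    `|w x - w y| `^ p * kerz p s (x, y) <= L * h (x, y).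
  move=> xy /Aw/wr xr; rewrite /nearb/= in xy.
  exact: paraboloid_ker_near xr xy.
have ue (x : Rn R n) : 0 < - ext u x - w x -> ext u x <= 2 * e.
  rewrite /w /paraboloid => hx.
  have : 0 <= 2 * e / r ^+ 2 * enorm (x - x1) ^+ 2.
    by rewrite mulr_ge0 ?sqr_ge0// divr_ge0 ?sqr_ge0// mulr_ge0// ltW.
  lra.
have kfT x : (\int[mu]_y (kern_far (kerz p s) (nearb r0) (x, y))%:E <= T0%:E)%E.
  by under eq_integral do rewrite farE; exact: hT.
have kfG (x : Rn R n) : 0 < - ext u x - w x -> (Gam%:E <=
    \int[mu]_y ((1 - th) `^ (p - 1) * ext u y `^ (p - 1) *
      kern_far (kerz p s) (nearb r0) (x, y))%:E)%E.
  move=> /Aw/wr xr.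
  have xO : cube x r `<=` Omega := subset_trans (cube_sub_double xr) x1O.
  have key := far_mass su M0 uM r_0 r00 xO (ltW (lt_trans ltr01 b1)).
  under eq_integral do rewrite farE thE.
  rewrite IE -EFinM in key.
  rewrite -(@leeD2rE _ ((b * dd * Mp) * (2 * r0) ^+ n)%:E)//; apply: le_trans key.
  by rewrite -EFinD lee_fin; exact: scal.
have H := @super_energy _ _ _ mu p (kerz p s) (nearb r0) p1 (measurable_kerz p s)
  (kerz_ge0 p s) (kerzC p s) (measurable_nearb r0) (nearbC r0) (ext u) w h
  (lower_rhs p s Omega K u) L S (2 * e) th T0 Gam mext (measurable_paraboloid _ _ _) u0
  h1 h2 mh h0 hC L0 S0 T00 Gam0 th01 hS wL ue kfT kfG.
have mv : measurable_fun setT (v : Rn R n -> R).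
  apply: measurable_maxr; last exact: measurable_cst.
  apply: measurable_funB; last exact: measurable_paraboloid.
  exact: measurable_funN mext.
have v0 x : 0 <= v x by rewrite le_max lexx orbT.
pose V := (\int[mu]_x (v x)%:E)%E.
have Vfin : V \is a fin_num.
  rewrite ge0_fin_numE; last by apply: integral_ge0 => x _; rewrite lee_fin.
  apply: (@le_lt_trans _ _ (\int[mu]_x ((2 * e) * \1_(Omega : set (Rn R n)) x)%:E)%E).
    apply: ge0_le_integral.
    - exact: measurableT.
    - by move=> x _; rewrite lee_fin.
    - exact/measurable_EFinP.
    - exact: measurable_scaled_indic (mOmega oO).
    move=> x _; rewrite lee_fin /v; have [hx|hx] := ltP 0 (- ext u x - w x).
      rewrite indicE mem_set ?mulr1; last exact: AO.
      have := u0 x; have : 0 <= 2 * e / r ^+ 2 * enorm (x - x1) ^+ 2.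
        by rewrite mulr_ge0 ?sqr_ge0// divr_ge0 ?sqr_ge0// mulr_ge0// ltW.
      rewrite /w /paraboloid; lra.
    by rewrite mulr_ge0// mulr_ge0// ltW.
  have e2 : 0 <= 2 * e by rewrite mulr_ge0// ltW.
  rewrite (integral_scaled_indic mu (mOmega oO) e2).
  by apply: lte_mul_pinfty; rewrite ?lee_fin//; exact: Omega_fin.
pose Vr := fine V; have VE : V = Vr%:E by rewrite /Vr fineK.
have Vr0 : 0 <= Vr by rewrite -lee_fin -VE; apply: integral_ge0 => x _; rewrite lee_fin.
have TE : trunc_energy mu p (kern_near (kerz p s) (nearb r0)) (fun x => - ext u x - w x)%R 0 =
    trunc_energy mu p (kern_near (kerz p s) (nearb r0)) f t'.
  by apply: eq_integral => z _; rewrite !subr0 !wf.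
have AE : above (fun x => - ext u x - w x) 0 = above f t'.
  by apply/seteqP; split => x; rewrite /above/= wf subr_gt0.
have VfE : (\int[mu]_x (Num.max (f x - t') 0)%:E = V)%E.
  by apply: eq_integral => x _; rewrite /v wf.
have LamE : (\int[mu]_x (lower_rhs p s Omega K u * v x)%:E = (lower_rhs p s Omega K u * Vr)%:E)%E.
  under eq_integral do rewrite EFinM.
  rewrite ge0_integralZl; last 4 first.
  - exact: measurableT.
  - exact/measurable_EFinP.
  - by move=> x _; rewrite lee_fin.
  - by rewrite lee_fin lower_rhs_ge0.
  by rewrite -/V VE EFinM.
rewrite VfE VE; move: H.
rewrite TE AE -/v -/V VE LamE -!EFinM => /lee_cancel H.
have -> : (C * e `^ p)%:E = (2 * (cac_C p * L * S))%:E :> \bar R.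
  by congr _%:E; rewrite /C /L; ring.
apply: le_trans H; apply: leeD; [exact: lexx|rewrite lee_fin].
have LamI : lower_rhs p s Omega K u <= 2 * dd * I := lower_rhs_le su M0 uM.
(* 2 Gam = 2 dd I + dd gI: the first term absorbs the right-hand side, half of the second pays the
   far error, and the other half is [gam]. *)
have h3 : dd * gI / 2 <= 2 * Gam - lower_rhs p s Omega K u - 2 * (be * T0).
  by rewrite /Gam; lra.
have := ler_wpM2r Vr0 h3; rewrite /be; lra.
Qed.

End lower.

(** Each point of the compact closure of [B] has a radius that works for all nearby centres;
    compactness makes it uniform. *)
Lemma compactly_contained_cube (R : realType) (n : nat) (Omega B : set 'rV[R]_n) :
  open Omega -> bounded_set Omega -> compactly_contained B Omega ->
  exists2 r, 0 < r & forall x, B x -> cube x (2 * r) `<=` Omega.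
Proof.
move=> oO bO BO.
have cB : compact (closure B).
  apply: bounded_closed_compact; last exact: closed_closure.
  by move: bO => [M [Mr hM]]; exists M; split => // y /hM MO x /BO; exact: MO.
have nearB x : closure B x -> \forall x' \near x & r \near 0^'+,
    cube x' (2 * r) `<=` Omega.
  move=> /BO Ox; have /nbhs_ballP[e /= e0 eA] := open_nbhs_nbhs (conj oO Ox : open_nbhs x Omega).
  rewrite (cube_ball _ e0) in eA.
  exists (cube x (e / 2), [set r | 0 < r < e / 4]) => /=.
    split; first by rewrite -(cube_ball _ (divr_gt0 e0 _))//; apply: nbhsx_ballx; rewrite divr_gt0.
    near=> r; apply/andP; split; first by near: r; exact: nbhs_right_gt.
    by near: r; apply: nbhs_right_lt; rewrite divr_gt0.
  move=> [x' r] /= [xx' /andP[r0 re]] y xy; apply: eA => i.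
  rewrite (_ : x ord0 i - y ord0 i = (x ord0 i - x' ord0 i) + (x' ord0 i - y ord0 i)); last by ring.
  by rewrite (le_lt_trans (ler_normD _ _))//; have := xx' i; have := xy i; lra.
have H : \forall r \near (0 : R)^'+, closure B `<=` (fun x => cube x (2 * r) `<=` Omega).
  by apply: ((compact_near_coveringP (closure B)).1 cB).
near (0 : R)^'+ => r; exists r; first by near: r; exact: nbhs_right_gt.
move=> x Bx; have : closure B `<=` (fun x => cube x (2 * r) `<=` Omega) by near: r; exact: H.
by apply; exact: subset_closure.
Unshelve. all: by end_near.
Qed.

(** * Pointwise lower bound *)

Section lower_bound.
Context {R : realType} {n : nat}.
Variables (p s : R) (Omega K : set 'rV[R]_n) (delta : R).
Hypotheses (n_gt0 : (0 < n)%N) (p1 : 1 < p) (s0 : 0 < s) (s1 : s < 1)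
  (oO : open Omega) (bO : bounded_set Omega)
  (mK : measurable (K : set (Rn R n))) (KO : compactly_contained K Omega)
  (delta0 : 0 < delta) (O0 : Omega !=set0).
Local Notation mu := (@lebesgueRn R n).
Local Notation sol := (solution p s Omega K delta).
Local Notation ext := (ext Omega).
Local Notation gap := (gap Omega).

Let p0 : 0 < p. Proof. exact: lt_trans p1. Qed.
Let p10 : 0 < p - 1. Proof. by rewrite subr_gt0. Qed.

Lemma gap_above u x1 e r t : sol u -> 0 < e -> 0 < r -> 0 <= t ->
  above (gap u x1 e r) t `<=` cube x1 (2 * r).
Proof.
move=> su e0 r0 t0 x; rewrite /above /gap/= => tx.
have u0 : 0 <= ext u x by exact: ext_ge0 su.
have w0 : paraboloid (- (2 * e) + 0) (2 * e / r ^+ 2) x1 x <= 0 by rewrite addr0; lra.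
have xr := sublevel_paraboloid r0 e0 (lexx 0) w0.
by move=> i; have := enorm_coord (x - x1) i; rewrite !mxE distrC; lra.
Qed.

Lemma measurable_gap u x1 e r : sol u -> measurable_fun setT (gap u x1 e r).
Proof.
move=> su; apply: measurable_funB; last exact: measurable_paraboloid.
exact: measurable_funN (measurable_ext oO su).
Qed.

(** At [x1] the gap is 2e - u x1 > e, and continuity spreads this to a neighbourhood. *)
Lemma gap_measure_gt0 u x1 e r : sol u -> Omega x1 -> u x1 < e -> 0 < r ->
  (0 < mu [set x | (e <= gap u x1 e r x)%R])%E.
Proof.
move=> su Ox ue r0; pose w := paraboloid (- (2 * e)) (2 * e / r ^+ 2) x1.
have cg : (fun x => - u x - w x) x @[x --> x1] --> - u x1 - w x1.
  have cu : (fun x => - u x) x @[x --> x1] --> - u x1.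
    have h : u x @[x --> x1] --> u x1 := solution_continuous oO delta0 su Ox.
    exact: (cvgN h).
  have cw : w x @[x --> x1] --> w x1.
    by have cP := smooth_continuous (smooth_paraboloid (- (2 * e)) (2 * e / r ^+ 2) x1); exact: cP.
  exact: (cvgB cu cw).
have eg : e < - u x1 - w x1.
  by rewrite /w /paraboloid subrr enorm0 expr0n mulr0 addr0; lra.
apply: (@nbhs_measure_gt0 _ _ x1 (Omega `&` [set x | e < - u x - w x])).
- apply: filterI; first exact: open_nbhs_nbhs.
  exact: (cvgr_gt _ cg).
- by move=> x [Oy /= ey]; rewrite /gap /ext zext_in// ltW.
- rewrite (_ : [set x | _] = (gap u x1 e r) @^-1` `[e, +oo[).
    by rewrite -[X in measurable X]setTI; exact: measurable_gap.
  by apply/seteqP; split => x /=; rewrite in_itv/= andbT.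
Qed.

Lemma lower_bound (M t m : R) (B : set 'rV[R]_n) : 0 < M -> 0 < t -> 0 < m ->
  compactly_contained B Omega ->
  exists2 e : R, 0 < e & forall u, sol u -> (forall x, Omega x -> u x <= M) ->
    (m%:E <= mu (above (ext u) t))%E -> forall x, B x -> e <= u x.
Proof.
move=> M0 t0 m0 BO; have [r r_0 BO'] := compactly_contained_cube oO bO BO.
have [r0 [gam [C [eps0 [r00 gam0 C0 e00 H]]]]] :=
  lower_energy delta n_gt0 p1 s0 s1 oO bO mK KO O0 M0 t0 m0 r_0.
have c0 := cac_c_gt0 p.
(* The iteration has height e/2, and C e^p = C 2^p (e/2)^p. *)
pose E := C * 2 `^ p / cac_c p.
have E0 : 0 <= E by rewrite divr_ge0 ?(ltW c0)// mulr_ge0// powR_ge0.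
have [nu nu0 DG] := @de_giorgi_Rn R n p s n_gt0 p1 s0 r0 E r00 E0.
have fO := Omega_fin oO bO.
pose mO := fine (mu Omega).
have muO : mu Omega = mO%:E by rewrite /mO fineK// ge0_fin_numE// measure_ge0.
have mO0 : 0 <= mO by rewrite -lee_fin -muO measure_ge0.
have CmO : 0 <= 2 * C * mO / gam by rewrite divr_ge0 ?(ltW gam0)// !mulr_ge0.
(* Chebyshev at level e/2 bounds |{gap > e/2}| by (2 C |Omega| / gam) e^(p-1); [e1] brings this
   below [nu]. *)
pose A := 2 * C * mO / gam + 1.
have A0 : 0 < A by rewrite ltr_wpDl.
have nA0 : 0 < nu / A by rewrite divr_gt0.
pose e1 := (nu / A) `^ (p - 1)^-1.
have e1E : e1 `^ (p - 1) = nu / A by rewrite -powRrM mulVf ?gt_eqF// powRr1// ltW.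
pose e := Num.min eps0 e1.
have ee : e <= eps0 by rewrite /e ge_min lexx.
have e0 : 0 < e by rewrite lt_min e00 powR_gt0.
have eA : A * e `^ (p - 1) <= nu.
  rewrite mulrC -ler_pdivlMr// -e1E; apply: powR_le; [exact: ltW|exact: ltW|].
  by rewrite /e ge_min lexx orbT.
exists e => // u su uM um x1 Bx1; rewrite leNgt; apply/negP => ue.
have x1O := BO' x1 Bx1.
have Ox1 : Omega x1 by apply: BO; exact: subset_closure.
pose f := gap u x1 e r; have mf : measurable_fun setT f by exact: measurable_gap.
have mA t' := measurable_above t' mf.
have AO t' : 0 <= t' -> (mu (above f t') <= mO%:E)%E.
  move=> t'0; rewrite -muO; apply: le_measure; rewrite ?inE; [exact: mA|exact: mOmega|].
  by apply: subset_trans x1O; exact: gap_above.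
have He t' (t'0 : 0 <= t') := H u x1 e t' su uM um x1O (introT andP (conj e0 ee)) t'0.
pose h := e / 2; have h0 : 0 < h by rewrite divr_gt0.
have small : (mu (above f h) <= nu%:E)%E.
  have fin : mu (above f h) \is a fin_num.
    by rewrite ge0_fin_numE ?measure_ge0//; apply: le_lt_trans (AO h (ltW h0)) _; rewrite ltry.
  pose y := fine (mu (above f h)); have yE : mu (above f h) = y%:E by rewrite /y fineK.
  have cheb : ((h * y)%:E <= \int[mu]_x (Num.max (f x - 0) 0)%:E)%E.
    rewrite EFinM -yE -(integral_scaled_indic mu (mA h) (ltW h0)).
    apply: ge0_le_integral.
    - exact: measurableT.
    - by move=> x _; rewrite lee_fin mulr_ge0// ltW.
    - exact: measurable_scaled_indic (mA h).
    - apply/measurable_EFinP; apply: measurable_maxr; last exact: measurable_cst.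
      by apply: measurable_funB; [exact: mf|exact: measurable_cst].
    move=> x _; rewrite lee_fin indicE subr0; have [|xA] := boolP (x \in above f h).
      by rewrite inE /above/= mulr1 le_max => hx; rewrite (ltW hx).
    by rewrite mulr0 le_max lexx orbT.
  have h1 : ((gam * (h * y))%:E <= (C * e `^ p * mO)%:E)%E.
    rewrite EFinM; apply: (@le_trans _ _ (gam%:E * \int[mu]_x (Num.max (f x - 0) 0)%:E)%E).
      by apply: lee_wpmul2l; [rewrite lee_fin ltW|exact: cheb].
    apply: (@le_trans _ _ ((C * e `^ p)%:E * mu (above f 0))%E).
      apply: le_trans (He 0 (lexx 0)); rewrite leeDr// mule_ge0//.
        by rewrite lee_fin ltW.
      apply: integral_ge0 => z _; rewrite lee_fin mulr_ge0 ?powR_ge0//.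
      exact: kern_near_ge0 (kerz_ge0 p s) _.
    rewrite [X in (_ <= X)%E]EFinM; apply: lee_wpmul2l; last exact: AO.
    by rewrite lee_fin mulr_ge0 ?powR_ge0.
  rewrite yE lee_fin; apply: le_trans eA.
  move: h1; rewrite lee_fin -(powRBM p1 (ltW e0)) /h.
  set q := e `^ (p - 1) => h1.
  have q0 : 0 <= q by exact: powR_ge0.
  have h2 : e * (gam * y) <= e * (2 * C * mO * q) by lra.
  rewrite ler_pM2l// in h2.
  apply: (@le_trans _ _ (2 * C * mO / gam * q)).
    by rewrite mulrAC ler_pdivlMr// mulrC.
  by rewrite ler_wpM2r// lerDl.
(* The integral bound is spent on the first half of the height; the iteration runs from e/2 to
   [e]. *)
pose g x := f x - h.
have aE t' : above g t' = above f (h + t').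
  by apply/seteqP; split => x; rewrite /above /g/=; lra.
have mg : measurable_fun setT g by apply: measurable_funB; [exact: mf|exact: measurable_cst].
have Z : mu [set x | (h <= g x)%R] = 0%E.
  apply: (DG g h mg h0); last by rewrite aE addr0.
  move=> t' /andP[t'0 _].
  have ht' : 0 <= h + t' by rewrite addr_ge0// ltW.
  have -> : trunc_energy mu p (kern_near (kerz p s) (nearb r0)) g t' =
      trunc_energy mu p (kern_near (kerz p s) (nearb r0)) f (h + t').
    apply: eq_integral => z _; rewrite /g; congr (`|_ - _| `^ _ * _)%:E;
      congr Num.max; ring.
  rewrite aE.
  have {}He := He (h + t') ht'.
  have E1 : ((cac_c p)%:E * trunc_energy mu p (kern_near (kerz p s) (nearb r0)) f (h + t') <=
      (C * e `^ p)%:E * mu (above f (h + t')))%E.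
    apply: le_trans He; rewrite leeDl// mule_ge0//; first by rewrite lee_fin ltW.
    by apply: integral_ge0 => x _; rewrite lee_fin le_max lexx orbT.
  rewrite -lee_pdivlMl// in E1; apply: (le_trans E1).
  rewrite muleA -EFinM lee_wpmul2r// lee_fin le_eqVlt; apply/orP; left; apply/eqP.
  have e2 : e `^ p = 2 `^ p * h `^ p.
    by rewrite -powRM ?(ltW h0)//; congr (_ `^ _); rewrite /h; field.
  by rewrite e2 /E; field; rewrite gt_eqF.
have := gap_measure_gt0 su Ox1 ue r_0.
rewrite (_ : [set x | _] = [set x | h <= g x]).
  by rewrite [X in (0 < X)%E]Z ltxx.
by apply/seteqP; split => x /=; rewrite /g /h -/f; lra.
Qed.

End lower_bound.

(** * Harnack inequality *)

Section harnack.
Context {R : realType} {n : nat}.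
Variables (p s : R) (Omega K B : set 'rV[R]_n) (delta : R).
Hypotheses (n_gt0 : (0 < n)%N) (p1 : 1 < p) (s0 : 0 < s) (s1 : s < 1)
  (oO : open Omega) (bO : bounded_set Omega)
  (mK : measurable (K : set (Rn R n))) (KO : compactly_contained K Omega)
  (delta0 : 0 < delta) (BO : compactly_contained B Omega).
Local Notation mu := (@lebesgueRn R n).
Local Notation sol := (solution p s Omega K delta).

Lemma ereal_harnack (u : 'rV[R]_n -> R) (e M : R) : 0 < e -> 0 < M ->
  (forall x, B x -> e <= u x <= M) ->
  (ereal_sup [set (u x)%:E | x in B] <=
   (M / e)%:E * ereal_inf [set (u x)%:E | x in B])%E.
Proof.
move=> e0 M0 uB; apply: (@le_trans _ _ M%:E).
  by apply: ge_ereal_sup => _ [x /uB /andP[_ uM] <-]; rewrite lee_fin.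
rewrite -[X in (X%:E <= _)%E](divfK (lt0r_neq0 e0)) EFinM; apply: lee_wpmul2l.
  by rewrite lee_fin divr_ge0// ltW.
by apply: le_ereal_inf_tmp => _ [x /uB /andP[eu _] <-]; rewrite lee_fin.
Qed.

(** Both alternatives of the theorem enter only through a lower bound on |{u > t}|, abstracted here
    by [P]. The mass bound may depend on [M], which is fixed before it is invoked. *)
Lemma harnack_of_mass (P : ('rV[R]_n -> R) -> Prop) : Omega !=set0 ->
  (forall M : R, 0 < M -> exists2 t : R, 0 < t & exists2 m : R, 0 < m &
    forall u, sol u -> (forall x, Omega x -> u x <= M) -> P u ->
      (m%:E <= mu (above (ext Omega u) t))%E) ->
  exists2 C : R, 0 < C & forall u, sol u -> P u ->
    (ereal_sup [set (u x)%:E | x in B] <=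
     C%:E * ereal_inf [set (u x)%:E | x in B])%E.
Proof.
move=> O0 mass.
have [M M0 uM] := @solution_bounded R n p s Omega K delta n_gt0 p1 s0 s1 oO bO delta0 O0.
have [t t0 [m m0 um]] := mass M M0.
have [e e0 ue] := lower_bound n_gt0 p1 s0 s1 oO bO mK KO delta0 O0 M0 t0 m0 BO.
exists (M / e); first by rewrite divr_gt0.
move=> u su Pu; apply: ereal_harnack => // x Bx; apply/andP; split.
  exact: (ue u su (uM u su) (um u su (uM u su) Pu)).
by apply: uM => //; apply: BO; exact: subset_closure.
Qed.

End harnack.

Theorem corollary1p4 (R : realType) (n : nat) (p s : R)
    (Omega K B : set 'rV[R]_n) (delta D : R)
    (n_gt0 : (0 < n)%N) (p_gt1 : 1 < p) (s_gt0 : 0 < s) (s_lt1 : s < 1)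
    (Omega_open : open Omega) (Omega_bounded : bounded_set Omega)
    (K_measurable : measurable (K : set (Rn R n)))
    (K_in_Omega : compactly_contained K Omega)
    (delta_gt0 : 0 < delta) (D_gt0 : 0 < D)
    (B_in_Omega : compactly_contained B Omega) :
  let mu := @lebesgueRn R n in
  let hyp (u : 'rV[R]_n -> R) :=
    [/\ {within closure (neighborhood Omega delta), continuous u},
        in_V0 s p Omega u,
        forall x, Omega x -> 0 < u x,
        fracplap_ge s p Omega u (fun=>
          - 2 * diam Omega `^ (- (n%:R + p * s)) *
          \int[mu]_(y in K) (u y `^ (p - 1))) &
        fracplap_le s p Omega u (fun=> 1)] in
  let harnack (C : R) (u : 'rV[R]_n -> R) :=
    (ereal_sup [set (u x)%:E | x in B]
       <= C%:E * ereal_inf [set (u x)%:E | x in B])%E in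
  (forall x0 : 'rV[R]_n, (Omega `\` K) x0 ->
     exists2 C : R, 0 < C &
       forall u, hyp u -> D <= u x0 -> harnack C u) /\
  (forall q : R, 1 <= q ->
     exists2 C : R, 0 < C &
       forall u, hyp u -> (D%:E <= LpNorm mu (Omega `\` K) q u)%E ->
         harnack C u).
Proof.
move=> mu hyp harnack.
have solE u : hyp u -> solution p s Omega K delta u.
  case=> cu V0 u0 ge1 le1; split => //.
  by move: ge1; congr (fracplap_ge _ _ _ _ _); apply/funext => _; rewrite /lower_rhs !mulNr.
split=> [x0 [Ox0 nKx0]|q q1].
  have O0 : Omega !=set0 by exists x0.
  have mass M : 0 < M -> exists2 t : R, 0 < t & exists2 m : R, 0 < m &
      forall u, solution p s Omega K delta u -> (forall x, Omega x -> u x <= M) ->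
        D <= u x0 -> (m%:E <= mu (above (ext Omega u) t))%E.
    move=> M0; exists (D / 4); first by rewrite divr_gt0.
    by apply: point_mass.
  have [C C0 H] := harnack_of_mass n_gt0 p_gt1 s_gt0 s_lt1 Omega_open Omega_bounded
    K_measurable K_in_Omega delta_gt0 B_in_Omega O0 mass.
  by exists C => // u /solE su; exact: H.
have [ne|nO] := pselect (Omega !=set0).
  have mass M : 0 < M -> exists2 t : R, 0 < t & exists2 m : R, 0 < m &
      forall u, solution p s Omega K delta u -> (forall x, Omega x -> u x <= M) ->
        (D%:E <= LpNorm mu (Omega `\` K) q u)%E ->
        (m%:E <= mu (above (ext Omega u) t))%E.
    by move=> M0; apply: norm_mass.
  have [C C0 H] := harnack_of_mass n_gt0 p_gt1 s_gt0 s_lt1 Omega_open Omega_bounded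
    K_measurable K_in_Omega delta_gt0 B_in_Omega ne mass.
  by exists C => // u /solE su; exact: H.
(* If [Omega] is empty, so is [B], and the supremum over the empty set is -oo. *)
exists 1 => // u _ _; rewrite /harnack (_ : B = set0) ?image_set0 ?ereal_sup0 ?leNye//.
by apply/seteqP; split => x // Bx; apply: nO; exists x; apply: B_in_Omega; exact: subset_closure.
Qed.
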